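(* There are unique analytic functions $B_1,B_2:T\to\mathbb R$ and $B_3:T\to\mathbb C$ such that $B_1$ does not depend on the variable $t_1$ and, for all $t=(t_1,t_2,t_3)\in T$, $k\in\mathbb C^*$ and $k'\in\mathbb C$: (1) $B_1\circ g(z)=\operatorname{Im}(z)$ for $z\in\mathbb H$, and $B_1(t_1,t_2k^{-4},t_3k^{-6})=B_1(t)|k|^2$; (2) $B_2\circ g=0$, and $B_2(t_1k^{-2}+k'k^{-1},t_2k^{-4},t_3k^{-6})=B_1(t)|k'|^2+B_2(t)|k^{-1}|^2+\operatorname{Im}\big(B_3(t)k'\overline{k^{-1}}\big)$; (3) $B_3\circ g=1$, and $B_3(t_1k^{-2}+k'k^{-1},t_2k^{-4},t_3k^{-6})=B_3(t)k\overline{k^{-1}}+2\sqrt{-1}\,k\overline{k'}B_1(t)$. Moreover, $|B_3|$ is identically $1$ on the zero locus of $B_2$.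
   Context: Let $\mathbb H=\{z\in\mathbb C:\operatorname{Im} z>0\}$, $q=e^{2\pi iz}$, $\sigma_r(n)=\sum_{d\mid n}d^r$, and let $g_1=a_1\big(1-24\sum_{n\ge1}\sigma_1(n)q^n\big)$, $g_2=a_2\big(1+240\sum_{n\ge1}\sigma_3(n)q^n\big)$, $g_3=a_3\big(1-504\sum_{n\ge1}\sigma_5(n)q^n\big)$ with $a_1=\frac{2\pi i}{12}$, $a_2=12\left(\frac{2\pi i}{12}\right)^2$, $a_3=8\left(\frac{2\pi i}{12}\right)^3$. Let $g=(g_1,g_2,g_3):\mathbb H\to\mathbb C^3$ and $T=\mathbb C^3\setminus\{(t_1,t_2,t_3)\in\mathbb C^3: 27t_3^2-t_2^3=0\}$ (the image of $g$ lies in $T$). *)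

(* Defs.v *)
(* Built on MathComp-Analysis; the field of complex numbers is R[i], with
   R : realType arbitrary. *)
From HB Require Import structures.
From mathcomp Require Import all_boot all_order all_algebra.
From mathcomp Require Import complex.
From mathcomp Require Import all_classical all_reals all_analysis.

Set Implicit Arguments.
Unset Strict Implicit.
Unset Printing Implicit Defensive.

Import Order.TTheory GRing.Theory Num.Theory numFieldNormedType.Exports.

Local Open Scope classical_set_scope.
Local Open Scope ring_scope.

Definition cexp (R : realType) (z : R[i]) : R[i] :=
  (expR (complex.Re z))%:C%C *
    Complex (cos (complex.Im z)) (sin (complex.Im z)).

Definition sigma (r n : nat) : nat := \sum_(d <- divisors n) d ^ r.

(* 2 pi i *)
Definition two_pi_i (R : realType) : R[i] := Complex 0 (2 * pi).

Definition nome (R : realType) (z : R[i]) : R[i] := cexp (two_pi_i R * z).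

(* The cast to R[i]^o selects the topology of R[i] given by its own norm. *)
Definition sigma_series (R : realType) (r : nat) (z : R[i]) : R[i] :=
  limn (fun N => \sum_(1 <= n < N) (sigma r n)%:R * nome z ^+ n : R[i]^o).

Definition g1 (R : realType) (z : R[i]) : R[i] :=
  (two_pi_i R / 12) * (1 - 24 * sigma_series 1 z).

Definition g2 (R : realType) (z : R[i]) : R[i] :=
  12 * (two_pi_i R / 12) ^+ 2 * (1 + 240 * sigma_series 3 z).

Definition g3 (R : realType) (z : R[i]) : R[i] :=
  8 * (two_pi_i R / 12) ^+ 3 * (1 - 504 * sigma_series 5 z).

Definition vec3 (R : realType) (t1 t2 t3 : R[i]) : 'rV[R[i]]_3 :=
  \row_(j < 3) [:: t1; t2; t3]`_j.

Definition g (R : realType) (z : R[i]) : 'rV[R[i]]_3 :=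
  vec3 (g1 z) (g2 z) (g3 z).

(* Column indices start at 0: t 0 1 and t 0 2 are the mathematical t_2, t_3. *)
Definition T (R : realType) : set 'rV[R[i]]_3 :=
  ~` [set t | 27 * t 0 2 ^+ 2 - t 0 1 ^+ 3 = 0].

(* Near x, f is the sum of an absolutely convergent power series in the
   coordinates of h = y - x, indexed by multi-indices a; by absolute
   convergence the sum may be taken along the boxes {0, ..., N-1}^n. *)
Definition real_analytic_at (R : realType) (n : nat) (f : 'rV[R]_n -> R)
    (x : 'rV[R]_n) : Prop :=
  exists (c : {ffun 'I_n -> nat} -> R) (r : R), 0 < r /\
    forall h : 'rV[R]_n, (forall i, `|h 0 i| < r) ->
      summable [set: {ffun 'I_n -> nat}]
        (fun a => (c a * \prod_(i < n) h 0 i ^+ a i)%:E) /\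
      (fun N : nat => \sum_(a : {ffun 'I_n -> 'I_N})
          c [ffun i => nat_of_ord (a i)] * \prod_(i < n) h 0 i ^+ a i)
        @ \oo --> f (x + h).

(* The identification of R^n x R^n with C^n sending (u, v) to u + i v. *)
Definition to_complex (R : realType) (n : nat) (x : 'rV[R]_(n + n)) :
    'rV[R[i]]_n :=
  \row_(j < n) Complex (x 0 (lshift n j)) (x 0 (rshift n j)).

(* Meant for open A: f is a total function whose values outside A are
   irrelevant. *)
Definition real_analytic_on (R : realType) (n : nat) (A : set 'rV[R[i]]_n)
    (f : 'rV[R[i]]_n -> R) : Prop :=
  forall x : 'rV[R]_(n + n), A (to_complex x) ->
    real_analytic_at (f \o @to_complex R n) x.

Definition complex_analytic_on (R : realType) (n : nat) (A : set 'rV[R[i]]_n)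
    (f : 'rV[R[i]]_n -> R[i]) : Prop :=
  real_analytic_on A (fun t => complex.Re (f t)) /\
  real_analytic_on A (fun t => complex.Im (f t)).

Definition B1_equations (R : realType) (B1 : 'rV[R[i]]_3 -> R) : Prop :=
  (forall z : R[i], 0 < complex.Im z -> B1 (g z) = complex.Im z) /\
  (forall t1 t2 t3 k : R[i], T (vec3 t1 t2 t3) -> k != 0 ->
    B1 (vec3 t1 (t2 * k ^- 4) (t3 * k ^- 6)) =
    B1 (vec3 t1 t2 t3) * Normc.normc k ^+ 2).

Definition B2_equations (R : realType) (B1 B2 : 'rV[R[i]]_3 -> R)
    (B3 : 'rV[R[i]]_3 -> R[i]) : Prop :=
  (forall z : R[i], 0 < complex.Im z -> B2 (g z) = 0) /\
  (forall t1 t2 t3 k k' : R[i], T (vec3 t1 t2 t3) -> k != 0 ->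
    B2 (vec3 (t1 * k ^- 2 + k' * k^-1) (t2 * k ^- 4) (t3 * k ^- 6)) =
    B1 (vec3 t1 t2 t3) * Normc.normc k' ^+ 2 +
    B2 (vec3 t1 t2 t3) * Normc.normc k^-1 ^+ 2 +
    complex.Im (B3 (vec3 t1 t2 t3) * k' * conjc k^-1)).

Definition B3_equations (R : realType) (B1 : 'rV[R[i]]_3 -> R)
    (B3 : 'rV[R[i]]_3 -> R[i]) : Prop :=
  (forall z : R[i], 0 < complex.Im z -> B3 (g z) = 1) /\
  (forall t1 t2 t3 k k' : R[i], T (vec3 t1 t2 t3) -> k != 0 ->
    B3 (vec3 (t1 * k ^- 2 + k' * k^-1) (t2 * k ^- 4) (t3 * k ^- 6)) =
    B3 (vec3 t1 t2 t3) * k * conjc k^-1 +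
    2 * Complex 0 1 * k * conjc k' * (B1 (vec3 t1 t2 t3))%:C%C).

Definition B_conditions (R : realType) (B1 B2 : 'rV[R[i]]_3 -> R)
    (B3 : 'rV[R[i]]_3 -> R[i]) : Prop :=
  [/\ real_analytic_on (@T R) B1,
      real_analytic_on (@T R) B2 &
      complex_analytic_on (@T R) B3] /\
  (forall t1 t1' t2 t3 : R[i], T (vec3 t1 t2 t3) ->
    B1 (vec3 t1' t2 t3) = B1 (vec3 t1 t2 t3)) /\
  [/\ B1_equations B1, B2_equations B1 B2 B3 & B3_equations B1 B3].

(* Main.v *)
(* Write the points of T as t = (g1 z l^2 + k' l, g2 z l^4, g3 z l^6) with z in the
   upper half plane and l = 1/k. The equations express B1, B2, B3 at t in terms of
   (z, l, k'), so uniqueness is the surjectivity of this parametrization. Existence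
   holds because (g2 z l^4, g3 z l^6) determines (z, l) up to SL2(Z), and the
   quasi-modularity of g1 makes the three expressions invariant. They are analytic
   since the Jacobian of (z, l) |-> (g2 z l^4, g3 z l^6) is a multiple of the
   discriminant, which does not vanish, so (z, l) has local power series inverses.
   Finally |B3|^2 = 1 + 4 B1 B2.

   Modularity. Ramanujan's differential equations for g1, g2, g3 come from an
   elementary manipulation of divisor sums. Lipschitz' formula gives the functional
   equation of g2 under z |-> -1/z, and differentiating it yields those of g3 and g1.

   Bijectivity. With J = g2^3 / disc, a point of a fundamental domain minimizing
   |J - j| has J = j, since near any point (z, l) all nearby values are taken. A pair
   of inequivalent points with the same image would exist with |J| maximal, since
   exp(2 pi i z) is a function of J near the cusp; perturbing it increases |J|. *)
Require Import Defs.
From HB Require Import structures.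
From mathcomp Require Import all_boot all_order all_algebra.
From mathcomp Require Import complex.
From mathcomp Require Import all_classical all_reals all_analysis.
From mathcomp Require Import ring lra zify.

Set Implicit Arguments.
Unset Strict Implicit.
Unset Printing Implicit Defensive.

Import Order.TTheory GRing.Theory Num.Theory numFieldNormedType.Exports.

Local Open Scope classical_set_scope.
Local Open Scope ring_scope.

(** The complex analysis rests on one device: power series on a real box, normed by the sum of |c_a|
    r^|a|. The three functions involve conjugates, so they are analytic in six real variables and
    not holomorphic in three; an algebra with real variables and complex coefficients contains both
    kinds of functions. Estimates are proved for arbitrary elements of it. In zero variables it is
    the field C, so the same estimates also yield complex derivatives, local injectivity and
    openness. Contour integrals and the valence formula are replaced by extremal arguments along
    sequences. At the orbits of i and of a cube root of unity J is ramified; the perturbations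
    therefore act on the pair (g2 l^4, g3 l^6), where the parametrization is a local isomorphism.
    The divisor sum identities come from the forms a^2 - a b + b^2 and a b (a - b). They precede
    modularity, because the functional equations of g3 and g1 are found by differentiating that of
    g2 with their help. *)

Notation nm := (@Normc.normc _).

(** * Norms and unconditional sums *)

Section Norm.
Variable R : realType.
Implicit Types x y z : R[i].

Lemma normrC z : `|z| = (nm z)%:C%C. Proof. by case: z. Qed.

Lemma nm_ge0 z : 0 <= nm z. Proof. by case: z => a b; exact: sqrtr_ge0. Qed.

Lemma nm0 : nm (0 : R[i]) = 0. Proof. exact: Normc.normc0. Qed.

Lemma nm1 : nm (1 : R[i]) = 1. Proof. exact: Normc.normc1. Qed.

Lemma nm_eq0 z : (nm z == 0) = (z == 0).
Proof.
by apply/eqP/eqP => [/Normc.eq0_normc|->]; rewrite ?nm0.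
Qed.

Lemma nm_gt0 z : (0 < nm z) = (z != 0).
Proof. by rewrite lt_def nm_ge0 nm_eq0 andbT. Qed.

Lemma nmM x y : nm (x * y) = nm x * nm y. Proof. exact: Normc.normcM. Qed.

Lemma nmV x : nm x^-1 = (nm x)^-1. Proof. exact: Normc.normcV. Qed.

Lemma nmX x n : nm (x ^+ n) = nm x ^+ n.
Proof. by elim: n => [|n IH]; rewrite ?expr0 ?nm1 // !exprS nmM IH. Qed.

Lemma nmD x y : nm (x + y) <= nm x + nm y. Proof. exact: le_normcD. Qed.

Lemma nmN x : nm (- x) = nm x. Proof. exact: normcN. Qed.

Lemma nmBC x y : nm (x - y) = nm (y - x). Proof. by rewrite -nmN opprB. Qed.

Lemma nmB x y : nm (x - y) <= nm x + nm y.
Proof. by rewrite -(nmN y) nmD. Qed.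

Lemma nm_le_add x y : nm x <= nm (x - y) + nm y.
Proof. by rewrite -{1}(subrK y x) nmD. Qed.

Lemma nm_tri x y z : nm (x - z) <= nm (x - y) + nm (y - z).
Proof. by rewrite -(subrKA y x) nmD. Qed.

Lemma nm_real (a : R) : nm a%:C%C = `|a|.
Proof. by rewrite /= expr0n addr0 sqrtr_sqr. Qed.

Lemma nm_nat n : nm (n%:R : R[i]) = n%:R.
Proof.
by rewrite -(rmorph_nat (real_complex R)) nm_real ger0_norm // ler0n.
Qed.

Lemma nm_i : nm (Complex 0 1 : R[i]) = 1.
Proof. by rewrite /= expr0n expr1n add0r sqrtr1. Qed.

Lemma nmJ z : nm (conjc z) = nm z.
Proof. by case: z => a b /=; rewrite sqrrN. Qed.

Lemma nm_sqr z : nm z ^+ 2 = complex.Re z ^+ 2 + complex.Im z ^+ 2.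
Proof. by case: z => a b /=; rewrite sqr_sqrtr // addr_ge0 // sqr_ge0. Qed.

Lemma nm_Re z : `|complex.Re z| <= nm z.
Proof.
case: z => a b /=; rewrite -sqrtr_sqr ler_sqrt ?addr_ge0 ?sqr_ge0 //.
by rewrite lerDl sqr_ge0.
Qed.

Lemma nm_Im z : `|complex.Im z| <= nm z.
Proof.
case: z => a b /=; rewrite -sqrtr_sqr ler_sqrt ?addr_ge0 ?sqr_ge0 //.
by rewrite lerDr sqr_ge0.
Qed.

Lemma nm_le_ReIm z : nm z <= `|complex.Re z| + `|complex.Im z|.
Proof.
rewrite -(@ler_pXn2r _ 2) ?nnegrE ?nm_ge0 ?addr_ge0 // nm_sqr sqrrD.
by rewrite !real_normK ?num_real // addrAC lerDl mulrn_wge0 // mulr_ge0.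
Qed.

Lemma nm_sum (I : Type) (s : seq I) (P : pred I) (F : I -> R[i]) :
  nm (\sum_(i <- s | P i) F i) <= \sum_(i <- s | P i) nm (F i).
Proof.
elim/big_rec2: _ => [|i y x _ le_xy]; first by rewrite nm0.
by apply: le_trans (nmD _ _) _; rewrite lerD2l.
Qed.

Lemma nm_prod (I : Type) (s : seq I) (P : pred I) (F : I -> R[i]) :
  nm (\prod_(i <- s | P i) F i) = \prod_(i <- s | P i) nm (F i).
Proof. by apply: (big_morph _ nmM nm1). Qed.

Lemma nm_eps_eq0 z : (forall e : R, 0 < e -> nm z <= e) -> z = 0.
Proof.
move=> h; apply/eqP; rewrite -nm_eq0 eq_le nm_ge0 andbT.
by apply/ler_addgt0Pl => e e0; rewrite addr0 h.
Qed.

Lemma nm_eps_eq x y : (forall e : R, 0 < e -> nm (x - y) <= e) -> x = y.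
Proof. by move=> h; apply/eqP; rewrite -subr_eq0; apply/eqP/nm_eps_eq0. Qed.

End Norm.

(** * Unconditional summation of complex families *)

Section UnconditionalSums.
Variable R : realType.
Local Notation C := R[i].

(* Unconditional summation; since the index type is arbitrary, double series can be
   reindexed and rearranged freely. *)
Definition sums_to (I : eqType) (a : I -> C) (l : C) : Prop :=
  forall e : R, 0 < e -> exists s0 : seq I, forall s, uniq s ->
    {subset s0 <= s} -> nm (\sum_(i <- s) a i - l) <= e.

(** Absolute summability carries an explicit bound, because these bounds become the norms in the
    algebra [nb]. *)
Definition abs_le (I : eqType) (a : I -> C) (M : R) : Prop :=
  forall s, uniq s -> \sum_(i <- s) nm (a i) <= M.

Lemma sums_to_ext (I : eqType) (a b : I -> C) l : a =1 b -> sums_to a l -> sums_to b l.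
Proof.
move=> ab ha e /ha[s0 hs]; exists s0 => s us ss.
under eq_bigr do rewrite -ab; exact: hs.
Qed.

Lemma sums_to_unique (I : eqType) (a : I -> C) l l' : sums_to a l -> sums_to a l' -> l = l'.
Proof.
move=> h h'; apply: nm_eps_eq => e e0.
have [s hs] := h _ (divr_gt0 e0 (ltr0Sn _ 1)); have [s' hs'] := h' _ (divr_gt0 e0 (ltr0Sn _ 1)).
have := hs (undup (s ++ s')) (undup_uniq _).
have := hs' (undup (s ++ s')) (undup_uniq _).
have h1 : {subset s <= undup (s ++ s')}.
  by move=> x; rewrite mem_undup mem_cat => ->.
have h2 : {subset s' <= undup (s ++ s')}.
  by move=> x; rewrite mem_undup mem_cat => ->; rewrite orbT.
move=> /(_ h2) H2 /(_ h1) H1.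
apply: le_trans (nm_tri _ (\sum_(i <- undup (s ++ s')) a i) _) _.
by rewrite nmBC (splitr e) lerD.
Qed.

Lemma sums_to_fin (I : eqType) (a : I -> C) (s0 : seq I) : uniq s0 ->
  (forall i, i \notin s0 -> a i = 0) -> sums_to a (\sum_(i <- s0) a i).
Proof.
move=> us0 h e e0; exists s0 => s us ss.
rewrite (bigID [in s0]) /= [X in _ + X - _]big1 ?addr0; last first.
  by move=> i /h.
rewrite -big_filter (perm_big s0) ?subrr ?nm0 ?ltW //.
apply: uniq_perm; rewrite ?filter_uniq // => x; rewrite mem_filter.
by apply/andP/idP => [[]//|xs]; split => //; exact: ss.
Qed.

Lemma HS0 (I : eqType) (a : I -> C) : (forall i, a i = 0) -> sums_to a 0.
Proof.
move=> h; have := @sums_to_fin I a [::] isT; rewrite big_nil; apply.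
by move=> i _; exact: h.
Qed.

Lemma sums_to_add (I : eqType) (a b : I -> C) l m :
  sums_to a l -> sums_to b m -> sums_to (fun i => a i + b i) (l + m).
Proof.
move=> h h' e e0.
have [s hs] := h _ (divr_gt0 e0 (ltr0Sn _ 1)); have [s' hs'] := h' _ (divr_gt0 e0 (ltr0Sn _ 1)).
exists (s ++ s') => t ut st; rewrite big_split /= opprD addrACA.
apply: le_trans (nmD _ _) _; rewrite (splitr e) lerD //.
  by apply: hs => // x xs; apply: st; rewrite mem_cat xs.
by apply: hs' => // x xs; apply: st; rewrite mem_cat xs orbT.
Qed.

Lemma sums_to_scale (I : eqType) (a : I -> C) c l :
  sums_to a l -> sums_to (fun i => c * a i) (c * l).
Proof.
move=> h e e0.
have c0 : 0 < nm c + 1 by rewrite ltr_wpDl // nm_ge0.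
have [s hs] := h _ (divr_gt0 e0 c0).
exists s => t ut st; rewrite -mulr_sumr -mulrBr nmM.
apply: le_trans (ler_wpM2l (nm_ge0 _) (hs t ut st)) _.
rewrite mulrCA ger_pMr // ler_pdivrMr // mul1r lerDl //.
Qed.

Lemma sums_to_sub (I : eqType) (a b : I -> C) l m :
  sums_to a l -> sums_to b m -> sums_to (fun i => a i - b i) (l - m).
Proof.
move=> ha /(sums_to_scale (-1)) hb; have := sums_to_add ha hb.
by rewrite mulN1r; apply: sums_to_ext => i; rewrite mulN1r.
Qed.

Lemma sums_to_sum (I : eqType) (J : Type) (s : seq J) (P : pred J)
    (a : J -> I -> C) (l : J -> C) : (forall j, P j -> sums_to (a j) (l j)) ->
  sums_to (fun i => \sum_(j <- s | P j) a j i) (\sum_(j <- s | P j) l j).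
Proof.
move=> h; elim: s => [|j s IH].
  by rewrite big_nil; apply: HS0 => i; rewrite big_nil.
rewrite big_cons; case: ifPn => Pj.
  by apply: sums_to_ext (sums_to_add (h _ Pj) IH) => i; rewrite big_cons Pj.
by apply: sums_to_ext IH => i; rewrite big_cons (negbTE Pj).
Qed.

Lemma abs_le_ge0 (I : eqType) (a : I -> C) M : abs_le a M -> 0 <= M.
Proof. by move=> /(_ [::] isT); rewrite big_nil. Qed.

Lemma abs_le_le (I : eqType) (a b : I -> C) M N : (forall i, nm (a i) <= nm (b i)) ->
  M <= N -> abs_le b M -> abs_le a N.
Proof.
move=> ab MN hb s us; apply: le_trans MN; apply: le_trans (hb s us).
exact: ler_sum.
Qed.

Lemma abs_le_ext (I : eqType) (a b : I -> C) M : a =1 b -> abs_le a M -> abs_le b M.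
Proof. by move=> ab; apply: abs_le_le => // i; rewrite ab. Qed.

Lemma abs_le_scale (I : eqType) (a : I -> C) c M :
  abs_le a M -> abs_le (fun i => c * a i) (nm c * M).
Proof.
move=> h s us; under eq_bigr do rewrite nmM.
by rewrite -mulr_sumr ler_wpM2l ?nm_ge0 ?h.
Qed.

Lemma abs_le_add (I : eqType) (a b : I -> C) M N :
  abs_le a M -> abs_le b N -> abs_le (fun i => a i + b i) (M + N).
Proof.
move=> h h' s us; apply: le_trans (lerD (h s us) (h' s us)).
by rewrite -big_split /=; apply: ler_sum => i _; exact: nmD.
Qed.

Lemma sums_to_nm (I : eqType) (a : I -> C) l M : sums_to a l -> abs_le a M -> nm l <= M.
Proof.
move=> h ha; apply/ler_addgt0Pl => e /h[s hs].
apply: le_trans (nm_le_add _ (\sum_(i <- undup s) a i)) _.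
rewrite nmBC lerD //.
  by apply: hs (undup_uniq _) _ => x; rewrite mem_undup.
apply: le_trans (nm_sum _ _ _) _; exact: ha (undup_uniq _).
Qed.

Lemma ler_sum_sub (I : eqType) (s s' : seq I) (F : I -> R) :
  uniq s -> {subset s <= s'} -> (forall i, 0 <= F i) ->
  \sum_(i <- s) F i <= \sum_(i <- s') F i.
Proof.
elim: s s' => [|x s IH] s' /=; first by move=> _ _ F0; rewrite big_nil sumr_ge0.
move=> /andP[xs us] ss F0.
have xs' : x \in s' by apply: ss; rewrite mem_head.
rewrite big_cons (perm_big _ (perm_to_rem xs')) big_cons lerD2l IH // => y ys.
have := ss y; rewrite inE ys orbT => /(_ isT) ys'.
have := perm_mem (perm_to_rem xs') y; rewrite ys' inE => /esym/orP[/eqP yx|//].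
by rewrite -yx ys in xs.
Qed.

(** The limit is the supremum of the finite partial sums; this is where completeness of the reals
    enters. *)
Lemma sums_to_exists_pos (I : eqType) (b : I -> R) (M : R) : (forall i, 0 <= b i) ->
  (forall s, uniq s -> \sum_(i <- s) b i <= M) ->
  exists l : R, sums_to (fun i => (b i)%:C%C) l%:C%C.
Proof.
move=> b0 h.
pose A := [set x : R | exists2 s : seq I, uniq s & x = \sum_(i <- s) b i].
have hA : has_sup A.
  by split; [exists 0, [::] => //; rewrite big_nil | exists M => x [s us ->]; exact: h].
exists (sup A) => e e0.
have [x [s0 us0 ->] hx] := sup_adherent e0 hA.
exists s0 => s us ss.
rewrite -rmorph_sum -rmorphB nm_real distrC ger0_norm ?subr_ge0; last first.
  by apply: sup_upper_bound => //; exists s.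
rewrite lerBlDr -lerBlDl; apply: le_trans (ltW hx) _.
exact: ler_sum_sub.
Qed.

Lemma sums_to_exists (I : eqType) (a : I -> C) M : abs_le a M -> exists l, sums_to a l.
Proof.
move=> h.
(* For [f] the real or the imaginary part, the real family is split into its positive and negative
   parts. *)
have aux (f : C -> R) : (forall z, `|f z| <= nm z) ->
    exists l : R, sums_to (fun i => (f (a i))%:C%C) l%:C%C.
  move=> hf.
  have [|s us|l1 h1] := @sums_to_exists_pos I (fun i => Num.max (f (a i)) 0) M.
  - by move=> i; rewrite le_max lexx orbT.
  - apply: le_trans (h s us); apply: ler_sum => i _.
    by rewrite ge_max nm_ge0 andbT (le_trans (ler_norm _)).
  have [|s us|l2 h2] := @sums_to_exists_pos I (fun i => Num.max (- f (a i)) 0) M.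
  - by move=> i; rewrite le_max lexx orbT.
  - apply: le_trans (h s us); apply: ler_sum => i _.
    by rewrite ge_max nm_ge0 andbT (le_trans (ler_norm _)) // normrN.
  exists (l1 - l2); rewrite rmorphB; apply: sums_to_ext (sums_to_sub h1 h2) => i /=.
  rewrite -[in RHS](subr0 (f (a i))) -rmorphB; congr (_%:C)%C.
  by case: (lerP (f (a i)) 0) => H; rewrite /Num.max; case: ltP; case: ltP; lra.
have [l1 h1] := aux _ (@nm_Re R); have [l2 h2] := aux _ (@nm_Im R).
exists (l1%:C%C + Complex 0 1 * l2%:C%C).
apply: sums_to_ext (sums_to_add h1 (sums_to_scale (Complex 0 1) h2)) => i.
by rewrite [RHS]complexE.
Qed.

Lemma abs_le_inj (I J : eqType) (f : J -> I) (a : I -> C) M : injective f ->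
  abs_le a M -> abs_le (a \o f) M.
Proof.
move=> fi h s us; have := h (map f s); rewrite big_map; apply.
by rewrite map_inj_uniq.
Qed.

Lemma sum_pmap (V : nmodType) (I J : eqType) (f : J -> I) (g : I -> option J)
  (a : I -> V) (s : seq I) : ocancel g f ->
  (forall i, g i = None -> a i = 0) ->
  \sum_(j <- pmap g s) a (f j) = \sum_(i <- s) a i.
Proof.
move=> gf a0; elim: s => [|x s IH] /=; first by rewrite !big_nil.
rewrite big_cons -IH; have := gf x; have := a0 x.
case: (g x) => [j _ /= fj|/(_ erefl) -> _] /=; last by rewrite add0r.
by rewrite big_cons fj.
Qed.

Lemma inj_pinv (I J : Type) (f : J -> I) : injective f ->
  exists g : I -> option J, ocancel g f /\ pcancel f g.
Proof.
move=> fi; exists (fun i => if pselect (exists j, f j = i) is left h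
  then Some (projT1 (cid h)) else None); split=> [i|j].
  by case: pselect => //= h; case: cid.
case: pselect => [h|[]]; last by exists j.
by congr Some; apply: fi; case: cid.
Qed.

Lemma sums_to_inj (I J : eqType) (f : J -> I) (a : I -> C) l : injective f ->
  (forall i, (forall j, f j != i) -> a i = 0) -> sums_to (a \o f) l -> sums_to a l.
Proof.
move=> fi a0 h e /h[s0 hs]; exists (map f s0) => s us ss.
have [g [gf fg]] := inj_pinv fi.
have a0' i : g i = None -> a i = 0.
  by move=> gi; apply: a0 => j; apply/eqP => ji; rewrite -ji fg in gi.
rewrite -(sum_pmap s gf a0'); apply: hs; first exact: (pmap_uniq gf).
move=> j js; rewrite mem_pmap; apply/mapP; exists (f j) => //.
by apply: ss; exact: map_f.
Qed.

Lemma abs_le_inj_ext (I J : eqType) (f : J -> I) (a : I -> C) M : injective f ->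
  (forall i, (forall j, f j != i) -> a i = 0) -> abs_le (a \o f) M -> abs_le a M.
Proof.
move=> fi a0 h s us.
have [g [gf fg]] := inj_pinv fi.
have a0' i : g i = None -> nm (a i) = 0.
  move=> gi; rewrite a0 ?nm0 // => j; apply/eqP => ji; by rewrite -ji fg in gi.
by rewrite -(sum_pmap (a := nm \o a) s gf a0'); apply: h; exact: (pmap_uniq gf).
Qed.

(** The bound provides some limit of the pulled back family, and uniqueness of limits identifies
    it. *)
Lemma sums_to_inj_ext (I J : eqType) (f : J -> I) (a : I -> C) l M : injective f ->
  (forall i, (forall j, f j != i) -> a i = 0) -> abs_le (a \o f) M ->
  sums_to a l -> sums_to (a \o f) l.
Proof.
move=> fi a0 ha h; have [l' h'] := sums_to_exists ha.
by rewrite (sums_to_unique h (sums_to_inj fi a0 h')).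
Qed.

Lemma sums_to_bij (I J : eqType) (f : J -> I) (a : I -> C) l : bijective f ->
  sums_to (a \o f) l -> sums_to a l.
Proof.
move=> bf; apply: sums_to_inj; first exact: bij_inj.
by case: bf => g fg gf i /(_ (g i)); rewrite gf eqxx.
Qed.

Lemma abs_le_sigma (I J : eqType) (a : I * J -> C) (m : I -> R) M :
  (forall i, abs_le (fun j => a (i, j)) (m i)) ->
  (forall s, uniq s -> \sum_(i <- s) m i <= M) -> abs_le a M.
Proof.
move=> ha hm s us.
pose s1 := undup (map fst s); pose s2 := undup (map snd s).
apply: (@le_trans _ _ (\sum_(p <- [seq (i, j) | i <- s1, j <- s2]) nm (a p))).
  apply: ler_sum_sub => // [[i j] ijs|i]; last exact: nm_ge0.
  apply/allpairsP; exists (i, j); split=> //=; rewrite mem_undup;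
    by apply/mapP; exists (i, j).
rewrite big_allpairs_dep /=.
apply: le_trans (hm s1 (undup_uniq _)); apply: ler_sum => i _.
by apply: ha; exact: undup_uniq.
Qed.

(** Fubini, from the total sum and the row sums alone. Each of the finitely many rows is cut down to
    a finite set that contains its part of [s0] and is accurate to [d], so that all rows together
    cost at most e/2; the union of these sets is within e/2 of [l]. *)
Lemma sums_to_sigma (I J : eqType) (a : I * J -> C) (b : I -> C) l :
  sums_to a l -> (forall i, sums_to (fun j => a (i, j)) (b i)) -> sums_to b l.
Proof.
move=> h hb e e0.
have [s0 hs] := h _ (divr_gt0 e0 (ltr0Sn _ 1)).
exists (map fst s0) => s us ss.
pose d : R := e / 2 / (size s).+1%:R.
have d0 : 0 < d by rewrite !divr_gt0.
pose P i (t : seq J) := [/\ uniq t, (forall j, (i, j) \in s0 -> j \in t) &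
  nm (\sum_(j <- t) a (i, j) - b i) <= d].
have hP i : exists t, P i t.
  have [t0 ht] := hb i d d0.
  pose t1 := undup (t0 ++ map snd s0).
  exists t1; split; first exact: undup_uniq.
    move=> j ij; rewrite mem_undup mem_cat; apply/orP; right.
    by apply/mapP; exists (i, j).
  by apply: ht; [exact: undup_uniq|move=> j jt; rewrite mem_undup mem_cat jt].
pose t i := projT1 (cid (hP i)).
have ht i : P i (t i) by rewrite /t; case: cid.
have := hs [seq (i, j) | i <- s, j <- t i].
rewrite big_allpairs_dep /= => H.
apply: le_trans (nm_tri _ (\sum_(i <- s) \sum_(j <- t i) a (i, j)) _) _.
rewrite (splitr e) lerD //; last first.
  apply: H.
    apply: allpairs_uniq_dep => // [i _|]; first by case: (ht i).
    by case=> i j [i' j'] _ _ [-> ->].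
  move=> [i j] ij; apply/allpairsPdep; exists i, j; split=> //.
    by apply: ss; apply/mapP; exists (i, j).
  by case: (ht i) => _ + _; apply.
rewrite -sumrB; apply: le_trans (nm_sum _ _ _) _.
apply: (@le_trans _ _ (\sum_(i <- s) d)).
  by apply: ler_sum => i _; rewrite nmBC; case: (ht i).
rewrite big_const_seq count_predT iter_addr_0.
have -> : e / 2 = d * (size s).+1%:R by rewrite divfK ?pnatr_eq0.
by rewrite -(mulr_natr d); apply: ler_wpM2l; [exact: ltW|rewrite ler_nat].
Qed.

Lemma sums_to_nat (a : nat -> C) l : sums_to a l -> forall e : R, 0 < e ->
  exists N0, forall N, (N0 <= N)%N -> nm (\sum_(0 <= i < N) a i - l) <= e.
Proof.
move=> h e /h[s0 hs]; exists (\max_(i <- s0) i.+1)%N => N hN.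
apply: hs; first exact: iota_uniq.
move=> i is0; rewrite mem_index_iota /=; apply: leq_trans hN.
exact: (@leq_bigmax_seq _ _ predT (fun i => i.+1)).
Qed.

Lemma abs_le_nat (a : nat -> C) M :
  (forall N, \sum_(0 <= i < N) nm (a i) <= M) -> abs_le a M.
Proof.
move=> h s us; apply: le_trans (h (\max_(i <- s) i.+1)%N).
apply: ler_sum_sub => // [i is0|i]; last exact: nm_ge0.
by rewrite mem_index_iota /=; exact: (@leq_bigmax_seq _ _ predT (fun i => i.+1)).
Qed.

Lemma sums_to_swap (I J : eqType) (a : I * J -> C) l : sums_to a l ->
  sums_to (fun p : J * I => a (p.2, p.1)) l.
Proof.
move=> h; apply: (@sums_to_bij _ _ (fun p : I * J => (p.2, p.1))).
  by exists (fun p : J * I => (p.2, p.1)) => [[i j]|[i j]].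
by apply: sums_to_ext h => -[].
Qed.

Lemma sums_to_mul (I J : eqType) (a : I -> C) (b : J -> C) l m M N :
  abs_le a M -> abs_le b N -> sums_to a l -> sums_to b m ->
  abs_le (fun p : I * J => a p.1 * b p.2) (M * N) /\
  sums_to (fun p : I * J => a p.1 * b p.2) (l * m).
Proof.
move=> ha hb hl hm.
have hab : abs_le (fun p : I * J => a p.1 * b p.2) (M * N).
  apply: (@abs_le_sigma _ _ _ (fun i => nm (a i) * N)) => [i|s us /=].
    exact: (@abs_le_scale _ b (a i) N hb).
  by rewrite -mulr_suml ler_wpM2r ?(abs_le_ge0 hb) ?ha.
split=> //; have [k hk] := sums_to_exists hab.
suff -> : l * m = k by [].
apply: sums_to_unique (sums_to_sigma hk (fun i => sums_to_scale (a i) hm)).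
by rewrite mulrC; apply: sums_to_ext (sums_to_scale m hl) => i; rewrite mulrC.
Qed.

Lemma sums_to_nat_conv (a : nat -> C) l M : abs_le a M ->
  (forall e : R, 0 < e -> exists N0, forall N, (N0 <= N)%N ->
     nm (\sum_(0 <= i < N) a i - l) <= e) -> sums_to a l.
Proof.
move=> /sums_to_exists[l' hl'] h; suff -> : l = l' by [].
apply: nm_eps_eq => e e0.
have [N0 h0] := h _ (divr_gt0 e0 (ltr0Sn _ 1)).
have [N1 h1] := sums_to_nat hl' (divr_gt0 e0 (ltr0Sn _ 1)).
apply: le_trans (nm_tri _ (\sum_(0 <= i < maxn N0 N1) a i) _) _.
rewrite (splitr e) nmBC lerD ?h0 ?h1 //; first exact: leq_maxl.
exact: leq_maxr.
Qed.

Definition conv (V : nzRingType) (a b : nat -> V) (n : nat) : V :=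
  \sum_(i < n.+1) a i * b (n - i)%N.

Lemma sums_to_conv (a b : nat -> C) l m M N :
  abs_le a M -> abs_le b N -> sums_to a l -> sums_to b m ->
  abs_le (conv a b) (M * N) /\ sums_to (conv a b) (l * m).
Proof.
move=> ha hb hl hm; have [hab hlm] := sums_to_mul ha hb hl hm.
pose c (p : nat * nat) := if (p.2 <= p.1)%N then a p.2 * b (p.1 - p.2)%N else 0.
(* The pair (i, j) goes to (i + j, i), so the rows of [c] are the antidiagonals of the Cauchy
   product. *)
pose f (p : nat * nat) := (p.1 + p.2, p.1)%N.
have fi : injective f by move=> [i j] [i' j'] [+ ii]; rewrite ii => /addnI ->.
have cf : c \o f =1 (fun p => a p.1 * b p.2).
  by move=> [i j]; rewrite /c /= leq_addr addKn.
have c0 p : (forall q, f q != p) -> c p = 0.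
  case: p => i j h; rewrite /c /=; case: leqP => // ji.
  by have := h (j, i - j)%N; rewrite /f /= subnKC // eqxx.
have hc : sums_to c (l * m).
  by apply: sums_to_inj fi c0 _; apply: sums_to_ext hlm => p; rewrite -cf.
have ac : abs_le c (M * N).
  by apply: abs_le_inj_ext fi c0 _; apply: abs_le_ext hab => p; rewrite -cf.
have in_n n : sums_to (fun j => c (n, j)) (conv a b n).
  have := @sums_to_fin _ (fun j => c (n, j)) (iota 0 n.+1) (iota_uniq _ _).
  have -> : \sum_(i <- iota 0 n.+1) c (n, i) = conv a b n.
    rewrite /conv -(big_mkord predT (fun i => a i * b (n - i)%N)) /index_iota subn0.
    rewrite !big_seq; apply: eq_bigr => i; rewrite mem_iota /c /= add0n ltnS.
    by move=> ->.
  apply=> i; rewrite mem_iota /= add0n ltnS -ltnNge => ni.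
  by rewrite /c /= leqNgt ni.
split; last exact: sums_to_sigma hc in_n.
move=> s us.
pose t := [seq (n, j) | n <- s, j <- iota 0 n.+1].
apply: le_trans (ac t _); last first.
  by apply: allpairs_uniq_dep => // [n _|[i j] [i' j'] _ _ [-> ->]//]; exact: iota_uniq.
rewrite big_allpairs_dep /=; apply: ler_sum => n _.
apply: le_trans (nm_sum _ _ _) _.
rewrite -(big_mkord predT (fun i => nm (a i * b (n - i)%N))) /index_iota subn0.
rewrite le_eqVlt; apply/orP; left; apply/eqP.
rewrite !big_seq; apply: eq_bigr => i; rewrite mem_iota /c /= add0n ltnS.
by move=> ->.
Qed.

End UnconditionalSums.

(** * The exponential series *)

Section Exp.
Variable R : realType.
Local Notation C := R[i].
Implicit Types z w : C.

Lemma cexpD z w : cexp (z + w) = cexp z * cexp w.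
Proof.
case: z => a b; case: w => c d; rewrite /cexp /= expRD cosD sinD; simpc.
by apply/eqP; rewrite eq_complex /=; apply/andP; split; apply/eqP; ring.
Qed.

Lemma cexp0 : cexp 0 = 1 :> C.
Proof. by rewrite /cexp /= expR0 cos0 sin0 mul1r. Qed.

Lemma cexpN z : cexp (- z) = (cexp z)^-1.
Proof.
have h : cexp z * cexp (- z) = 1 by rewrite -cexpD subrr cexp0.
have z0 : cexp z != 0.
  by apply: contra_eq_neq h => ->; rewrite mul0r eq_sym oner_neq0.
by apply: (mulfI z0); rewrite h divff.
Qed.

Lemma cexpMn z n : cexp (z *+ n) = cexp z ^+ n.
Proof.
by elim: n => [|n IH]; rewrite ?mulr0n ?cexp0 // mulrS cexpD IH exprS.
Qed.

Lemma nm_cexp z : nm (cexp z) = expR (complex.Re z).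
Proof.
rewrite /cexp nmM nm_real ger0_norm ?expR_ge0 //=.
by rewrite cos2Dsin2 sqrtr1 mulr1.
Qed.

Lemma cexp_neq0 z : cexp z != 0.
Proof. by rewrite -nm_gt0 nm_cexp expR_gt0. Qed.

Lemma real_cvg_sums_to (u : nat -> R) (l M : R) : abs_le (fun n => (u n)%:C%C) M ->
  series u @ \oo --> l -> sums_to (fun n => (u n)%:C%C) l%:C%C.
Proof.
move=> hu hl; apply: sums_to_nat_conv hu _ => e e0.
have /cvgrPdist_le/(_ e e0)[N _ hN] := hl.
exists N => n /hN; rewrite distrC.
by rewrite -rmorph_sum -rmorphB nm_real.
Qed.

Definition ecoef z (n : nat) : C := z ^+ n / n`!%:R.

Lemma nm_ecoef z n : nm (ecoef z n) = nm z ^+ n / n`!%:R.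
Proof. by rewrite nmM nmV nmX nm_nat. Qed.

Lemma exp_partial (x : R) N : 0 <= x ->
  \sum_(0 <= i < N) x ^+ i / i`!%:R <= expR x.
Proof.
move=> x0; apply: (@nondecreasing_cvgn_le _ (series (exp_coeff x))).
  by apply: nondecreasing_series => n _ _; exact: exp_coeff_ge0.
exact: is_cvg_series_exp_coeff.
Qed.

Lemma abs_le_ecoef z : abs_le (ecoef z) (expR (nm z)).
Proof.
apply: abs_le_nat => N; under eq_bigr do rewrite nm_ecoef.
exact: exp_partial (nm_ge0 _).
Qed.

Lemma sums_to_expr (x : R) : sums_to (ecoef x%:C%C) (cexp x%:C%C).
Proof.
have -> : cexp x%:C%C = (expR x)%:C%C by rewrite /cexp /= cos0 sin0 mulr1.
have E : ecoef x%:C%C =1 (fun n => (exp_coeff x n)%:C%C).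
  by move=> n; rewrite /exp_coeff /= rmorphM /= rmorphXn fmorphV rmorph_nat.
apply: sums_to_ext (fun n => esym (E n)) _; apply: real_cvg_sums_to.
  by apply: abs_le_ext E (abs_le_ecoef _).
exact: is_cvg_series_exp_coeff.
Qed.

Lemma sums_to_expi (y : R) : sums_to (ecoef (Complex 0 y)) (cexp (Complex 0 y)).
Proof.
have -> : cexp (Complex 0 y) = (cos y)%:C%C + Complex 0 1 * (sin y)%:C%C.
  by rewrite /cexp /= expR0 mul1r [LHS]complexE.
have E n : ecoef (Complex 0 y) n =
    (cos_coeff y n)%:C%C + Complex 0 1 * (sin_coeff y n)%:C%C.
  rewrite /ecoef -(rmorph_nat (real_complex R)) -fmorphV.
  have -> : Complex 0 y = y%:C%C * Complex 0 1 by simpc.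
  rewrite exprMn -rmorphXn /cos_coeff /sin_coeff /=.
  rewrite -[in Complex 0 1 ^+ n](odd_double_half n) exprD -mul2n exprM sqr_i.
  have -> : ((-1 : C)) ^+ n./2 = ((-1) ^+ n./2)%:C%C by rewrite rmorphXn rmorphN1.
  rewrite -exprnP.
  case O : (odd n) => /=; rewrite ?mul0r ?mul1r ?mulr0 ?addr0 ?add0r.
    rewrite expr1.
    have -> : n.-1./2 = n./2 by case: n O => //= n; rewrite uphalf_half => /negbTE ->.
    by simpc; congr Complex; ring.
  by simpc; congr Complex; ring.
have bnd (u : nat -> R) : (forall n, `|u n| <= nm (ecoef (Complex 0 y) n)) ->
    abs_le (fun n => (u n)%:C%C) (expR (nm (Complex 0 y))).
  by move=> h; apply: abs_le_le (abs_le_ecoef _) => // n; rewrite nm_real.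
apply: sums_to_ext (fun n => esym (E n)) _.
apply: sums_to_add; last apply: sums_to_scale.
  apply: real_cvg_sums_to.
    apply: bnd => n; apply: le_trans (nm_Re _); rewrite E /=.
    by rewrite mul0r mul1r subr0 ?mulr0 ?subr0 ?addr0.
  by rewrite unlock; exact: is_cvg_series_cos_coeff.
apply: real_cvg_sums_to.
  apply: bnd => n; apply: le_trans (nm_Im _); rewrite E /=.
  by rewrite mul0r mul1r add0r ?add0r ?addr0.
by rewrite unlock; exact: is_cvg_series_sin_coeff.
Qed.

Lemma ecoefD z w : conv (ecoef z) (ecoef w) =1 ecoef (z + w).
Proof.
move=> n; rewrite /conv /ecoef addrC exprDn mulr_suml; apply: eq_bigr => i _.
have ni : (i <= n)%N by rewrite -ltnS.
have f0 m : m`!%:R != 0 :> C by rewrite pnatr_eq0 -lt0n fact_gt0.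
have := f0 n; rewrite -(bin_fact ni) !natrM => h; rewrite -mulr_natr.
have := h; rewrite !mulf_eq0 !negb_or => /and3P[c0 i0 n0].
by field; rewrite c0 i0 n0.
Qed.

(** On the two axes the series are those of the real exponential, cosine and sine; the Cauchy
    product joins them. *)
Lemma sums_to_exp z : sums_to (ecoef z) (cexp z).
Proof.
case: z => x y.
have -> : Complex x y = x%:C%C + Complex 0 y by simpc.
have [_] := sums_to_conv (abs_le_ecoef x%:C%C) (abs_le_ecoef (Complex 0 y))
  (sums_to_expr x) (sums_to_expi y).
by rewrite -cexpD; apply: sums_to_ext; exact: ecoefD.
Qed.

Lemma sums_to_shift (a : nat -> C) l N M : abs_le a M -> sums_to a l ->
  sums_to (fun n => a (N + n)%N) (l - \sum_(0 <= i < N) a i).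
Proof.
move=> ha hl.
pose b n := if (n < N)%N then a n else 0.
have hb : sums_to b (\sum_(0 <= i < N) a i).
  have := @sums_to_fin _ _ b (index_iota 0 N) (iota_uniq _ _).
  rewrite [X in sums_to b X](eq_big_nat _ _ (F2 := a)) => [|i /andP[_ iN]]; last first.
    by rewrite /b iN.
  by apply => i; rewrite mem_index_iota /b /= => /negbTE ->.
have hc := sums_to_sub hl hb.
apply: (@sums_to_ext _ _ ((fun i => a i - b i) \o addn N)).
  by move=> n; rewrite /= /b ltnNge leq_addr /= subr0.
apply: (sums_to_inj_ext (M := M)) hc => //; first exact: addnI.
  move=> i h; rewrite /b; case: ltnP => iN; first by rewrite subrr.
  by have := h (i - N)%N; rewrite subnKC ?eqxx.
apply: abs_le_le (abs_le_inj (@addnI N) ha) => // n.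
by rewrite /= /b ltnNge leq_addr /= subr0.
Qed.

(** Since (N + n)! >= n!, the tail is dominated termwise by z^N times the exponential series. *)
Lemma cexp_taylor z N :
  nm (cexp z - \sum_(0 <= m < N) ecoef z m) <= nm z ^+ N * expR (nm z).
Proof.
apply: sums_to_nm (sums_to_shift N (abs_le_ecoef z) (sums_to_exp z)) _.
rewrite -nmX; apply: abs_le_le (abs_le_scale (z ^+ N) (abs_le_ecoef z)) => // n.
rewrite nm_ecoef nmM nmX nm_ecoef exprD -mulrA.
rewrite ler_wpM2l ?exprn_ge0 ?nm_ge0 // ler_wpM2l ?exprn_ge0 ?nm_ge0 //.
by rewrite lef_pV2 ?posrE ?ltr0n ?fact_gt0 // ler_nat leq_fact // leq_addl.
Qed.

Lemma two_pi_neq0 : two_pi_i R != 0.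
Proof.
rewrite eq_complex /= eqxx /=.
by rewrite mulf_neq0 // ?pnatr_eq0 // gt_eqF // pi_gt0.
Qed.

Lemma nm_two_pi : nm (two_pi_i R) = 2 * pi.
Proof. by rewrite /= expr0n add0r sqrtr_sqr ger0_norm // mulr_ge0 ?pi_ge0. Qed.

Lemma cexp_2pi : cexp (two_pi_i R) = 1.
Proof. by rewrite /cexp /= expR0 mul1r mulr_natl cos2pi sin2pi. Qed.

Lemma cexp_int (n : int) : cexp (two_pi_i R *~ n) = 1.
Proof.
by case: n => n; rewrite ?NegzE ?mulrNz ?cexpN -?pmulrn cexpMn cexp_2pi expr1n ?invr1.
Qed.

(** After subtraction of a multiple of 2 pi i the imaginary part v lies in [0, 2 pi). Then cos v = 1
    forces sin (v/2) = 0, whereas the sine is positive on (0, pi). *)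
Lemma cexp_eq1 w : cexp w = 1 -> exists n : int, w = two_pi_i R *~ n.
Proof.
move=> hw; exists (Num.floor (complex.Im w / (2 * pi))).
set n := Num.floor _; apply/eqP; rewrite -subr_eq0; set v := w - _.
have hv : cexp v = 1 by rewrite cexpD cexpN cexp_int hw invr1 mulr1.
have pi0 : 0 < 2 * pi :> R by rewrite mulr_gt0 ?pi_gt0.
have Rv : complex.Re v = 0.
  by apply: expR_inj; rewrite -nm_cexp hv nm1 expR0.
have Iv : complex.Im v = complex.Im w - 2 * pi * n%:~R.
  by rewrite /v raddfB /= raddfMz /= mulrzr.
have v0 : 0 <= complex.Im v < 2 * pi.
  have := floor_itv (complex.Im w / (2 * pi)); rewrite -/n intrD.
  rewrite ler_pdivlMr // ltr_pdivrMr // Iv mulrDl mul1r => /andP[h1 h2].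
  by apply/andP; split; lra.
have hc : cos (complex.Im v) = 1.
  by have := congr1 (@complex.Re R) hv; rewrite /cexp /= Rv expR0 mul1r mul0r subr0.
have hs : sin (complex.Im v / 2) = 0.
  have := cos_mulr2n (complex.Im v / 2); rewrite [_ / 2 *+ 2]mulr2n -splitr hc cos2sin2.
  by move=> h; apply/eqP; rewrite -sqrf_eq0; apply/eqP; lra.
have Iv0 : complex.Im v = 0.
  apply/eqP; apply: contraT => vn0.
  have : 0 < sin (complex.Im v / 2).
    by apply: sin_gt0_pi; move: v0; rewrite le_eqVlt eq_sym (negbTE vn0) /=; lra.
  by rewrite hs ltxx.
by rewrite eq_complex Rv Iv0 !eqxx.
Qed.

Lemma nm_nome z : nm (nome z) = expR (- (2 * pi * complex.Im z)).
Proof. by rewrite nm_cexp; case: z => x y /=; rewrite mul0r sub0r. Qed.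

Lemma nome_neq0 z : nome z != 0. Proof. exact: cexp_neq0. Qed.

Lemma nome_lt1 z : 0 < complex.Im z -> nm (nome z) < 1.
Proof.
by move=> h; rewrite nm_nome expR_lt1 oppr_lt0 !mulr_gt0 // pi_gt0.
Qed.

Lemma nomeD z w : nome (z + w) = nome z * nome w.
Proof. by rewrite /nome mulrDr cexpD. Qed.

Lemma nome_int (n : int) : nome (n%:~R : C) = 1.
Proof. by rewrite /nome mulrzr cexp_int. Qed.

Lemma nome_Mn z n : nome (z *+ n) = nome z ^+ n.
Proof. by rewrite /nome mulrnAr cexpMn. Qed.

Lemma nome_inj_int z w : nome z = nome w -> exists n : int, w = z + n%:~R.
Proof.
move=> h; have : cexp (two_pi_i R * (w - z)) = 1.
  by rewrite mulrBr cexpD cexpN -/(nome w) -h divff // nome_neq0.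
move=> /cexp_eq1[n]; rewrite -mulrzr => /(mulfI two_pi_neq0) wz.
by exists n; rewrite -wz addrC subrK.
Qed.

End Exp.

(** * Row bounds, and the sum as a total function *)

Section SigmaSum.
Variable R : realType.
Local Notation C := R[i].

Lemma abs_le_sub (I : eqType) (a b : I -> C) M N :
  abs_le a M -> abs_le b N -> abs_le (fun i => a i - b i) (M + N).
Proof.
move=> ha hb; apply: abs_le_add => // s us; have := hb s us.
by under eq_bigr do rewrite -nmN.
Qed.

Lemma abs_le_rows (I J : eqType) (a : I * J -> C) (b : I -> C) M :
  abs_le a M -> (forall i, sums_to (fun j => a (i, j)) (b i)) -> abs_le b M.
Proof.
move=> ha hb s us; apply/ler_addgt0Pl => e e0.
pose d : R := e / (size s).+1%:R.
have d0 : 0 < d by rewrite divr_gt0.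
have hP i : exists t : seq J, uniq t /\ nm (\sum_(j <- t) a (i, j) - b i) <= d.
  have [t0 ht] := hb i d d0; exists (undup t0).
  by split; [|apply: ht => [|j]]; rewrite ?undup_uniq // mem_undup.
pose t i := projT1 (cid (hP i)).
have ht i : uniq (t i) /\ nm (\sum_(j <- t i) a (i, j) - b i) <= d.
  by rewrite /t; case: cid.
apply: (@le_trans _ _ (\sum_(i <- s) (d + \sum_(j <- t i) nm (a (i, j))))).
  apply: ler_sum => i _; apply: le_trans (nm_le_add _ (\sum_(j <- t i) a (i, j))) _.
  by rewrite nmBC lerD ?(proj2 (ht i)) ?nm_sum.
rewrite big_split /= lerD //.
  rewrite big_const_seq count_predT iter_addr_0.
  have -> : e = d * (size s).+1%:R by rewrite divfK ?pnatr_eq0.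
  by rewrite -(mulr_natr d); apply: ler_wpM2l; [exact: ltW|rewrite ler_nat].
have := ha [seq (i, j) | i <- s, j <- t i]; rewrite big_allpairs_dep /=; apply.
apply: allpairs_uniq_dep => // [i _|[i j] [i' j'] _ _ [-> ->]//].
by case: (ht i).
Qed.

(** The value is 0 where no sum exists, so that [qs] and [ps] below are total functions. *)
Definition hsum (I : eqType) (a : I -> C) : C := xget 0 [set l | sums_to a l].

Lemma hsumP (I : eqType) (a : I -> C) M : abs_le a M -> sums_to a (hsum a).
Proof. by move=> /sums_to_exists[l hl]; rewrite /hsum; case: xgetP => //= /(_ l). Qed.

Lemma hsum_eq (I : eqType) (a : I -> C) l : sums_to a l -> hsum a = l.
Proof.
move=> h; rewrite /hsum; case: xgetP => [l' _ /= h'|/(_ l)//].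
exact: sums_to_unique h' h.
Qed.

Lemma abs_le_pos_sum (I J : eqType) (a : I * J -> C) (m : I -> R) M :
  (forall i, abs_le (fun j => a (i, j)) (m i)) ->
  (forall s, uniq s -> \sum_(i <- s) m i <= M) ->
  forall j, abs_le (fun i => a (i, j)) M.
Proof.
move=> h hm j; have := abs_le_sigma h hm.
by apply: (abs_le_inj (f := fun i => (i, j))) => i i' [].
Qed.

End SigmaSum.

(** * Power series on boxes and q-series *)

Section NormalFunctions.
Variables (R : realType) (n : nat) (r : R).
Local Notation C := R[i].
Local Notation mi := {ffun 'I_n -> nat}.
Hypothesis r0 : 0 < r.

Definition mdg (a : mi) : nat := \sum_i a i.
(** The monomials are real while the coefficients are complex; this makes the algebra stable under
    conjugation. *)
Definition mon (h : 'rV[R]_n) (a : mi) : C := (\prod_i h 0 i ^+ a i)%:C%C.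
Definition box (h : 'rV[R]_n) := forall i, `|h 0 i| <= r.

(* On the box of radius [r], [f] is a power series whose norm, the sum of
   [|c a| r^|a|], is at most [M]. These functions form a Banach algebra, in which the
   local inverses are constructed by iteration. *)
Definition nb (f : 'rV[R]_n -> C) (M : R) : Prop :=
  exists c : mi -> C, abs_le (fun a => c a * (r ^+ mdg a)%:C%C) M /\
    forall h, box h -> sums_to (fun a => c a * mon h a) (f h).

Lemma nm_mon h a : box h -> nm (mon h a) <= r ^+ mdg a.
Proof.
move=> hb; rewrite nm_real normr_prod /mdg.
rewrite (big_morph (GRing.exp r) (exprD r) (expr0 r)); apply: ler_prod => i _.
rewrite normr_ge0 normrX; apply: lerXn2r; rewrite ?nnegrE ?normr_ge0 //.
  exact: ltW.
Qed.

Lemma nm_rX k : nm (r ^+ k)%:C%C = r ^+ k.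
Proof. by rewrite nm_real ger0_norm ?exprn_ge0 // ltW. Qed.

Lemma abs_le_mon (c : mi -> C) M h : box h -> abs_le (fun a => c a * (r ^+ mdg a)%:C%C) M ->
  abs_le (fun a => c a * mon h a) M.
Proof.
move=> hb; apply: abs_le_le => // a; rewrite !nmM ler_wpM2l ?nm_ge0 // nm_rX.
exact: nm_mon.
Qed.

Lemma nb_val f M h : nb f M -> box h -> nm (f h) <= M.
Proof. by move=> [c [hc hf]] hb; apply: sums_to_nm (hf h hb) (abs_le_mon hb hc). Qed.

Lemma nb_ge0 f M : nb f M -> 0 <= M.
Proof. by move=> [c [hc hf]]; exact: abs_le_ge0 hc. Qed.

Lemma nb_ext f g M N : (forall h, box h -> f h = g h) -> M <= N -> nb f M -> nb g N.
Proof.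
move=> fg MN [c [hc hf]]; exists c; split; first exact: abs_le_le hc.
by move=> h hb; rewrite -fg //; exact: hf.
Qed.

Lemma nb_le f M N : M <= N -> nb f M -> nb f N. Proof. exact: nb_ext. Qed.

(** Completeness of the algebra: a normally convergent series of elements is summed coefficient by
    coefficient, and Fubini identifies the result with the pointwise sum. *)
Lemma nb_family (I : eqType) (f : I -> 'rV[R]_n -> C) (m : I -> R) F M :
  (forall i, nb (f i) (m i)) -> (forall s, uniq s -> \sum_(i <- s) m i <= M) ->
  (forall h, box h -> sums_to (fun i => f i h) (F h)) -> nb F M.
Proof.
move=> hf hm hF.
pose c i := projT1 (cid (hf i)).
have hc i : abs_le (fun a => c i a * (r ^+ mdg a)%:C%C) (m i) /\
    forall h, box h -> sums_to (fun a => c i a * mon h a) (f i h).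
  by rewrite /c; case: cid.
have hca a : sums_to (c^~ a) (hsum (c^~ a)).
  have := abs_le_pos_sum (a := fun p : I * mi => c p.1 p.2 * (r ^+ mdg p.2)%:C%C)
    (fun i => proj1 (hc i)) hm a.
  move=> /= /(abs_le_scale ((r ^+ mdg a)%:C%C)^-1) h; apply: hsumP.
  apply: abs_le_ext h => i /=; rewrite mulrC mulfK //.
  by rewrite -nm_eq0 nm_rX expf_neq0 // gt_eqF.
have AB := abs_le_sigma (a := fun p : I * mi => c p.1 p.2 * (r ^+ mdg p.2)%:C%C)
    (fun i => proj1 (hc i)) hm.
exists (fun a => hsum (c^~ a)); split.
  apply: (@abs_le_rows _ _ _ (fun p : mi * I => c p.2 p.1 * (r ^+ mdg p.1)%:C%C)).
    have := abs_le_inj (f := fun p : mi * I => (p.2, p.1)) _ AB; apply.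
    by move=> [a i] [a' i'] [-> ->].
  move=> a /=; rewrite mulrC; apply: sums_to_ext (sums_to_scale _ (hca a)) => i.
  by rewrite mulrC.
move=> h hb.
have AB' : abs_le (fun p : I * mi => c p.1 p.2 * mon h p.2) M.
  apply: abs_le_sigma hm => i; exact: abs_le_mon hb (proj1 (hc i)).
have [l hl] := sums_to_exists AB'.
have -> : F h = l.
  apply: sums_to_unique (hF h hb) (sums_to_sigma hl _) => i; exact: (proj2 (hc i) h hb).
apply: sums_to_sigma (sums_to_swap hl) _ => a /=.
by rewrite mulrC; apply: sums_to_ext (sums_to_scale _ (hca a)) => i; rewrite mulrC.
Qed.

Definition mi0 : mi := [ffun=> 0%N].

Lemma nb_single (c : C) (b : mi) : nb (fun h => c * mon h b) (nm c * r ^+ mdg b).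
Proof.
exists (fun a => if a == b then c else 0); split.
  move=> s us; case: (boolP (b \in s)) => bs; last first.
    rewrite big_seq big1 ?mulr_ge0 ?nm_ge0 ?exprn_ge0 ?ltW // => a as_.
    by case: eqP => [ab|]; [rewrite -ab as_ in bs|rewrite mul0r nm0].
  rewrite (perm_big _ (perm_to_rem bs)) big_cons eqxx nmM nm_rX.
  rewrite big_seq big1 /= ?addr0 // => a; rewrite mem_rem_uniq // inE => /andP[/negbTE-> _].
  by rewrite mul0r nm0.
move=> h hb.
have := @sums_to_fin R _ (fun a => (if a == b then c else 0) * mon h a) [:: b] isT.
rewrite big_seq1 eqxx; apply => a; rewrite inE => /negbTE ->.
by rewrite mul0r.
Qed.

Lemma mon0 h : mon h mi0 = 1.
Proof. by rewrite /mon big1 // => i _; rewrite ffunE expr0. Qed.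

Lemma mdg0 : mdg mi0 = 0%N.
Proof. by rewrite /mdg big1 // => i _; rewrite ffunE. Qed.

Lemma nb_cst c : nb (fun=> c) (nm c).
Proof.
have := nb_single c mi0; rewrite mdg0 expr0 mulr1; apply: nb_ext => // h _.
by rewrite mon0 mulr1.
Qed.

Lemma nb_coord i : nb (fun h => (h 0 i)%:C%C) r.
Proof.
pose b : mi := [ffun j => (j == i : nat)].
have bE : mdg b = 1%N.
  rewrite /mdg (bigD1 i) //= big1 ?addn0 ?ffunE ?eqxx // => j /negbTE ji.
  by rewrite ffunE ji.
have := nb_single 1 b; rewrite bE expr1 nm1 mul1r; apply: nb_ext => // h _.
rewrite mul1r /mon (bigD1 i) //= big1 ?mulr1 ?ffunE ?eqxx ?expr1 // => j /negbTE ji.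
by rewrite ffunE ji expr0.
Qed.

Lemma nb_add f g M N : nb f M -> nb g N -> nb (fun h => f h + g h) (M + N).
Proof.
move=> [c [hc hf]] [d [hd hg]]; exists (fun a => c a + d a); split.
  by apply: abs_le_ext (abs_le_add hc hd) => a; rewrite mulrDl.
move=> h hb; apply: sums_to_ext (sums_to_add (hf h hb) (hg h hb)) => a.
by rewrite mulrDl.
Qed.

Lemma nb_scale f M c : nb f M -> nb (fun h => c * f h) (nm c * M).
Proof.
move=> [d [hd hg]]; exists (fun a => c * d a); split.
  by apply: abs_le_ext (abs_le_scale c hd) => a; rewrite mulrA.
move=> h hb; apply: sums_to_ext (sums_to_scale c (hg h hb)) => a.
by rewrite mulrA.
Qed.

Lemma nb_opp f M : nb f M -> nb (fun h => - f h) M.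
Proof.
move=> /(nb_scale (-1)); rewrite nmN nm1 mul1r; apply: nb_ext => // h _.
by rewrite mulN1r.
Qed.

Lemma nb_sub f g M N : nb f M -> nb g N -> nb (fun h => f h - g h) (M + N).
Proof. by move=> hf /nb_opp hg; exact: nb_add hf hg. Qed.

Definition madd (a b : mi) : mi := [ffun i => (a i + b i)%N].

Lemma monD h a b : mon h (madd a b) = mon h a * mon h b.
Proof.
rewrite -rmorphM -big_split /=; congr (_%:C)%C; apply: eq_bigr => i _.
by rewrite ffunE exprD.
Qed.

Lemma mdgD a b : mdg (madd a b) = (mdg a + mdg b)%N.
Proof. by rewrite -big_split /=; apply: eq_bigr => i _; rewrite ffunE. Qed.

Lemma nb_monM f M b : nb f M -> nb (fun h => mon h b * f h) (r ^+ mdg b * M).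
Proof.
move=> [c [hc hf]].
pose ccoord a := madd b a.
have shi : injective ccoord.
  move=> a a' /ffunP e; apply/ffunP => i; have := e i; rewrite !ffunE.
  exact: addnI.
pose sb (a : mi) : mi := [ffun i => (a i - b i)%N].
pose d (a : mi) := if [forall i, (b i <= a i)%N] then c (sb a) else 0.
have dsh a : d (ccoord a) = c a.
  rewrite /d; have -> : [forall i, (b i <= ccoord a i)%N].
    by apply/forallP => i; rewrite ffunE leq_addr.
  by congr c; apply/ffunP => i; rewrite !ffunE addKn.
have d0 a : (forall a', ccoord a' != a) -> d a = 0.
  move=> ha; rewrite /d; case: forallP => // ba.
  have /eqP[] := ha (sb a); apply/ffunP => i; rewrite !ffunE subnKC //.
exists d; split.
  apply: (abs_le_inj_ext shi) => [a /d0 ->|]; first by rewrite mul0r.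
  have := abs_le_scale (r ^+ mdg b)%:C%C hc; rewrite nm_rX; apply: abs_le_ext => a.
  by rewrite /= dsh mdgD exprD rmorphM mulrCA.
move=> h hb; apply: (sums_to_inj shi) => [a /d0 ->|]; first by rewrite mul0r.
apply: sums_to_ext (sums_to_scale (mon h b) (hf h hb)) => a.
by rewrite /= dsh monD mulrCA.
Qed.

(** Only the first factor is expanded. The product is then a normally convergent series of monomial
    multiples of [g], which avoids a convolution of multi-indices. *)
Lemma nb_mul f g M N : nb f M -> nb g N -> nb (fun h => f h * g h) (M * N).
Proof.
move=> [c [hc hf]] hg; have N0 := nb_ge0 hg.
apply: (@nb_family _ (fun a h => c a * (mon h a * g h))
  (fun a => nm (c a) * (r ^+ mdg a * N))).
- by move=> a; apply/nb_scale/nb_monM.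
- move=> s us; have := hc s us => H.
  under eq_bigr do rewrite mulrA; rewrite -mulr_suml ler_wpM2r //.
  by apply: le_trans H; apply: ler_sum => a _; rewrite nmM nm_rX.
- move=> h hb; rewrite mulrC; apply: sums_to_ext (sums_to_scale (g h) (hf h hb)) => a.
  by rewrite mulrC mulrA.
Qed.

Lemma nb_exp f M k : nb f M -> nb (fun h => f h ^+ k) (M ^+ k).
Proof.
move=> hf; elim: k => [|k IH].
  by rewrite expr0 -[X in nb _ X](@nm1 R); apply: nb_ext (nb_cst 1).
by rewrite exprS; apply: nb_ext (nb_mul hf IH) => // h _; rewrite exprS.
Qed.

Lemma nb_sum (I : Type) (s : seq I) (f : I -> 'rV[R]_n -> C) (m : I -> R) :
  (forall i, nb (f i) (m i)) -> nb (fun h => \sum_(i <- s) f i h) (\sum_(i <- s) m i).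
Proof.
move=> h; elim: s => [|i s IH].
  rewrite big_nil -[X in nb _ X](@nm0 R); apply: nb_ext (nb_cst 0) => // x _.
  by rewrite big_nil.
by rewrite big_cons; apply: nb_ext (nb_add (h i) IH) => // x _; rewrite big_cons.
Qed.

Lemma nb_powdiff f g M d k : nb f M -> nb g M -> nb (fun h => f h - g h) d ->
  nb (fun h => f h ^+ k.+1 - g h ^+ k.+1) (d * (k.+1%:R * M ^+ k)).
Proof.
move=> hf hg hd.
have := nb_sum (index_enum 'I_k.+1) (fun i : 'I_k.+1 =>
  nb_mul (nb_exp (k - i) hf) (nb_exp i hg)).
have -> : \sum_(i < k.+1) M ^+ (k - i) * M ^+ i = k.+1%:R * M ^+ k.
  rewrite (eq_bigr (fun=> M ^+ k)) => [|i _]; last first.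
    by rewrite -exprD subnK // -ltnS.
  by rewrite sumr_const card_ord mulr_natl.
move=> /(nb_mul hd); apply: nb_ext => // h _.
by rewrite subrXX.
Qed.

Lemma sum_exp_le (x : R) s : uniq s -> 0 <= x ->
  \sum_(k <- s) x ^+ k / k`!%:R <= expR x.
Proof.
move=> us x0; have := abs_le_ecoef x%:C%C us; rewrite nm_real ger0_norm //.
by under eq_bigr do rewrite nm_ecoef nm_real ger0_norm //.
Qed.

(** The terms of degree 0 and 1 cancel. In degree k + 2 the difference of powers costs d (k + 2)
    M^(k+1), and (k + 2)/(k + 2)! = 1/(k + 1)! <= 1/k! leaves d M times the exponential series of
    M. *)
Lemma nb_cexp f g M d : nb f M -> nb g M -> nb (fun h => f h - g h) d ->
  nb (fun h => cexp (f h) - cexp (g h) - (f h - g h)) (d * M * expR M).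
Proof.
move=> hf hg hd; have M0 := nb_ge0 hf; have d0 := nb_ge0 hd.
apply: (@nb_family _ (fun k h => (k.+2`!%:R)^-1 * (f h ^+ k.+2 - g h ^+ k.+2))
  (fun k => d * M * (M ^+ k / k`!%:R))).
- move=> k; apply: nb_ext (nb_scale (k.+2`!%:R)^-1 (nb_powdiff k.+1 hf hg hd)) => //.
  rewrite nmV nm_nat factS natrM invfM exprS.
  have -> : k.+2%:R^-1 / k.+1`!%:R * (d * (k.+2%:R * (M * M ^+ k))) =
     d * M * (M ^+ k * (k.+1`!%:R)^-1) :> R.
    have a0 : k.+2%:R != 0 :> R by rewrite pnatr_eq0.
    have b0 : k.+1`!%:R != 0 :> R by rewrite pnatr_eq0 -lt0n fact_gt0.
    by move: (k.+2%:R : R) (k.+1`!%:R : R) a0 b0 => x y x0 y0; field; rewrite x0 y0.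
  rewrite ler_wpM2l ?mulr_ge0 // ler_wpM2l ?exprn_ge0 //.
  by rewrite lef_pV2 ?posrE ?ltr0n ?fact_gt0 // ler_nat leq_fact.
- move=> s us; rewrite -mulr_sumr ler_wpM2l ?mulr_ge0 //; exact: sum_exp_le.
- move=> h hb.
  have := sums_to_shift 2 (abs_le_sub (abs_le_ecoef (f h)) (abs_le_ecoef (g h)))
    (sums_to_sub (sums_to_exp (f h)) (sums_to_exp (g h))).
  rewrite !big_nat_recr //= big_nil /ecoef !expr0 !expr1 fact0 !divr1 subrr !add0r.
  by apply: sums_to_ext => k; rewrite add2n -mulrBl mulrC.
Qed.

Lemma nb_cexp_lin (u : C) f g M d : nb f M -> nb g M -> nb (fun h => f h - g h) d ->
  nb (fun h => cexp (u * f h) - cexp (u * g h) - u * (f h - g h))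
    (nm u ^+ 2 * (d * M) * expR (nm u * M)).
Proof.
move=> /(nb_scale u) hf /(nb_scale u) hg /(nb_scale u) hd.
have hd' : nb (fun h => u * f h - u * g h) (nm u * d).
  by apply: nb_ext hd => // h _; rewrite mulrBr.
apply: nb_ext (nb_cexp hf hg hd') => [h _|]; first by rewrite mulrBr.
by rewrite le_eqVlt; apply/orP; left; apply/eqP; ring.
Qed.

End NormalFunctions.

(** * Series in q on the upper half plane *)

Section QSeries.
Variable R : realType.
Local Notation C := R[i].
Implicit Types (a b : nat -> C) (z : C).

(** The power series with coefficients [a] has radius of convergence at least 1. *)
Definition qsumm a := forall rho : R, 0 <= rho < 1 ->
  exists M, abs_le (fun n => a n * (rho ^+ n)%:C%C) M.

Definition qs a z : C := hsum (fun n => a n * nome z ^+ n).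

Lemma qsumm_abs_le a z : qsumm a -> 0 < complex.Im z ->
  exists M, abs_le (fun n => a n * nome z ^+ n) M.
Proof.
move=> ha hz; have [|M hM] := ha (nm (nome z)); first by rewrite nm_ge0 nome_lt1.
exists M; apply: abs_le_le hM => // n.
have -> : nm (a n * nome z ^+ n) = nm (a n) * nm (nome z) ^+ n by rewrite nmM nmX.
by rewrite nmM nm_real ger0_norm // exprn_ge0 // nm_ge0.
Qed.

Lemma qsP a z : qsumm a -> 0 < complex.Im z ->
  sums_to (fun n => a n * nome z ^+ n) (qs a z).
Proof. by move=> ha hz; have [M /hsumP] := qsumm_abs_le ha hz. Qed.

Lemma qs_ext a b z : a =1 b -> qs a z = qs b z.
Proof. by move=> ab; congr (hsum _); apply/funext => n; rewrite ab. Qed.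

Lemma qsumm_ext a b : a =1 b -> qsumm a -> qsumm b.
Proof. by move=> /funext <-. Qed.

Lemma qsumm_le a b (c : R) : (forall n, nm (a n) <= c * nm (b n)) -> qsumm b -> qsumm a.
Proof.
move=> ab hb rho hr; have [M hM] := hb rho hr; exists (`|c| * M) => s us.
apply: le_trans (ler_wpM2l (normr_ge0 c) (hM s us)); rewrite mulr_sumr.
apply: ler_sum => n _; rewrite !nmM mulrA ler_wpM2r ?nm_ge0 //.
by apply: le_trans (ab n) _; rewrite ler_wpM2r ?nm_ge0 // ler_norm.
Qed.

Lemma qsumm_add a b : qsumm a -> qsumm b -> qsumm (fun n => a n + b n).
Proof.
move=> ha hb rho hr; have [M hM] := ha rho hr; have [N hN] := hb rho hr.
by exists (M + N); apply: abs_le_ext (abs_le_add hM hN) => n; rewrite mulrDl.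
Qed.

Lemma qsumm_scale a c : qsumm a -> qsumm (fun n => c * a n).
Proof. by apply: (@qsumm_le _ _ (nm c)) => n; rewrite nmM. Qed.

Lemma qsumm_cst c : qsumm (fun=> c).
Proof.
move=> rho /andP[r0 r1]; exists (nm c / (1 - rho)); apply: abs_le_nat => N.
under eq_bigr do rewrite nmM nm_real ger0_norm ?exprn_ge0 //.
rewrite -mulr_sumr ler_wpM2l ?nm_ge0 //.
rewrite -[X in _ <= X]mul1r ler_pdivlMr ?subr_gt0 // mulrC.
rewrite big_mkord -opprB mulNr -subrX1 opprB lerBlDr lerDl.
exact: exprn_ge0.
Qed.

Lemma qsumm_nat a : qsumm a -> qsumm (fun n => n%:R * a n).
Proof.
move=> ha rho /andP[r0 r1]; have [t t0 t1] : exists2 t : R, 0 < t & rho + t < 1.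
  by exists ((1 - rho) / 2); lra.
have [|M hM] := ha (rho + t); first by lra.
have s0 : 0 <= rho + t by lra.
(* A Bernoulli inequality: the passage from rho to rho + t < 1 pays for the factor n. *)
have key n : (1 + n%:R * t) * rho ^+ n <= (rho + t) ^+ n.
  elim: n => [|n IH]; first by rewrite mul0r addr0 mul1r.
  rewrite !exprS -[n.+1]addn1 natrD.
  apply: (@le_trans _ _ ((rho + t) * ((1 + n%:R * t) * rho ^+ n))); last exact: ler_wpM2l.
  have n0 : 0 <= n%:R :> R by [].
  have p0 : 0 <= rho ^+ n by exact: exprn_ge0.
  rewrite mulrA [leRHS]mulrA; apply: ler_wpM2r => //.
  have nt : 0 <= n%:R * t by rewrite mulr_ge0 // ltW.
  have : 0 <= t * (n%:R * t) by rewrite mulr_ge0 // ltW.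
  have : 0 <= t * (1 - rho) by rewrite mulr_ge0 ?subr_ge0 // ltW.
  have -> : (n%:R + 1) * t = n%:R * t + t by rewrite mulrDl mul1r.
  by move: (n%:R * t) => x; lra.
exists (t^-1 * M); rewrite -(ger0_norm (x := t^-1)) ?invr_ge0 ?ltW //.
rewrite -nm_real; apply: abs_le_le (abs_le_scale _ hM) => // n.
rewrite !nmM nm_nat !nm_real !ger0_norm ?exprn_ge0 ?invr_ge0 ?(ltW t0) //.
rewrite mulrAC [in leRHS]mulrA [in leRHS]mulrAC ler_wpM2r ?nm_ge0 //.
rewrite ler_pdivlMl //; apply: le_trans (key n).
by rewrite mulrA mulrC [t * _]mulrC mulrC ler_wpM2r ?exprn_ge0 // lerDr.
Qed.

Lemma qsumm_exp k : qsumm (fun n => n%:R ^+ k).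
Proof.
elim: k => [|k IH]; first by apply: qsumm_ext (qsumm_cst 1) => n; rewrite expr0.
by apply: qsumm_ext (qsumm_nat IH) => n; rewrite exprS.
Qed.

Lemma nb_qs a z : qsumm a -> 0 < complex.Im z -> exists2 K : R, 0 <= K &
  forall n (r : R) (f g : 'rV[R]_n -> C) M d, 0 < r -> M <= complex.Im z / 2 ->
  nb r f M -> nb r g M -> nb r (fun h => f h - g h) d ->
  nb r (fun h => qs a (z + f h) - qs a (z + g h) -
    two_pi_i R * qs (fun k => k%:R * a k) z * (f h - g h)) (K * (d * M)).
Proof.
move=> ha hz.
(* [rho] is the square root of |nome z|. As M <= Im z / 2, the growth exp (2 pi k M) of the
   perturbed k-th term uses up at most the other square root. The two factors k in [K0] come from
   the second order of the error. *)
pose rho : R := expR (- (pi * complex.Im z)).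
have [|K0 hK0] := qsumm_nat (qsumm_nat ha) (rho := rho).
  by rewrite expR_ge0 /rho expR_lt1 oppr_lt0 mulr_gt0 // pi_gt0.
have K00 := abs_le_ge0 hK0.
exists ((2 * pi) ^+ 2 * K0); first by rewrite mulr_ge0 ?sqr_ge0.
move=> n r f g M d r0 Mz hf hg hd; have M0 := nb_ge0 hf; have d0 := nb_ge0 hd.
pose u (k : nat) : C := two_pi_i R * k%:R.
have nmu k : nm (u k) = 2 * pi * k%:R by rewrite nmM nm_two_pi nm_nat.
apply: (@nb_family _ _ _ r0 _ (fun k h => a k * nome z ^+ k *
    (cexp (u k * f h) - cexp (u k * g h) - u k * (f h - g h)))
  (fun k => ((2 * pi) ^+ 2 * (d * M)) * nm (k%:R * (k%:R * a k) * (rho ^+ k)%:C%C))).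
- move=> k; apply: nb_ext (nb_scale _ (nb_cexp_lin r0 (u k) hf hg hd)) => //.
  rewrite nmu !nmM nm_nat nm_real ger0_norm ?exprn_ge0 ?expR_ge0 // nmX nm_nome.
  have E : expR (- (2 * pi * complex.Im z)) ^+ k * expR (2 * pi * k%:R * M) <= rho ^+ k.
    rewrite /rho -!expRM_natl -expRD ler_expR.
    have : pi * k%:R * (M *+ 2) <= pi * k%:R * complex.Im z.
      by rewrite ler_wpM2l ?mulr_ge0 ?pi_ge0 //; lra.
    by move: (pi : R) (k%:R : R) => p q; lra.
  have X0 : 0 <= (2 * pi) ^+ 2 * (d * M) * (k%:R * (k%:R * nm (a k))).
    by rewrite !mulr_ge0 ?sqr_ge0 ?pi_ge0 ?nm_ge0.
  have := ler_wpM2l X0 E; congr (_ <= _); ring.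
- move=> s us; rewrite -mulr_sumr.
  rewrite [leRHS]mulrAC ler_wpM2l ?mulr_ge0 ?sqr_ge0 ?pi_ge0 //.
  exact: hK0.
- move=> h hb.
  have Hz w : nm w <= M -> 0 < complex.Im (z + w).
    move=> hw; rewrite raddfD /=; have := nm_Im w.
    by rewrite ler_norml => /andP[+ _]; lra.
  have e w k : a k * nome (z + w) ^+ k = a k * nome z ^+ k * cexp (u k * w).
    have -> : u k * w = two_pi_i R * (w *+ k) by rewrite /u -mulrA mulr_natl.
    by rewrite -/(nome (w *+ k)) nome_Mn nomeD exprMn mulrA.
  have h1 := qsP ha (Hz _ (nb_val r0 hf hb)); have h2 := qsP ha (Hz _ (nb_val r0 hg hb)).
  have h3 := qsP (qsumm_nat ha) hz.
  have := sums_to_sub (sums_to_sub h1 h2) (sums_to_scale (two_pi_i R * (f h - g h)) h3).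
  rewrite mulrAC; apply: sums_to_ext => k.
  rewrite (e (f h)) (e (g h)) /u.
  move: (cexp (_ * f h)) (cexp (_ * g h)) => c1 c2.
  move: (f h) (g h) (nome z ^+ k) (two_pi_i R) (a k) (k%:R : C).
  by move=> x1 x2 x3 x4 x5 x6; ring.
Qed.

End QSeries.

(** * Divisor sum identities *)

Section Skoruppa.
Variables (R : realType) (q : R[i]).
Hypothesis q1 : nm q < 1.
Local Notation C := R[i].
Local Notation I4 := ((nat * nat) * (nat * nat))%type.
Implicit Types f p : nat -> nat -> C.

(** The quadruple is ((a, x), (b, y)), each entry being one less than the positive integer it stands
    for; the exponent is a x + b y. *)
Definition qterm f (t : I4) : C :=
  f t.1.1.+1 t.2.1.+1 * q ^+ (t.1.1.+1 * t.1.2.+1 + t.2.1.+1 * t.2.2.+1)%N.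

Definition restr (P : I4 -> bool) (u : I4 -> C) (t : I4) : C := if P t then u t else 0.

Lemma abs_le_restr P u M : abs_le u M -> abs_le (restr P u) M.
Proof. by apply: abs_le_le => // t; rewrite /restr; case: ifP; rewrite ?nm0 ?nm_ge0. Qed.

Lemma restr_split (P1 P2 P3 : I4 -> bool) u L A B D :
  (forall t, [|| [&& P1 t, ~~ P2 t & ~~ P3 t], [&& ~~ P1 t, P2 t & ~~ P3 t]
     | [&& ~~ P1 t, ~~ P2 t & P3 t]]) ->
  sums_to u L -> sums_to (restr P1 u) A -> sums_to (restr P2 u) B -> sums_to (restr P3 u) D ->
  L = A + B + D.
Proof.
move=> hP hL hA hB hD; apply: sums_to_unique hL _.
apply: sums_to_ext (sums_to_add (sums_to_add hA hB) hD) => t; have := hP t; rewrite /restr.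
by case: (P1 t); case: (P2 t); case: (P3 t); rewrite //= ?addr0 ?add0r.
Qed.

(* Summing over a x + b y, the substitution (a, b, x, y) -> (a, a + b, x - y, y)
   exchanges the part x > y of the sum for f with the part b > a of the sum for p. *)
Lemma qterm_exchange f p Lf Lp D P Mf Mp :
  (forall a b, (0 < a)%N -> (0 < b)%N -> f a b = p a (a + b)%N) ->
  (forall a b, (0 < a)%N -> (0 < b)%N -> f a b = p (a + b)%N b) ->
  abs_le (qterm f) Mf -> abs_le (qterm p) Mp ->
  sums_to (qterm f) Lf -> sums_to (qterm p) Lp ->
  sums_to (restr (fun t => t.1.2 == t.2.2) (qterm f)) D ->
  sums_to (restr (fun t => t.1.1 == t.2.1) (qterm p)) P ->
  Lf - Lp = D - P.
Proof.
move=> fp1 fp2 af ap hf hp hD hP.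
pose xy (t : I4) := (t.2.2 < t.1.2)%N. pose yx (t : I4) := (t.1.2 < t.2.2)%N.
pose ba (t : I4) := (t.1.1 < t.2.1)%N. pose ab (t : I4) := (t.2.1 < t.1.1)%N.
have [A hA] := sums_to_exists (abs_le_restr xy af).
have [B hB] := sums_to_exists (abs_le_restr yx af).
(* [phi1] and [phi2] parametrize the regions x > y and x < y for [f], [psi1] and [psi2] the regions
   b > a and b < a for [p]. Under corresponding maps the terms agree, so only the diagonals x = y
   and a = b survive in the difference. *)
pose phi1 (t : I4) : I4 := ((t.1.1, (t.1.2 + t.2.2).+1), t.2).
pose psi1 (t : I4) : I4 := (t.1, ((t.1.1 + t.2.1).+1, t.2.2)).
pose phi2 (t : I4) : I4 := (t.1, (t.2.1, (t.1.2 + t.2.2).+1)).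
pose psi2 (t : I4) : I4 := (((t.1.1 + t.2.1).+1, t.1.2), t.2).
have phi1i : injective phi1 by move=> [[a x][b y]] [[a' x'][b' y']] [-> + -> ey]; rewrite ey => /addIn ->.
have psi1i : injective psi1 by move=> [[a x][b y]] [[a' x'][b' y']] [ea -> + ->]; rewrite ea => /addnI ->.
have phi2i : injective phi2 by move=> [[a x][b y]] [[a' x'][b' y']] [-> ex -> +]; rewrite ex => /addnI ->.
have psi2i : injective psi2 by move=> [[a x][b y]] [[a' x'][b' y']] [+ -> eb ->]; rewrite eb => /addIn ->.
have hA' : sums_to (restr ba (qterm p)) A.
  apply: (sums_to_inj psi1i).
    move=> [[a x][b y]] h; rewrite /restr /ba /=; case: ltnP => // lab.
    by have := h ((a, x), ((b - a).-1, y)); rewrite /psi1 /= -addnS prednK ?subn_gt0 // subnKC ?eqxx // ltnW.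
  apply: sums_to_ext (sums_to_inj_ext phi1i _ (abs_le_inj phi1i (abs_le_restr xy af)) hA).
    move=> [[a x][b y]]; rewrite /restr /xy /ba /psi1 /phi1 /qterm /=.
    rewrite !ltnS leq_addl leq_addr fp1 //; congr (p _ _ * q ^+ _); first by rewrite addSn addnS.
    by ring.
  move=> [[a x][b y]] h; rewrite /restr /xy /=; case: ltnP => // lab.
  by have := h ((a, (x - y).-1), (b, y)); rewrite /phi1 /= -addSn prednK ?subn_gt0 // subnK ?eqxx // ltnW.
have hB' : sums_to (restr ab (qterm p)) B.
  apply: (sums_to_inj psi2i).
    move=> [[a x][b y]] h; rewrite /restr /ab /=; case: ltnP => // lab.
    by have := h (((a - b).-1, x), (b, y)); rewrite /psi2 /= -addSn prednK ?subn_gt0 // subnK ?eqxx // ltnW.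
  apply: sums_to_ext (sums_to_inj_ext phi2i _ (abs_le_inj phi2i (abs_le_restr yx af)) hB).
    move=> [[a x][b y]]; rewrite /restr /yx /ab /psi2 /phi2 /qterm /=.
    rewrite !ltnS leq_addl leq_addr fp2 //; congr (p _ _ * q ^+ _); first by rewrite addSn addnS.
    by ring.
  move=> [[a x][b y]] h; rewrite /restr /yx /=; case: ltnP => // lab.
  by have := h ((a, x), (b, (y - x).-1)); rewrite /phi2 /= -addnS prednK ?subn_gt0 // subnKC ?eqxx // ltnW.
rewrite (restr_split _ hf hA hB hD) ?(restr_split _ hp hA' hB' hP); last 2 first.
- by move=> [[a x] [b y]]; rewrite /ba /ab /=; case: ltngtP.
- by move=> [[a x] [b y]]; rewrite /xy /yx /=; case: ltngtP.
by ring.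
Qed.

(** For x = y the exponent is (a + b) x. The terms are grouped by n = a + b, which is [t.1.+1]. *)
Lemma diag_mult f D M : abs_le (qterm f) M ->
  sums_to (restr (fun t => t.1.2 == t.2.2) (qterm f)) D ->
  sums_to (fun t : nat * nat => (\sum_(a < t.1) f a.+1 (t.1 - a)%N) *
    q ^+ (t.1.+1 * t.2.+1)) D.
Proof.
move=> af hD.
pose u (t : (nat * nat) * nat) := if (t.2 < t.1.1)%N
  then f t.2.+1 (t.1.1 - t.2)%N * q ^+ (t.1.1.+1 * t.1.2.+1) else 0.
pose psi (t : (nat * nat) * nat) : (nat * nat) * nat := (((t.1.1 + t.2).+1, t.1.2), t.1.1).
pose chi (t : (nat * nat) * nat) : I4 := (t.1, (t.2, t.1.2)).
have chii : injective chi by move=> [[a x] b] [[a' x'] b'] [-> -> ->].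
have psii : injective psi.
  by move=> [[a x] b] [[a' x'] b'] [+ -> ea]; rewrite ea => /addnI ->.
have hu : sums_to u D.
  apply: (sums_to_inj psii).
    move=> [[d x] a] h; rewrite /u /=; case: ltnP => // lab.
    by have := h ((a, x), (d - a).-1); rewrite /psi /= -addnS prednK ?subn_gt0 // subnKC ?eqxx // ltnW.
  apply: sums_to_ext (sums_to_inj_ext chii _ (abs_le_inj chii (abs_le_restr _ af)) hD).
    move=> [[a x] b]; rewrite /u /psi /restr /chi /qterm /= eqxx ltnS leq_addr.
    by rewrite subSn ?leq_addr // addKn; congr (_ * q ^+ _); ring.
  move=> [[a x][b y]] h; rewrite /restr /=; case: eqP => // xy'.
  by have := h ((a, x), b); rewrite /chi /= xy' eqxx.
apply: sums_to_sigma hu _ => -[d x] /=.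
have := @sums_to_fin _ _ (fun a => u ((d, x), a)) (iota 0 d) (iota_uniq _ _).
have -> : \sum_(i <- iota 0 d) u ((d, x), i) =
    (\sum_(a < d) f a.+1 (d - a)%N) * q ^+ (d.+1 * x.+1).
  rewrite mulr_suml -(big_mkord predT (fun a => f a.+1 (d - a)%N * _)) /index_iota subn0.
  by rewrite !big_seq; apply: eq_bigr => a; rewrite mem_iota /u /= => ->.
by apply => a; rewrite mem_iota /= add0n /u /= => /negbTE ->.
Qed.

(** For a = b the exponent is a (x + y), and m = x + y has m - 1 decompositions into positive
    integers; m is [t.2.+1], whence the factor [t.2]. *)
Lemma diag_base p P M : abs_le (qterm p) M ->
  sums_to (restr (fun t => t.1.1 == t.2.1) (qterm p)) P ->
  sums_to (fun t : nat * nat => t.2%:R * p t.1.+1 t.1.+1 * q ^+ (t.1.+1 * t.2.+1)) P.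
Proof.
move=> ap hP.
pose u (t : (nat * nat) * nat) := if (t.2 < t.1.2)%N
  then p t.1.1.+1 t.1.1.+1 * q ^+ (t.1.1.+1 * t.1.2.+1) else 0.
pose psi (t : nat * (nat * nat)) : (nat * nat) * nat := ((t.1, (t.2.1 + t.2.2).+1), t.2.1).
pose chi (t : nat * (nat * nat)) : I4 := ((t.1, t.2.1), (t.1, t.2.2)).
have chii : injective chi by move=> [a [x y]] [a' [x' y']] [-> -> _ ->].
have psii : injective psi.
  by move=> [a [x y]] [a' [x' y']] [-> + ex]; rewrite ex => /addnI ->.
have hu : sums_to u P.
  apply: (sums_to_inj psii).
    move=> [[a m] x] h; rewrite /u /=; case: ltnP => // lab.
    by have := h (a, (x, (m - x).-1)); rewrite /psi /= -addnS prednK ?subn_gt0 // subnKC ?eqxx // ltnW.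
  apply: sums_to_ext (sums_to_inj_ext chii _ (abs_le_inj chii (abs_le_restr _ ap)) hP).
    move=> [a [x y]]; rewrite /u /psi /restr /chi /qterm /= eqxx ltnS leq_addr.
    by congr (_ * q ^+ _); ring.
  move=> [[a x][b y]] h; rewrite /restr /=; case: eqP => // ab.
  by have := h (a, (x, y)); rewrite /chi /= ab eqxx.
apply: sums_to_sigma hu _ => -[a m] /=.
have := @sums_to_fin _ _ (fun x => u ((a, m), x)) (iota 0 m) (iota_uniq _ _).
have -> : \sum_(x <- iota 0 m) u ((a, m), x) =
    m%:R * p a.+1 a.+1 * q ^+ (a.+1 * m.+1).
  rewrite big_seq (eq_bigr (fun=> p a.+1 a.+1 * q ^+ (a.+1 * m.+1))).
    by rewrite -big_seq big_const_seq count_predT size_iota iter_addr_0 -mulrA mulr_natl.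
  by move=> x; rewrite mem_iota /u /= => ->.
by apply => x; rewrite mem_iota /= add0n /u /= => /negbTE ->.
Qed.

Definition wterm (i j : nat) (t : nat * nat) : C :=
  t.1.+1%:R ^+ i * t.2.+1%:R ^+ j * q ^+ (t.1.+1 * t.2.+1)%N.

(* The sum of [a^i b^j q^(a b)] over all [a, b >= 1]. *)
Definition W i j : C := hsum (wterm i j).

Lemma qsumm_expS k : qsumm (fun n => n.+1%:R ^+ k : C).
Proof.
elim: k => [|k IH]; first by apply: qsumm_ext (qsumm_cst 1) => n; rewrite expr0.
apply: qsumm_ext (qsumm_add (qsumm_nat IH) IH) => n.
by rewrite exprS -natr1 mulrDl mul1r.
Qed.

(** As (a + 1) (x + 1) >= a + x, the double series is dominated by a product of two power series in
    |q|. *)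
Lemma abs_le_wterm i j : exists M, abs_le (wterm i j) M.
Proof.
have hq : 0 <= nm q < 1 by rewrite nm_ge0.
have [M hM] := qsumm_expS i hq; have [N hN] := qsumm_expS j hq.
have [l hl] := sums_to_exists hM; have [m hm] := sums_to_exists hN.
have [hMN _] := sums_to_mul hM hN hl hm; exists (M * N); apply: abs_le_le hMN => // -[a x] /=.
rewrite /wterm /= mulrACA -rmorphM -exprD nmM [leRHS]nmM ler_wpM2l ?nm_ge0 //.
rewrite nm_real ger0_norm ?exprn_ge0 ?nm_ge0 // nmX.
apply: ler_wiXn2l; rewrite ?nm_ge0 ?ltW //.
by rewrite mulSn mulnS; lia.
Qed.

Lemma W_sums_to i j : sums_to (wterm i j) (W i j).
Proof. by have [M /hsumP] := abs_le_wterm i j. Qed.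

Lemma W_mul i j : (exists M, abs_le (qterm (fun a b => a%:R ^+ i * b%:R ^+ j)) M) /\
  sums_to (qterm (fun a b => a%:R ^+ i * b%:R ^+ j)) (W i 0 * W j 0).
Proof.
have [M hM] := abs_le_wterm i 0; have [N hN] := abs_le_wterm j 0.
have [h1 h2] := sums_to_mul hM hN (W_sums_to i 0) (W_sums_to j 0).
have E : (fun t : I4 => wterm i 0 t.1 * wterm j 0 t.2) =1
    qterm (fun a b => a%:R ^+ i * b%:R ^+ j).
  move=> [[a x] [b y]]; rewrite /wterm /qterm /= !expr0 !mulr1 exprD.
  by rewrite mulrACA.
by split; [exists (M * N); exact: abs_le_ext E h1|exact: sums_to_ext E h2].
Qed.

Definition pgrowth f := exists (K : R) (k : nat), 0 <= K /\
  forall a b, nm (f a.+1 b.+1) <= K * (a.+1%:R ^+ k * b.+1%:R ^+ k).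

Lemma pgrowth_abs_le f : pgrowth f -> exists M, abs_le (qterm f) M.
Proof.
move=> [K [k [K0 h]]]; have [[M hM] _] := W_mul k k; exists (nm K%:C%C * M).
apply: abs_le_le (abs_le_scale _ hM) => // -[[a x] [b y]].
rewrite /qterm /= mulrA !nmM ler_wpM2r ?nm_ge0 //; apply: le_trans (h a b) _.
by rewrite !nmX !nm_nat nm_real ger0_norm.
Qed.

Lemma pgrowth_cst c : pgrowth (fun _ _ => c).
Proof. by exists (nm c), 0%N; split=> [|a b]; rewrite ?nm_ge0 // !expr0 !mulr1. Qed.

Lemma pgrowth_fst : pgrowth (fun a _ => a%:R).
Proof.
exists 1, 1%N; split=> // a b; rewrite nm_nat mul1r !expr1 ler_peMr //.
by rewrite ler1n.
Qed.

Lemma pgrowth_snd : pgrowth (fun _ b => b%:R).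
Proof.
exists 1, 1%N; split=> // a b; rewrite nm_nat mul1r !expr1 ler_peMl //.
by rewrite ler1n.
Qed.

Lemma pgrowth_mul f p : pgrowth f -> pgrowth p -> pgrowth (fun a b => f a b * p a b).
Proof.
move=> [K [k [K0 h]]] [L [l [L0 h']]]; exists (K * L), (k + l)%N.
split=> [|a b]; first exact: mulr_ge0.
rewrite nmM; apply: le_trans (ler_pM (nm_ge0 _) (nm_ge0 _) (h a b) (h' a b)) _.
by rewrite !exprD le_eqVlt; apply/orP; left; apply/eqP; ring.
Qed.

Lemma pgrowth_add f p : pgrowth f -> pgrowth p -> pgrowth (fun a b => f a b + p a b).
Proof.
move=> [K [k [K0 h]]] [L [l [L0 h']]]; exists (K + L), (k + l)%N.
split=> [|a b]; first exact: addr_ge0.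
apply: le_trans (nmD _ _) _; rewrite mulrDl lerD //.
  apply: le_trans (h a b) _; rewrite ler_wpM2l // ler_pM ?exprn_ge0 //;
  by rewrite ler_weXn2l ?ler1n // leq_addr.
apply: le_trans (h' a b) _; rewrite ler_wpM2l // ler_pM ?exprn_ge0 //;
by rewrite ler_weXn2l ?ler1n // leq_addl.
Qed.

Lemma pgrowth_exp f k : pgrowth f -> pgrowth (fun a b => f a b ^+ k).
Proof.
move=> hf; elim: k => [|k IH]; first exact: (pgrowth_cst 1).
have [K [l [K0 h]]] := pgrowth_mul hf IH.
by exists K, l; split=> // a b; rewrite exprS.
Qed.

Lemma pgrowth_opp f : pgrowth f -> pgrowth (fun a b => - f a b).
Proof. by move=> [K [k [K0 h]]]; exists K, k; split=> // a b; rewrite nmN. Qed.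

(** Only the two diagonals remain. On x = y the sums over a + b = n are polynomial in n with
    coefficients [c]; on a = b the weight m - 1 turns p(a, a) = e a^k into e ([W k 1] - [W k 0]).
    For k >= 1, [W k 1] is the sum of n sigma_{k-1}(n) q^n, so such an identity expresses the
    derivative of an Eisenstein series by products of others. *)
Lemma skoruppa f p L (c : seq C) e k :
  pgrowth f -> pgrowth p ->
  (forall a b, (0 < a)%N -> (0 < b)%N -> f a b = p a (a + b)%N) ->
  (forall a b, (0 < a)%N -> (0 < b)%N -> f a b = p (a + b)%N b) ->
  sums_to (qterm (fun a b => f a b - p a b)) L ->
  (forall d, \sum_(a < d) f a.+1 (d - a)%N = \sum_(i < size c) c`_i * d.+1%:R ^+ i) ->
  (forall a, p a a = e * a%:R ^+ k) ->
  L = \sum_(i < size c) c`_i * W i 0 - e * (W k 1 - W k 0).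
Proof.
move=> /pgrowth_abs_le[M aM] /pgrowth_abs_le[N aN] h1 h2 hL hc hp.
have [Lf hf] := sums_to_exists aM; have [Lp hp'] := sums_to_exists aN.
have [D hD] := sums_to_exists (abs_le_restr (fun t => t.1.2 == t.2.2) aM).
have [P hP] := sums_to_exists (abs_le_restr (fun t => t.1.1 == t.2.1) aN).
have -> : L = Lf - Lp.
  apply: sums_to_unique hL _; apply: sums_to_ext (sums_to_sub hf hp') => t.
  by rewrite /qterm mulrBl.
rewrite (qterm_exchange h1 h2 aM aN hf hp' hD hP); congr (_ - _).
  apply: sums_to_unique (diag_mult aM hD) _.
  have := @sums_to_sum R _ _ (index_enum 'I_(size c)) predT (fun i t => c`_i * wterm i 0 t)
    (fun i => c`_i * W i 0) (fun i _ => sums_to_scale _ (W_sums_to i 0)).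
  apply: sums_to_ext => t; rewrite hc mulr_suml; apply: eq_bigr => i _.
  by rewrite /wterm expr0 mulr1 mulrA.
apply: sums_to_unique (diag_base aN hP) _.
apply: sums_to_ext (sums_to_scale e (sums_to_sub (W_sums_to k 1) (W_sums_to k 0))) => t.
by rewrite /wterm hp expr0 expr1 mulr1 -natr1; ring.
Qed.

(** [G D] is a discrete primitive of x -> F(x, D - x). In the applications it is assembled from the
    Faulhaber polynomials, after expansion of the summand in powers of D. *)
Lemma sum_conv (F G : C -> C -> C) d : (forall D, G D 0 = 0) ->
  (forall D x, G D (x + 1) = G D x + F (x + 1) (D - (x + 1))) ->
  \sum_(a < d) F a.+1%:R (d - a)%N%:R = G d.+1%:R d%:R.
Proof.
move=> G0 GS; rewrite (eq_bigr (fun a : 'I_d => F a.+1%:R (d.+1%:R - a.+1%:R))).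
  move: (d.+1%:R : C) => D.
  by elim: d => [|d IH]; rewrite ?big_ord0 ?G0 // big_ord_recr IH -natr1 GS.
by move=> a _; rewrite -natrB ?subSS // ltnS ltnW.
Qed.

Definition W_qterm i j := proj2 (W_mul i j).

(** Both substitutions turn a^2 - a b + b^2 into a^2 + a b + b^2. The first, second and third powers
    of this form give the derivatives of the series of weights 2, 4 and 6. Each time the coefficient
    -1 in the list cancels the term [W k 0] of the diagonal a = b. *)
Lemma W11 : 2 * (W 1 0 * W 1 0) = 5 / 6 * W 3 0 + W 1 0 / 6 - W 2 1.
Proof.
pose f a b : C := a%:R ^+ 2 + a%:R * b%:R + b%:R ^+ 2.
pose p a b : C := a%:R ^+ 2 - a%:R * b%:R + b%:R ^+ 2.
rewrite (@skoruppa f p (2 * (W 1 0 * W 1 0)) [:: 0; 1/6; -1; 5/6] 1 2).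
- by rewrite !big_ord_recl big_ord0 /=; field.
- by rewrite /f; do ![apply: pgrowth_add|apply: pgrowth_opp|apply: pgrowth_mul|apply: pgrowth_exp|exact: pgrowth_fst|exact: pgrowth_snd].
- by rewrite /p; do ![apply: pgrowth_add|apply: pgrowth_opp|apply: pgrowth_mul|apply: pgrowth_exp|exact: pgrowth_fst|exact: pgrowth_snd].
- by move=> a b _ _; rewrite /f /p natrD; ring.
- by move=> a b _ _; rewrite /f /p natrD; ring.
- apply: sums_to_ext (sums_to_scale 2 (W_qterm 1 1)) => t; rewrite /qterm /f /p.
  by rewrite mulrA; congr (_ * _); ring.
- move=> d; rewrite (sum_conv (F := fun A B => A ^+ 2 + A * B + B ^+ 2) (G := fun D x => (1) * D ^+ 0 * (x * (x + 1) * (2 * x + 1) / 6) + (-1) * D ^+ 1 * (x * (x + 1) / 2) + (1) * D ^+ 2 * x)).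
  + by rewrite !big_ord_recl big_ord0 /= -natr1; field.
  + by move=> D; field.
  + by move=> D x; field.
- by move=> a; rewrite /p; ring.
Qed.

Lemma W13 : 4 * (W 1 0 * W 3 0 + W 3 0 * W 1 0) = 7 / 10 * W 5 0 + W 3 0 / 3 - W 1 0 / 30 - W 4 1.
Proof.
pose f a b : C := (a%:R ^+ 2 + a%:R * b%:R + b%:R ^+ 2) ^+ 2.
pose p a b : C := (a%:R ^+ 2 - a%:R * b%:R + b%:R ^+ 2) ^+ 2.
rewrite (@skoruppa f p (4 * (W 1 0 * W 3 0 + W 3 0 * W 1 0)) [:: 0; -1/30; 0; 1/3; -1; 7/10] 1 4).
- by rewrite !big_ord_recl big_ord0 /=; field.
- by rewrite /f; do ![apply: pgrowth_add|apply: pgrowth_opp|apply: pgrowth_mul|apply: pgrowth_exp|exact: pgrowth_fst|exact: pgrowth_snd].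
- by rewrite /p; do ![apply: pgrowth_add|apply: pgrowth_opp|apply: pgrowth_mul|apply: pgrowth_exp|exact: pgrowth_fst|exact: pgrowth_snd].
- by move=> a b _ _; rewrite /f /p natrD; ring.
- by move=> a b _ _; rewrite /f /p natrD; ring.
- apply: sums_to_ext (sums_to_scale 4 (sums_to_add (W_qterm 1 3) (W_qterm 3 1))) => t.
  by rewrite /qterm /f /p -mulrDl mulrA; congr (_ * _); ring.
- move=> d; rewrite (sum_conv (F := fun A B => (A ^+ 2 + A * B + B ^+ 2) ^+ 2) (G := fun D x => (1) * D ^+ 0 * (x * (x + 1) * (2 * x + 1) * (3 * x ^+ 2 + 3 * x - 1) / 30) + (-2) * D ^+ 1 * (x * (x + 1) / 2) ^+ 2 + (3) * D ^+ 2 * (x * (x + 1) * (2 * x + 1) / 6) + (-2) * D ^+ 3 * (x * (x + 1) / 2) + (1) * D ^+ 4 * x)).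
  + by rewrite !big_ord_recl big_ord0 /= -natr1; field.
  + by move=> D; field.
  + by move=> D x; field.
- by move=> a; rewrite /p; ring.
Qed.

Lemma W15 : 6 * (W 1 0 * W 5 0 + W 5 0 * W 1 0) + 14 * (W 3 0 * W 3 0) = 83 / 140 * W 7 0 + W 5 0 / 2 - 7 / 60 * W 3 0 + W 1 0 / 42 - W 6 1.
Proof.
pose f a b : C := (a%:R ^+ 2 + a%:R * b%:R + b%:R ^+ 2) ^+ 3.
pose p a b : C := (a%:R ^+ 2 - a%:R * b%:R + b%:R ^+ 2) ^+ 3.
rewrite (@skoruppa f p (6 * (W 1 0 * W 5 0 + W 5 0 * W 1 0) + 14 * (W 3 0 * W 3 0)) [:: 0; 1/42; 0; -7/60; 0; 1/2; -1; 83/140] 1 6).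
- by rewrite !big_ord_recl big_ord0 /=; field.
- by rewrite /f; do ![apply: pgrowth_add|apply: pgrowth_opp|apply: pgrowth_mul|apply: pgrowth_exp|exact: pgrowth_fst|exact: pgrowth_snd].
- by rewrite /p; do ![apply: pgrowth_add|apply: pgrowth_opp|apply: pgrowth_mul|apply: pgrowth_exp|exact: pgrowth_fst|exact: pgrowth_snd].
- by move=> a b _ _; rewrite /f /p natrD; ring.
- by move=> a b _ _; rewrite /f /p natrD; ring.
- apply: sums_to_ext (sums_to_add (sums_to_scale 6 (sums_to_add (W_qterm 1 5) (W_qterm 5 1)))
    (sums_to_scale 14 (W_qterm 3 3))) => t.
  by rewrite /qterm /f /p -mulrDl !mulrA -mulrDl; congr (_ * _); ring.
- move=> d; rewrite (sum_conv (F := fun A B => (A ^+ 2 + A * B + B ^+ 2) ^+ 3) (G := fun D x => (1) * D ^+ 0 * (x * (x + 1) * (2 * x + 1) * (3 * x ^+ 4 + 6 * x ^+ 3 - 3 * x + 1) / 42) + (-3) * D ^+ 1 * (x ^+ 2 * (x + 1) ^+ 2 * (2 * x ^+ 2 + 2 * x - 1) / 12) + (6) * D ^+ 2 * (x * (x + 1) * (2 * x + 1) * (3 * x ^+ 2 + 3 * x - 1) / 30) + (-7) * D ^+ 3 * (x * (x + 1) / 2) ^+ 2 + (6) * D ^+ 4 * (x * (x + 1) * (2 * x + 1) / 6) + (-3) * D ^+ 5 * (x * (x + 1) / 2) + (1) * D ^+ 6 * x)).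
  + by rewrite !big_ord_recl big_ord0 /= -natr1; field.
  + by move=> D; field.
  + by move=> D x; field.
- by move=> a; rewrite /p; ring.
Qed.

(** This [p] vanishes for a = b, so no derivative appears. The result is E4^2 = E8, by which [W 7 0]
    is eliminated from [W15]. *)
Lemma W33 : 4 * (W 3 0 * W 3 0) = (W 7 0 - W 3 0) / 30.
Proof.
pose f a b : C := (a%:R * b%:R * (a%:R + b%:R)) ^+ 2.
pose p a b : C := (a%:R * b%:R * (a%:R - b%:R)) ^+ 2.
rewrite (@skoruppa f p (4 * (W 3 0 * W 3 0)) [:: 0; 0; 0; -1/30; 0; 0; 0; 1/30] 0 0).
- by rewrite !big_ord_recl big_ord0 /=; field.
- by rewrite /f; do ![apply: pgrowth_add|apply: pgrowth_opp|apply: pgrowth_mul|apply: pgrowth_exp|exact: pgrowth_fst|exact: pgrowth_snd].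
- by rewrite /p; do ![apply: pgrowth_add|apply: pgrowth_opp|apply: pgrowth_mul|apply: pgrowth_exp|exact: pgrowth_fst|exact: pgrowth_snd].
- by move=> a b _ _; rewrite /f /p natrD; ring.
- by move=> a b _ _; rewrite /f /p natrD; ring.
- apply: sums_to_ext (sums_to_scale 4 (W_qterm 3 3)) => t.
  by rewrite /qterm /f /p mulrA; congr (_ * _); ring.
- move=> d; rewrite (sum_conv (F := fun A B => (A * B * (A + B)) ^+ 2) (G := fun D x => (1) * D ^+ 2 * (x * (x + 1) * (2 * x + 1) * (3 * x ^+ 2 + 3 * x - 1) / 30) + (-2) * D ^+ 3 * (x * (x + 1) / 2) ^+ 2 + (1) * D ^+ 4 * (x * (x + 1) * (2 * x + 1) / 6))).
  + by rewrite !big_ord_recl big_ord0 /= -natr1; field.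
  + by move=> D; field.
  + by move=> D x; field.
- by move=> a; rewrite /p; ring.
Qed.

End Skoruppa.

(** * Divisor sums as series in q *)

Section Eisenstein.
Variable R : realType.
Local Notation C := R[i].
Implicit Types z w : C.

(* divisors 0 = [:: 1], so the constant term has to be removed by hand. *)
Definition sg k (n : nat) : C := if n is 0%N then 0 else (sigma k n)%:R.

Lemma sigma_le k n : (0 < n)%N -> (sigma k n <= n ^ k.+1)%N.
Proof.
move=> n0; apply: (@leq_trans (\sum_(d <- divisors n) n ^ k)%N).
  rewrite /sigma big_seq [leqRHS]big_seq; apply: leq_sum => d; rewrite -dvdn_divisors //.
  by move=> /dvdn_leq h; case: k => // k; rewrite leq_exp2r // h.
rewrite big_const_seq count_predT iter_addn_0 mulnC expnS leq_mul2r.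
apply/orP; right; rewrite -[leqRHS](size_iota 1); apply: uniq_leq_size.
  exact: divisors_uniq.
move=> d; rewrite -dvdn_divisors // mem_iota add1n ltnS => dn.
by rewrite (dvdn_gt0 n0 dn) dvdn_leq.
Qed.

Lemma qsumm_sg k : qsumm (sg k).
Proof.
apply: (@qsumm_le _ _ (fun n => n%:R ^+ k.+1) 1); last exact: qsumm_exp.
move=> -[|n]; first by rewrite nm0 mul1r nm_ge0.
by rewrite mul1r nmX !nm_nat -natrX ler_nat sigma_le.
Qed.

(** The pairs (a, x) are grouped by the product n = a x, with a as the divisor. *)
Lemma qs_divisors (F : nat -> nat -> C) z l :
  sums_to (fun t : nat * nat => F (t.1.+1 * t.2.+1)%N t.1.+1 * nome z ^+ (t.1.+1 * t.2.+1)) l ->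
  qs (fun n => if n is 0%N then 0 else \sum_(d <- divisors n) F n d) z = l.
Proof.
move=> h.
pose u (t : nat * nat) := if (0 < t.1)%N && (t.2 \in divisors t.1)
  then F t.1 t.2 * nome z ^+ t.1 else 0.
pose psi (t : nat * nat) := ((t.1.+1 * t.2.+1)%N, t.1.+1).
have psii : injective psi.
  move=> [a x] [a' x'] e; have ea : a = a' by case: e.
  have /eqP : (a.+1 * x.+1 = a'.+1 * x'.+1)%N := congr1 fst e.
  by rewrite ea eqn_mul2l /= => /eqP[->].
have hu : sums_to u l.
  apply: (sums_to_inj psii).
    move=> [n d] hn; rewrite /u /=; case: ifP => // /andP[n0].
    rewrite -dvdn_divisors // => dn; have d0 := dvdn_gt0 n0 dn.
    have q0 : (0 < n %/ d)%N by rewrite divn_gt0 // dvdn_leq.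
    have := hn (d.-1, (n %/ d).-1).
    by rewrite /psi /= !prednK // mulnC divnK // eqxx.
  apply: sums_to_ext h => -[a x].
  have -> : (u \o psi) (a, x) = if (0 < a.+1 * x.+1)%N &&
    (a.+1 \in divisors (a.+1 * x.+1)%N) then F (a.+1 * x.+1)%N a.+1 *
      nome z ^+ (a.+1 * x.+1) else 0 by [].
  by rewrite muln_gt0 -dvdn_divisors ?muln_gt0 // dvdn_mulr.
apply: hsum_eq; apply: sums_to_sigma hu _ => n.
have := @sums_to_fin _ _ (fun d => u (n, d)) (divisors n) (divisors_uniq n).
case: n => [|n].
  by rewrite big1 ?mul0r => [|d _] //; apply => d _; rewrite /u.
rewrite [X in sums_to _ X](eq_big_seq (fun d => F n.+1 d * nome z ^+ n.+1)).
  by rewrite -mulr_suml; apply => d dn; rewrite /u /= (negbTE dn).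
by move=> d dn; rewrite /u /= dn.
Qed.

Lemma qs_sg k z : 0 < complex.Im z -> qs (sg k) z = W (nome z) k 0.
Proof.
move=> hz; rewrite -(@qs_divisors (fun n d => d%:R ^+ k) z (W (nome z) k 0)).
  apply: qs_ext => -[|n] //; rewrite /sg /sigma natr_sum.
  by apply: eq_bigr => d _; rewrite natrX.
apply: sums_to_ext (W_sums_to (nome_lt1 hz) k 0) => -[a x].
by rewrite /wterm expr0 mulr1.
Qed.

Lemma qs_dsg k z : 0 < complex.Im z ->
  qs (fun n => n%:R * sg k n) z = W (nome z) k.+1 1.
Proof.
move=> hz; rewrite -(@qs_divisors (fun n d => n%:R * d%:R ^+ k) z (W (nome z) k.+1 1)).
  apply: qs_ext => -[|n]; first by rewrite mul0r.
  rewrite /sg /sigma natr_sum mulr_sumr.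
  by apply: eq_bigr => d _; rewrite natrX.
apply: sums_to_ext (W_sums_to (nome_lt1 hz) k.+1 1) => -[a x].
by rewrite /wterm expr1 natrM exprS /=; ring.
Qed.

Lemma cvgC_lim (u : nat -> C) (l : C) :
  (forall e : R, 0 < e -> exists N0, forall N, (N0 <= N)%N -> nm (u N - l) <= e) ->
  limn (u : nat -> R[i]^o) = l.
Proof.
move=> h; apply: cvg_lim; first exact: norm_hausdorff.
apply/cvgrPdist_le => e e0.
have [N0 hN] := h (complex.Re e) (proj2 (andP (eq_ind _ is_true e0 _ (ltcE 0 e)))).
exists N0 => // N /= /hN hu; rewrite distrC normrC.
have -> : e = (complex.Re e)%:C%C.
  by apply/eqP; rewrite eq_complex eqxx /=; move: e0; rewrite ltcE /= => /andP[].
by rewrite lecR.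
Qed.

Lemma sigma_seriesE k z : 0 < complex.Im z -> sigma_series k z = qs (sg k) z.
Proof.
move=> hz; apply: cvgC_lim => e e0.
have [N0 h] := sums_to_nat (qsP (qsumm_sg k) hz) e0.
exists (maxn N0 1) => N hN; have := h N (leq_trans (leq_maxl _ _) hN).
case: N {h} hN => [|N _]; first by rewrite geq_max ltn0 andbF.
rewrite big_nat_recl // /sg mul0r add0r big_add1 /=.
by under [in X in _ -> X]eq_bigr do idtac.
Qed.

End Eisenstein.

(** * Ramanujan's differential equations *)

Section Cdiff.
Variable R : realType.
Local Notation C := R[i].
Implicit Types (f g : C -> C) (z d : C).

Definition cdiff f z d := forall e : R, 0 < e -> exists2 r : R, 0 < r &
  forall h, nm h < r -> nm (f (z + h) - f z - d * h) <= e * nm h.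

Lemma cdiff_quad f z d (K r : R) : 0 < r ->
  (forall h, nm h < r -> nm (f (z + h) - f z - d * h) <= K * nm h ^+ 2) -> cdiff f z d.
Proof.
move=> r0 h e e0.
have K0 : 0 < `|K| + 1 by rewrite ltr_wpDl.
exists (Num.min r (e / (`|K| + 1))); first by rewrite lt_min r0 divr_gt0.
move=> w; rewrite lt_min => /andP[w1 w2]; apply: le_trans (h w w1) _.
rewrite expr2 mulrA ler_wpM2r ?nm_ge0 //.
move: w2; rewrite ltr_pdivlMr // => /ltW; apply: le_trans.
rewrite mulrC ler_wpM2l ?nm_ge0 //; apply: le_trans (ler_norm _) _.
by rewrite lerDl.
Qed.

Lemma cdiff_bound f z d : cdiff f z d -> exists2 r : R, 0 < r &
  forall h, nm h < r -> nm (f (z + h) - f z) <= (nm d + 1) * nm h.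
Proof.
move=> /(_ 1 ltr01)[r r0 h]; exists r => // w /h; rewrite mul1r => hw.
rewrite mulrDl mul1r [leRHS]addrC.
apply: le_trans (nm_le_add _ (d * w)) _.
by rewrite nmM lerD2r.
Qed.

Lemma cdiff_near f g z d (r : R) : 0 < r -> (forall h, nm h < r -> f (z + h) = g (z + h)) ->
  cdiff f z d -> cdiff g z d.
Proof.
move=> r0 fg hf e e0; have [s s0 h] := hf e e0.
exists (Num.min r s); first by rewrite lt_min r0.
move=> w; rewrite lt_min => /andP[w1 w2]; rewrite -fg //.
by have := fg 0; rewrite nm0 addr0 => <- //; exact: h.
Qed.

Lemma cdiff_cst c z : cdiff (fun=> c) z 0.
Proof.
move=> e e0; exists 1 => // h _; rewrite subrr mul0r subrr nm0.
by rewrite mulr_ge0 ?nm_ge0 // ltW.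
Qed.

Lemma cdiff_id z : cdiff id z 1.
Proof.
move=> e e0; exists 1 => // h _; have -> : id (z + h) - id z - 1 * h = 0 by rewrite /=; ring.
rewrite nm0.
by rewrite mulr_ge0 ?nm_ge0 // ltW.
Qed.

Lemma cdiff_add f g z d d' : cdiff f z d -> cdiff g z d' ->
  cdiff (fun x => f x + g x) z (d + d').
Proof.
move=> hf hg e e0.
have [r r0 h] := hf _ (divr_gt0 e0 (ltr0Sn _ 1)).
have [s s0 h'] := hg _ (divr_gt0 e0 (ltr0Sn _ 1)).
exists (Num.min r s); first by rewrite lt_min r0.
move=> w; rewrite lt_min => /andP[w1 w2].
have -> : f (z + w) + g (z + w) - (f z + g z) - (d + d') * w =
  (f (z + w) - f z - d * w) + (g (z + w) - g z - d' * w) by ring.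
apply: le_trans (nmD _ _) _; rewrite [e]splitr mulrDl.
by apply: lerD; [exact: h|exact: h'].
Qed.

Lemma cdiff_mul f g z d d' : cdiff f z d -> cdiff g z d' ->
  cdiff (fun x => f x * g x) z (d * g z + f z * d').
Proof.
move=> hf hg e e0.
have [rf rf0 bf] := cdiff_bound hf; have [rg rg0 bg] := cdiff_bound hg.
pose B := nm (f z) + nm (g z) + (nm d + 1) * (nm d' + 1) + 1.
have X0 : 0 <= (nm d + 1) * (nm d' + 1) by rewrite mulr_ge0 ?addr_ge0 ?nm_ge0.
have B0 : 0 < B by rewrite /B; have := nm_ge0 (f z); have := nm_ge0 (g z); lra.
pose e1 := e / B; have e10 : 0 < e1 by rewrite divr_gt0.
have [r r0 h] := hf _ e10; have [s s0 h'] := hg _ e10.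
exists (Num.min (Num.min r s) (Num.min (Num.min rf rg) e1)).
  by rewrite !lt_min r0 s0 rf0 rg0.
move=> w; rewrite !lt_min => /andP[/andP[w1 w2] /andP[/andP[w3 w4] w5]].
have -> : f (z + w) * g (z + w) - f z * g z - (d * g z + f z * d') * w =
  (f (z + w) - f z - d * w) * g z + f z * (g (z + w) - g z - d' * w) +
  (f (z + w) - f z) * (g (z + w) - g z) by ring.
apply: (@le_trans _ _ (e1 * nm w * nm (g z) + nm (f z) * (e1 * nm w) +
  (nm d + 1) * nm w * ((nm d' + 1) * nm w))).
  apply: le_trans (nmD _ _) _; apply: lerD.
    apply: le_trans (nmD _ _) _; rewrite !nmM; apply: lerD.
      by rewrite ler_wpM2r ?nm_ge0 ?h.
    by rewrite ler_wpM2l ?nm_ge0 ?h'.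
  by rewrite nmM; apply: ler_pM; rewrite ?nm_ge0 ?bf ?bg.
have -> : e = e1 * B by rewrite divfK // gt_eqF.
have : (nm d + 1) * (nm d' + 1) * nm w * nm w <= (nm d + 1) * (nm d' + 1) * nm w * e1.
  by apply: ler_wpM2l; [rewrite mulr_ge0 ?nm_ge0|exact: ltW].
have : 0 <= e1 * nm w by rewrite mulr_ge0 ?nm_ge0 // ltW.
move=> h1 h2; rewrite /B.
by move: (nm w) (nm d) (nm d') (nm (f z)) (nm (g z)) h1 h2 => W D D' F G h1 h2; lra.
Qed.

Lemma cdiff_scale f z d c : cdiff f z d -> cdiff (fun x => c * f x) z (c * d).
Proof. by move=> /(cdiff_mul (cdiff_cst c z)); rewrite mul0r add0r. Qed.

Lemma cdiff_comp f g z d d' : cdiff g z d' -> cdiff f (g z) d ->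
  cdiff (f \o g) z (d * d').
Proof.
move=> hg hf e e0.
have [rg rg0 bg] := cdiff_bound hg.
pose B := nm d' + 1; have B0 : 0 < B by rewrite ltr_wpDl ?nm_ge0.
have D0 : 0 < nm d + 1 by rewrite ltr_wpDl ?nm_ge0.
have [r r0 h] := hf (e / 2 / B) (divr_gt0 (divr_gt0 e0 (ltr0Sn _ 1)) B0).
have [s s0 h'] := hg (e / 2 / (nm d + 1)) (divr_gt0 (divr_gt0 e0 (ltr0Sn _ 1)) D0).
exists (Num.min (Num.min s rg) (r / B)); first by rewrite !lt_min s0 rg0 divr_gt0.
move=> w; rewrite !lt_min => /andP[/andP[w1 w2] w3].
pose k := g (z + w) - g z.
have kB : nm k <= B * nm w by exact: bg.
have kr : nm k < r by apply: le_lt_trans kB _; rewrite mulrC -ltr_pdivlMr.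
have -> : (f \o g) (z + w) - (f \o g) z - d * d' * w =
  (f (g z + k) - f (g z) - d * k) + d * (k - d' * w).
  have zk : g z + k = g (z + w) by rewrite /k addrC subrK.
  by rewrite zk /k /=; ring.
apply: le_trans (nmD _ _) _; rewrite [e]splitr mulrDl lerD //.
  apply: le_trans (h _ kr) _.
  apply: (@le_trans _ _ (e / 2 / B * (B * nm w))).
    by rewrite ler_wpM2l // ltW // !divr_gt0.
  by rewrite mulrA divfK // gt_eqF.
rewrite nmM; apply: (@le_trans _ _ ((nm d + 1) * (e / 2 / (nm d + 1) * nm w))).
  by apply: ler_pM; rewrite ?nm_ge0 ?lerDl ?h'.
by rewrite mulrA mulrCA divff ?mulr1 // gt_eqF.
Qed.

Lemma cdiff_inv z : z != 0 -> cdiff (fun x => x^-1) z (- z ^- 2).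
Proof.
move=> z0; have nz : 0 < nm z by rewrite nm_gt0.
apply: (@cdiff_quad _ _ _ (2 / nm z ^+ 3) (nm z / 2)); first by rewrite divr_gt0.
move=> h hh; have zh : nm z / 2 <= nm (z + h).
  have := nm_le_add z (- h); rewrite opprK nmN; lra.
have zh0 : z + h != 0 by rewrite -nm_gt0; apply: lt_le_trans zh; rewrite divr_gt0.
have -> : (z + h)^-1 - z^-1 - - z ^- 2 * h = h ^+ 2 / (z ^+ 2 * (z + h)).
  by field; rewrite z0 zh0.
rewrite nmM nmV nmX [nm (_ * (z + h))]nmM nmX mulrC; apply: ler_wpM2r; first by rewrite exprn_ge0 ?nm_ge0.
have -> : 2 / nm z ^+ 3 = (nm z ^+ 2 * (nm z / 2))^-1 by field; rewrite gt_eqF.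
rewrite lef_pV2 ?posrE ?mulr_gt0 ?exprn_gt0 // -?nm_gt0 ?invr_gt0 ?nm_gt0 //.
by rewrite ler_wpM2l ?exprn_ge0 ?nm_ge0.
Qed.

Lemma cdiff_unique f z d d' : cdiff f z d -> cdiff f z d' -> d = d'.
Proof.
move=> hf hf'; apply: nm_eps_eq => e e0.
have [r r0 h] := hf _ (divr_gt0 e0 (ltr0Sn _ 1)).
have [s s0 h'] := hf' _ (divr_gt0 e0 (ltr0Sn _ 1)).
pose t := Num.min r s / 2.
have t0 : 0 < t by rewrite divr_gt0 // lt_min r0.
have nt : nm t%:C%C = t by rewrite nm_real gtr0_norm.
have [t1 t2] : t < r /\ t < s.
  have [m1 m2] : Num.min r s <= r /\ Num.min r s <= s by rewrite !ge_min !lexx orbT.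
  by rewrite /t in t0 *; lra.
have := h t%:C%C; have := h' t%:C%C; rewrite nt => /(_ t2) H' /(_ t1) H.
rewrite -(ler_pM2r t0) -[in leLHS]nt -nmM.
have -> : (d - d') * t%:C%C = (f (z + t%:C%C) - f z - d' * t%:C%C) -
   (f (z + t%:C%C) - f z - d * t%:C%C) by ring.
by apply: le_trans (nmB _ _) _; rewrite [e]splitr mulrDl lerD.
Qed.

(** In zero variables the algebra consists of constants, so [nb_qs] becomes a quadratic error
    estimate for numbers. *)
Lemma cdiff_qs a z : qsumm a -> 0 < complex.Im z ->
  cdiff (qs a) z (two_pi_i R * qs (fun n => n%:R * a n) z).
Proof.
move=> ha hz; have [K K0 h] := nb_qs ha hz.
apply: (@cdiff_quad _ _ _ K (complex.Im z / 2)); first by rewrite divr_gt0.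
move=> w hw.
have c1 := nb_cst 0 ltr01 w; have c0 := nb_cst 0 ltr01 (0 : C).
have := h 0%N 1 (fun=> w) (fun=> 0) (nm w) (nm w) ltr01 (ltW hw) c1.
rewrite subr0 => /(_ _ c1) H; have {}H := H (nb_le _ c0).
have := nb_val ltr01 (H _) (h := 0).
rewrite addr0 expr2; apply; first by rewrite nm0 nm_ge0.
by case.
Qed.

End Cdiff.

(** * The differential equations of g1, g2, g3 *)

Section Ramanujan.
Variable R : realType.
Local Notation C := R[i].
Implicit Types z : C.

Let u : C := two_pi_i R / 12.

Lemma g_W z : 0 < complex.Im z ->
  [/\ g1 z = u * (1 - 24 * W (nome z) 1 0),
      g2 z = 12 * u ^+ 2 * (1 + 240 * W (nome z) 3 0) &
      g3 z = 8 * u ^+ 3 * (1 - 504 * W (nome z) 5 0)].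
Proof.
by move=> hz; rewrite /g1 /g2 /g3 !sigma_seriesE // !qs_sg.
Qed.

Lemma Im_near z h : nm h < complex.Im z -> 0 < complex.Im (z + h).
Proof.
move=> hh; rewrite raddfD /=; have := nm_Im h.
by rewrite ler_norml => /andP[+ _]; lra.
Qed.

Lemma cdiff_sigma k z : 0 < complex.Im z ->
  cdiff (sigma_series k) z (two_pi_i R * W (nome z) k.+1 1).
Proof.
move=> hz; rewrite -qs_dsg //.
have H := cdiff_qs (qsumm_sg k) hz.
refine (cdiff_near hz _ H).
by move=> h hh; rewrite sigma_seriesE // Im_near.
Qed.

(** This is q dE2/dq = (E2^2 - E4)/12. The normalizing constants of g1, g2, g3 absorb all powers of
    2 pi i, so the coefficients of the system are rational. *)
Lemma cdiff_g1 z : 0 < complex.Im z -> cdiff (@g1 R) z (g1 z ^+ 2 - g2 z / 12).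
Proof.
move=> hz; have [-> -> _] := g_W hz.
have := cdiff_scale u (cdiff_add (cdiff_cst 1 z) (cdiff_scale (-24) (cdiff_sigma 1 hz))).
have E := W11 (nome_lt1 hz).
have -> : u * (0 + -24 * (two_pi_i R * W (nome z) 2 1)) =
   (u * (1 - 24 * W (nome z) 1 0)) ^+ 2 -
   12 * u ^+ 2 * (1 + 240 * W (nome z) 3 0) / 12.
  have -> : W (nome z) 2 1 = 5 / 6 * W (nome z) 3 0 + W (nome z) 1 0 / 6 -
    2 * (W (nome z) 1 0 * W (nome z) 1 0) by rewrite E; ring.
  by rewrite /u; field.
apply: cdiff_near ltr01 _ => h _; rewrite /g1 -/u; ring.
Qed.

Lemma cdiff_g2 z : 0 < complex.Im z -> cdiff (@g2 R) z (4 * g1 z * g2 z - 6 * g3 z).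
Proof.
move=> hz; have [-> -> ->] := g_W hz.
have := cdiff_scale (12 * u ^+ 2)
  (cdiff_add (cdiff_cst 1 z) (cdiff_scale 240 (cdiff_sigma 3 hz))).
have E := W13 (nome_lt1 hz).
have -> : 12 * u ^+ 2 * (0 + 240 * (two_pi_i R * W (nome z) 4 1)) =
   4 * (u * (1 - 24 * W (nome z) 1 0)) * (12 * u ^+ 2 * (1 + 240 * W (nome z) 3 0)) -
   6 * (8 * u ^+ 3 * (1 - 504 * W (nome z) 5 0)).
  have -> : W (nome z) 4 1 = 7 / 10 * W (nome z) 5 0 + W (nome z) 3 0 / 3 -
    W (nome z) 1 0 / 30 - 4 * (W (nome z) 1 0 * W (nome z) 3 0 +
    W (nome z) 3 0 * W (nome z) 1 0) by rewrite E; ring.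
  by rewrite /u; field.
by apply: cdiff_near ltr01 _ => h _; rewrite /g2 -/u.
Qed.

Lemma cdiff_g3 z : 0 < complex.Im z -> cdiff (@g3 R) z (6 * g1 z * g3 z - g2 z ^+ 2 / 3).
Proof.
move=> hz; have [-> -> ->] := g_W hz.
have := cdiff_scale (8 * u ^+ 3)
  (cdiff_add (cdiff_cst 1 z) (cdiff_scale (-504) (cdiff_sigma 5 hz))).
have E := W15 (nome_lt1 hz); have E' := W33 (nome_lt1 hz).
have -> : 8 * u ^+ 3 * (0 + -504 * (two_pi_i R * W (nome z) 6 1)) =
   6 * (u * (1 - 24 * W (nome z) 1 0)) * (8 * u ^+ 3 * (1 - 504 * W (nome z) 5 0)) -
   (12 * u ^+ 2 * (1 + 240 * W (nome z) 3 0)) ^+ 2 / 3.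
  have -> : W (nome z) 6 1 = 83 / 140 * W (nome z) 7 0 + W (nome z) 5 0 / 2 -
    7 / 60 * W (nome z) 3 0 + W (nome z) 1 0 / 42 -
    (6 * (W (nome z) 1 0 * W (nome z) 5 0 +
    W (nome z) 5 0 * W (nome z) 1 0) + 14 * (W (nome z) 3 0 * W (nome z) 3 0)).
    by rewrite E; ring.
  (* E8 is replaced by E4^2, which closes the system. *)
  have -> : W (nome z) 7 0 = W (nome z) 3 0 + 30 * (4 * (W (nome z) 3 0 * W (nome z) 3 0)).
    by rewrite E'; field.
  by rewrite /u; field.
by apply: cdiff_near ltr01 _ => h _; rewrite /g3 -/u; ring.
Qed.

Definition disc z : C := 27 * g3 z ^+ 2 - g2 z ^+ 3.

Lemma cdiff_disc z : 0 < complex.Im z -> cdiff disc z (12 * g1 z * disc z).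
Proof.
move=> hz; have h2 := cdiff_g2 hz; have h3 := cdiff_g3 hz.
have := cdiff_add (cdiff_scale 27 (cdiff_mul h3 h3))
  (cdiff_scale (-1) (cdiff_mul h2 (cdiff_mul h2 h2))).
have -> : 27 * ((6 * g1 z * g3 z - g2 z ^+ 2 / 3) * g3 z +
   g3 z * (6 * g1 z * g3 z - g2 z ^+ 2 / 3)) +
   -1 * ((4 * g1 z * g2 z - 6 * g3 z) * (g2 z * g2 z) +
   g2 z * ((4 * g1 z * g2 z - 6 * g3 z) * g2 z +
   g2 z * (4 * g1 z * g2 z - 6 * g3 z))) = 12 * g1 z * disc z.
  by rewrite /disc; field.
by apply: cdiff_near ltr01 _ => h _; rewrite /disc; ring.
Qed.

End Ramanujan.

Lemma big_nat2 (V : nmodType) (F : nat -> V) : \sum_(0 <= i < 2) F i = F 0%N + F 1%N.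
Proof. by rewrite !big_nat_recr //= big_nil add0r. Qed.

(** * The cusp and the discriminant *)

Section StrictDiff.
Variable R : realType.
Local Notation C := R[i].
Implicit Types (F G : C -> C -> C) (a b : C).

(* Strict differentiability at the origin, tested on all normally convergent power
   series and not only on numbers, so that it yields contractions on that algebra. *)
Definition sdiff F a b := exists K rho : R, [/\ 0 <= K, 0 < rho <= 1 &
  forall n (r : R) (f g f' g' : 'rV[R]_n -> C) M d, 0 < r -> M <= rho ->
  nb r f M -> nb r g M -> nb r f' M -> nb r g' M ->
  nb r (fun h => f h - f' h) d -> nb r (fun h => g h - g' h) d ->
  nb r (fun h => F (f h) (g h) - F (f' h) (g' h) - a * (f h - f' h) - b * (g h - g' h))
    (K * (d * M))].

Lemma sdiff_ext F G a b : (forall x y, F x y = G x y) -> sdiff F a b -> sdiff G a b.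
Proof.
move=> FG [K [rho [K0 r0 h]]]; exists K, rho; split=> // n r f g f' g' M d p0 Mr h1 h2 h3 h4 h5 h6.
by apply: nb_ext (h n r f g f' g' M d p0 Mr h1 h2 h3 h4 h5 h6) => // x _; rewrite !FG.
Qed.

Lemma sdiff_const c : sdiff (fun _ _ => c) 0 0.
Proof.
exists 0, 1; split=> //; first by rewrite ltr01 lexx.
move=> n r f g f' g' M d p0 Mr h1 h2 h3 h4 h5 h6; rewrite mul0r.
have := nb_cst n p0 (0 : C); rewrite nm0; apply: nb_ext => // x _.
by rewrite !mul0r !subr0 subrr.
Qed.

Lemma sdiff_snd : sdiff (fun _ y => y) 0 1.
Proof.
exists 0, 1; split=> //; first by rewrite ltr01 lexx.
move=> n r f g f' g' M d p0 Mr h1 h2 h3 h4 h5 h6; rewrite mul0r.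
have := nb_cst n p0 (0 : C); rewrite nm0; apply: nb_ext => // x _.
by rewrite mul0r mul1r !subr0 subrr.
Qed.

Lemma sdiff_add F G a b a' b' : sdiff F a b -> sdiff G a' b' ->
  sdiff (fun x y => F x y + G x y) (a + a') (b + b').
Proof.
move=> [K [rho [K0 r0 h]]] [K' [rho' [K0' r0' h']]].
exists (K + K'), (Num.min rho rho'); split; first exact: addr_ge0.
  by case/andP: r0 => r0 r1; case/andP: r0' => r0' r1'; rewrite lt_min ge_min r0 r0' r1.
move=> n r f g f' g' M d p0; rewrite le_min => /andP[Mr Mr'] h1 h2 h3 h4 h5 h6.
have := nb_add (h n r f g f' g' M d p0 Mr h1 h2 h3 h4 h5 h6)
  (h' n r f g f' g' M d p0 Mr' h1 h2 h3 h4 h5 h6).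
by rewrite -mulrDl; apply: nb_ext => // x _; ring.
Qed.

Lemma sdiff_bound F a b : sdiff F a b -> exists L rho : R, [/\ 0 <= L, 0 < rho <= 1 &
  forall n (r : R) (f g : 'rV[R]_n -> C) M, 0 < r -> M <= rho ->
  nb r f M -> nb r g M -> nb r (fun h => F (f h) (g h) - F 0 0) (L * M)].
Proof.
move=> [K [rho [K0 /andP[r0 r1] h]]]; exists (K + nm a + nm b), rho; split.
- by rewrite !addr_ge0 ?nm_ge0.
- by rewrite r0 r1.
move=> n r f g M p0 Mr h1 h2.
have M0 := nb_ge0 h1.
have z0 : nb (n := n) r (fun=> 0) M by apply: nb_le (nb_cst n p0 (0 : C)); rewrite nm0.
have h5 : nb r (fun x => f x - 0) M by apply: nb_ext h1 => // x _; rewrite subr0.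
have h6 : nb r (fun x => g x - 0) M by apply: nb_ext h2 => // x _; rewrite subr0.
have := nb_add (nb_add (h n r f g _ _ M M p0 Mr h1 h2 z0 z0 h5 h6) (nb_scale a h1))
  (nb_scale b h2).
apply: nb_ext => [x _|]; first by ring.
rewrite !mulrDl lerD2r lerD2r ler_wpM2l // ler_piMr //.
exact: le_trans Mr r1.
Qed.

Lemma sdiff_mul F G a b a' b' : sdiff F a b -> sdiff G a' b' ->
  sdiff (fun x y => F x y * G x y) (a * G 0 0 + F 0 0 * a') (b * G 0 0 + F 0 0 * b').
Proof.
move=> hF hG.
have [L [s [L0 /andP[s0 s1] hL]]] := sdiff_bound hF.
have [L' [s' [L0' /andP[s0' s1'] hL']]] := sdiff_bound hG.
case: hF => [K [rho [K0 /andP[r0 r1] h]]]; case: hG => [K' [rho' [K0' /andP[r0' r1'] h']]].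
exists (K * (L' + nm (G 0 0)) + (nm a + nm b) * L' + ((L + nm (F 0 0)) * K' + L * (nm a' + nm b'))).
exists (Num.min (Num.min s s') (Num.min rho rho')); split.
- by rewrite !addr_ge0 // !mulr_ge0 ?addr_ge0 ?nm_ge0.
- by rewrite !lt_min !ge_min s0 s0' r0 r0' s1.
move=> n r f g f' g' M d p0; rewrite !le_min => /andP[/andP[Ms Ms'] /andP[Mr Mr']].
move=> h1 h2 h3 h4 h5 h6.
have M0 := nb_ge0 h1; have d0 := nb_ge0 h5; have M1 : M <= 1 by apply: le_trans r1.
have dF := h n r f g f' g' M d p0 Mr h1 h2 h3 h4 h5 h6.
have dG := h' n r f g f' g' M d p0 Mr' h1 h2 h3 h4 h5 h6.
have G1 := hL' n r f g M p0 Ms' h1 h2.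
have F1 := hL n r f' g' M p0 Ms h3 h4.
have cF := nb_cst n p0 (F 0 0); have cG := nb_cst n p0 (G 0 0).
(* F G - F' G' = (F - F') G + F' (G - G'). [A1] and [A3] carry the errors of the two linearizations,
   [A2] and [A4] the deviation of the cofactors from their values at the origin. *)
have A1 := nb_mul p0 dF (nb_add G1 cG).
have A2 := nb_mul p0 (nb_add (nb_scale a h5) (nb_scale b h6)) G1.
have A3 := nb_mul p0 (nb_add F1 cF) dG.
have A4 := nb_mul p0 F1 (nb_add (nb_scale a' h5) (nb_scale b' h6)).
have := nb_add (nb_add A1 A2) (nb_add A3 A4).
apply: nb_ext => [x _|]; first by ring.
rewrite -!mulrDl.
have dM : 0 <= d * M by rewrite mulr_ge0.
have LM : L * M <= L by rewrite ler_piMr.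
have LM' : L' * M <= L' by rewrite ler_piMr.
rewrite [leRHS]mulrDl; apply: lerD; rewrite [leRHS]mulrDl; apply: lerD.
- rewrite mulrAC ler_wpM2r // ler_wpM2l // lerD2r //.
- by rewrite le_eqVlt; apply/orP; left; apply/eqP; ring.
- rewrite mulrA ler_wpM2r // ler_wpM2r // lerD2r //.
- by rewrite le_eqVlt; apply/orP; left; apply/eqP; ring.
Qed.

Lemma sdiff_scale F a b c : sdiff F a b -> sdiff (fun x y => c * F x y) (c * a) (c * b).
Proof. by move=> /(sdiff_mul (sdiff_const c)); rewrite !mul0r !add0r. Qed.

Lemma sdiff_qs (c : nat -> C) z : qsumm c -> 0 < complex.Im z ->
  sdiff (fun x _ => qs c (z + x)) (two_pi_i R * qs (fun k => k%:R * c k) z) 0.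
Proof.
move=> hc hz; have [K K0 h] := nb_qs hc hz.
exists K, (Num.min (complex.Im z / 2) 1); split=> //.
  by rewrite lt_min ge_min lexx orbT divr_gt0 //= ltr01.
move=> n r f g f' g' M d p0; rewrite le_min => /andP[Mz _] h1 h2 h3 h4 h5 h6.
apply: nb_ext (h n r f f' M d p0 Mz h1 h3 h5) => // x _.
by rewrite mul0r subr0.
Qed.

Definition ps (c : nat -> C) (q : C) : C := hsum (fun n => c n * q ^+ n).

Lemma ps_sums_to c q : qsumm c -> nm q < 1 ->
  (exists M, abs_le (fun n => c n * q ^+ n) M) /\ sums_to (fun n => c n * q ^+ n) (ps c q).
Proof.
move=> hc hq; have [|M hM] := hc (nm q); first by rewrite nm_ge0.
have ab : abs_le (fun n => c n * q ^+ n) M.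
  apply: abs_le_le hM => // n.
  have -> : nm (c n * q ^+ n) = nm (c n) * nm q ^+ n by rewrite nmM nmX.
  by rewrite nmM nm_real ger0_norm // exprn_ge0 // nm_ge0.
by split; [exists M|exact: hsumP ab].
Qed.

Lemma ps0 c : ps c 0 = c 0%N.
Proof.
apply: hsum_eq; have := @sums_to_fin R _ (fun n => c n * 0 ^+ n) [:: 0%N] isT.
rewrite big_seq1 expr0 mulr1; apply => -[|n]; rewrite ?inE //.
by rewrite expr0n mulr0.
Qed.

Lemma sdiff_ps c : qsumm c -> sdiff (fun x _ => ps c x) (c 1%N) 0.
Proof.
move=> hc; have [|K hK] := qsumm_nat hc (rho := 1 / 2).
  by rewrite divr_ge0 //= ltr_pdivrMr // mul1r ltr1n.
(* The 4 turns (1/2)^(k+2) into the bound (1/2)^k for M^k. *)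
exists (4 * K), (1 / 2); split; first by rewrite mulr_ge0 // (abs_le_ge0 hK).
  by rewrite divr_gt0 //= ler_pdivrMr // mul1r ler1n.
move=> n r f g f' g' M d p0 Mz h1 _ h3 _ h5 _.
have M0 := nb_ge0 h1; have d0 := nb_ge0 h5.
apply: (@nb_family _ _ _ p0 _ (fun k h => c (2 + k)%N * (f h ^+ k.+2 - f' h ^+ k.+2))
  (fun k => d * M * (4 * nm ((2 + k)%:R * c (2 + k)%N * ((1 / 2) ^+ (2 + k))%:C%C)))).
- move=> k; apply: nb_ext (nb_scale (c (2 + k)%N) (nb_powdiff p0 k.+1 h1 h3 h5)) => //.
  rewrite !nmM nm_nat nm_real ger0_norm ?exprn_ge0 ?divr_ge0 //.
  rewrite add2n !exprS.
  have : M ^+ k <= (1 / 2) ^+ k by apply: lerXn2r; rewrite // nnegrE ?divr_ge0.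
  have X : 0 <= nm (c k.+2) * d * k.+2%:R * M by rewrite !mulr_ge0 ?nm_ge0.
  by move=> /(ler_wpM2l X); congr (_ <= _); field.
- move=> s us; rewrite -mulr_sumr -mulr_sumr mulrC ler_wpM2r ?mulr_ge0 // ler_wpM2l //.
  have := abs_le_inj (f := addn 2) _ hK us; apply; exact: addnI.
- move=> h hb.
  have hle w : nm w <= M -> nm w < 1.
    by move=> hw; apply: le_lt_trans hw _; apply: le_lt_trans Mz _; rewrite ltr_pdivrMr // mul1r ltr1n.
  have [[M1 a1] H1] := ps_sums_to hc (hle _ (nb_val p0 h1 hb)).
  have [[M2 a2] H2] := ps_sums_to hc (hle _ (nb_val p0 h3 hb)).
  have := sums_to_shift 2 (abs_le_sub a1 a2) (sums_to_sub H1 H2).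
  have -> : \sum_(0 <= i < 2) (c i * f h ^+ i - c i * f' h ^+ i) = c 1%N * (f h - f' h).
    by rewrite big_nat2 !expr0 subrr add0r !expr1 mulrBr.
  rewrite mul0r subr0.
  by apply: sums_to_ext => k; rewrite mulrBr.
Qed.

Lemma sdiff_point F a b : sdiff F a b -> exists K rho : R, [/\ 0 <= K, 0 < rho <= 1 &
  forall x y x' y' M d, M <= rho -> nm x <= M -> nm y <= M -> nm x' <= M -> nm y' <= M ->
  nm (x - x') <= d -> nm (y - y') <= d ->
  nm (F x y - F x' y' - a * (x - x') - b * (y - y')) <= K * (d * M)].
Proof.
move=> [K [rho [K0 r0 h]]]; exists K, rho; split=> //.
move=> x y x' y' M d Mr hx hy hx' hy' hd he.
have c (w : C) N : nm w <= N -> nb (n := 0) 1 (fun=> w) N.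
  by move=> hw; apply: nb_le hw (nb_cst 0 ltr01 w).
have := h 0%N 1 _ _ _ _ M d ltr01 Mr (c x M hx) (c y M hy) (c x' M hx') (c y' M hy')
  (c _ d hd) (c _ d he).
by move=> H; apply: (nb_val ltr01 H (h := 0)) => -[].
Qed.

End StrictDiff.

(** * Behaviour at the cusp and nonvanishing of the discriminant *)

Section Cusp.
Variable R : realType.
Local Notation C := R[i].
Implicit Types z : C.

Lemma cdiff_cexp z : cdiff (@cexp R) z (cexp z).
Proof.
apply: (@cdiff_quad _ _ _ _ (nm (cexp z) * expR 1) 1) => // h h1.
have -> : cexp (z + h) - cexp z - cexp z * h = cexp z * (cexp h - 1 - h).
  by rewrite cexpD; ring.
rewrite nmM -mulrA ler_wpM2l ?nm_ge0 //.
have := cexp_taylor h 2; rewrite big_nat2 /ecoef expr0 expr1 fact0.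
rewrite !divr1 opprD addrA mulrC => H; apply: le_trans H _.
by rewrite ler_wpM2r ?exprn_ge0 ?nm_ge0 // ler_expR ltW.
Qed.

Lemma const_line (G : C -> C) : (forall s : R, cdiff G s%:C%C 0) ->
  forall s t : R, G s%:C%C = G t%:C%C.
Proof.
move=> h s t.
suff P (p : C -> R) : (forall x y, p (x - y) = p x - p y) -> (forall x, `|p x| <= nm x) ->
    p (G s%:C%C) = p (G t%:C%C).
  have E1 := P (@complex.Re R) (raddfB _) (@nm_Re R).
  have E2 := P (@complex.Im R) (raddfB _) (@nm_Im R).
  by apply/eqP; rewrite eq_complex E1 E2 !eqxx.
move=> pB pn; apply: (is_derive_0_is_cst (f := fun u : R => p (G u%:C%C))) => x.
have H : (fun u : R => u^-1 *: (((fun v : R => p (G v%:C%C)) \o shift x) (u *: 1) -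
    p (G x%:C%C))) @ (0 : R)^' --> (0 : R).
  apply/cvgrPdist_le => e e0; have [r r0 hr] := h x e e0.
  near=> u.
  have u0 : u != 0 by near: u; exact: nbhs_dnbhs_neq.
  have ur : `|u| < r.
    near: u; apply: dnbhs0_lt => //.
  rewrite sub0r normrN /= normrM normfV ler_pdivrMl ?normr_gt0 // mulrC.
  rewrite -pB /GRing.scale /= mulr1.
  apply: le_trans (pn _) _.
  have := hr u%:C%C; rewrite nm_real => /(_ ur); rewrite mul0r subr0.
  by have -> : (u + x)%:C%C = x%:C%C + u%:C%C by rewrite rmorphD addrC.
split; first by apply/cvg_ex; exists 0.
exact: cvg_lim H.
Unshelve. all: by end_near.
Qed.

Definition iC (s : R) : C := Complex 0 s.

(** [const_line] needs differentiability at every real point; the ray is therefore run through as z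
    + i w^2, which stays in the half plane for all real w. *)
Lemma const_vertical (F : C -> C) z : (forall w, 0 < complex.Im w -> cdiff F w 0) ->
  0 < complex.Im z -> forall s, 0 <= s -> F (z + iC s) = F z.
Proof.
move=> h hz s s0.
pose G w := F (z + iC 1 * (w * w)).
have hG x : cdiff G x%:C%C 0.
  have hin : cdiff (fun w => z + iC 1 * (w * w)) x%:C%C
      (0 + iC 1 * (1 * x%:C%C + x%:C%C * 1)).
    exact: cdiff_add (cdiff_cst _ _) (cdiff_scale _ (cdiff_mul (cdiff_id _) (cdiff_id _))).
  have := cdiff_comp hin (h _ _); rewrite mul0r; apply.
  have -> : iC 1 * (x%:C%C * x%:C%C) = iC (x * x) by rewrite /iC; simpc.
  by rewrite raddfD /= ltr_wpDr // -expr2 sqr_ge0.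
have := const_line hG (Num.sqrt s) 0; rewrite /G rmorph0 !mulr0 addr0 -rmorphM.
rewrite -expr2 sqr_sqrtr // => <-; congr (F (_ + _)).
by rewrite /iC; simpc.
Qed.

Definition e4 (q : C) : C := 1 + 240 * ps (sg R 3) q.
Definition e6 (q : C) : C := 1 - 504 * ps (sg R 5) q.

Let u : C := two_pi_i R / 12.

Lemma u_neq0 : u != 0.
Proof. by rewrite mulf_neq0 ?two_pi_neq0 // invr_eq0 pnatr_eq0. Qed.

Lemma g2_e4 z : 0 < complex.Im z -> g2 z = 12 * u ^+ 2 * e4 (nome z).
Proof. by move=> hz; rewrite /g2 sigma_seriesE. Qed.

Lemma g3_e6 z : 0 < complex.Im z -> g3 z = 8 * u ^+ 3 * e6 (nome z).
Proof. by move=> hz; rewrite /g3 sigma_seriesE. Qed.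

Lemma sg1 k : sg R k 1 = 1.
Proof. by rewrite /sg /sigma (_ : divisors 1 = [:: 1%N]) // big_seq1 exp1n. Qed.

(** This is -1728 Delta as a function of q, with a simple zero at q = 0. *)
Definition ee (q : C) : C := e6 q ^+ 2 - e4 q ^+ 3.

Lemma disc_ee z : 0 < complex.Im z -> disc z = 1728 * u ^+ 6 * ee (nome z).
Proof. by move=> hz; rewrite /disc /ee g2_e4 // g3_e6 //; ring. Qed.

Lemma e4_0 : e4 0 = 1. Proof. by rewrite /e4 ps0 mulr0 addr0. Qed.
Lemma e6_0 : e6 0 = 1. Proof. by rewrite /e6 ps0 mulr0 subr0. Qed.
Lemma ee_0 : ee 0 = 0. Proof. by rewrite /ee e4_0 e6_0 !expr1n subrr. Qed.

Lemma sdiff_e4 : sdiff (fun x _ => e4 x) 240 0.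
Proof.
have := sdiff_add (sdiff_const 1) (sdiff_scale 240 (sdiff_ps (@qsumm_sg R 3))).
by rewrite sg1 !mulr1 !mulr0 !add0r.
Qed.

Lemma sdiff_e6 : sdiff (fun x _ => e6 x) (-504) 0.
Proof.
have := sdiff_add (sdiff_const 1) (sdiff_scale (-504) (sdiff_ps (@qsumm_sg R 5))).
rewrite sg1 !mulr1 !mulr0 !add0r; apply: sdiff_ext => x _.
by rewrite /e6 mulNr.
Qed.

Lemma sdiff_e43 : sdiff (fun x _ => e4 x ^+ 3) 720 0.
Proof.
have := sdiff_mul sdiff_e4 (sdiff_mul sdiff_e4 sdiff_e4).
rewrite e4_0.
have -> : 240 * (1 * 1) + 1 * (240 * 1 + 1 * 240) = 720 :> C by ring.
have -> : 0 * (1 * 1) + 1 * (0 * 1 + 1 * 0) = 0 :> C by ring.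
by apply: sdiff_ext => x _.
Qed.

Lemma sdiff_ee : sdiff (fun x _ => ee x) (-1728) 0.
Proof.
have := sdiff_add (sdiff_mul sdiff_e6 sdiff_e6) (sdiff_scale (-1) sdiff_e43).
rewrite e6_0.
have -> : -504 * 1 + 1 * -504 + -1 * 720 = -1728 :> C by ring.
have -> : 0 * 1 + 1 * 0 + -1 * 0 = 0 :> C by ring.
by apply: sdiff_ext => x _; rewrite /ee -expr2 mulN1r.
Qed.

(** The quotient E/F has the nonzero derivative [al] at 0. It appears cross-multiplied, so that the
    estimates on E and F suffice. *)
Lemma sdiff_ratio_inj (E F : C -> C) (al be : C) :
  sdiff (fun x _ => E x) al 0 -> sdiff (fun x _ => F x) be 0 ->
  E 0 = 0 -> F 0 = 1 -> al != 0 ->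
  exists2 rho : R, 0 < rho < 1 & forall x y, nm x <= rho -> nm y <= rho ->
    E x * F y = E y * F x -> x = y.
Proof.
move=> hE hF E0 F0 al0.
have [K [r [K0 /andP[r0 r1] h]]] := sdiff_point hE.
have [K' [r' [K0' /andP[r0' r1'] h']]] := sdiff_point hF.
have a0 : 0 < nm al by rewrite nm_gt0.
(* The three error terms in [key] add up to |al| d rho (T - 2); rho <= 1/T makes this smaller than
   |al| d unless d = 0. *)
pose A := K + nm al; pose B := K' + nm be; pose T := (K + 2 * (A * B)) / nm al + 2.
have A0 : 0 <= A by rewrite addr_ge0 ?nm_ge0.
have B0 : 0 <= B by rewrite addr_ge0 ?nm_ge0.
have X0 : 0 <= K + 2 * (A * B) by rewrite addr_ge0 // mulr_ge0 // mulr_ge0.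
have T1 : 1 < T by rewrite /T ltr_wpDl ?divr_ge0 ?nm_ge0 // ltr1n.
have T0 : 0 < T by apply: lt_trans T1.
pose rho := Num.min (Num.min r r') T^-1.
have rho0 : 0 < rho by rewrite !lt_min r0 r0' invr_gt0.
have [rhor rhor' rhoT] : [/\ rho <= r, rho <= r' & rho <= T^-1].
  by split; rewrite /rho !ge_min lexx ?orbT.
have rho1 : rho < 1 by apply: le_lt_trans rhoT _; rewrite invf_lt1.
exists rho; first by rewrite rho0.
move=> x y hx hy eq.
pose d := nm (x - y); have d0 : 0 <= d by exact: nm_ge0.
have n0 : nm (0 : C) <= rho by rewrite nm0 ltW.
have P (G : C -> C) c L s : 0 <= L -> rho <= s ->
    (forall x y x' y' M d, M <= s -> nm x <= M -> nm y <= M -> nm x' <= M ->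
      nm y' <= M -> nm (x - x') <= d -> nm (y - y') <= d ->
      nm (G x - G x' - c * (x - x') - 0 * (y - y')) <= L * (d * M)) ->
    [/\ nm (G x - G y - c * (x - y)) <= L * (d * rho),
        nm (G x - G y) <= (L + nm c) * d & nm (G y - G 0) <= (L + nm c) * rho].
  move=> L0 rs H.
  have E1 : nm (G x - G y - c * (x - y)) <= L * (d * rho).
    by have := H x 0 y 0 rho d rs hx n0 hy n0 (lexx _); rewrite mul0r !subr0 nm0; apply.
  have E2 : nm (G y - G 0 - c * (y - 0)) <= L * (rho * rho).
    have := H y 0 0 0 rho rho rs hy n0 n0 n0; rewrite mul0r !subr0 nm0; apply => //.
    exact: ltW.
  split=> //.
    apply: le_trans (nm_le_add _ (c * (x - y))) _; rewrite nmM mulrDl lerD2r.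
    by apply: le_trans E1 _; rewrite ler_wpM2l // ler_piMr // ltW.
  apply: le_trans (nm_le_add _ (c * (y - 0))) _; rewrite nmM mulrDl lerD //.
    by apply: le_trans E2 _; rewrite ler_wpM2l // ler_piMr // ltW.
  by rewrite subr0 ler_wpM2l // nm_ge0.
have [e1 e2 e3] := P E al K r K0 rhor h.
have [f1 f2 f3] := P F be K' r' K0' rhor' h'.
rewrite -/A E0 subr0 in e2 e3; rewrite -/B F0 in f2 f3.
have key : al * (x - y) = - (E x - E y - al * (x - y)) - (E x - E y) * (F y - 1) +
    E y * (F x - F y).
  have -> : E y * (F x - F y) = E x * F y - E y * F y by rewrite mulrBr -eq.
  by ring.
have : nm al * d <= nm al * (d * (rho * (T - 2))).
  have -> : nm al * (d * (rho * (T - 2))) =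
     K * (d * rho) + A * d * (B * rho) + A * rho * (B * d).
    by rewrite /T; field; rewrite gt_eqF.
  rewrite -nmM key; apply: le_trans (nmD _ _) _; apply: lerD.
    apply: le_trans (nmB _ _) _; rewrite nmN; apply: lerD => //.
    by rewrite nmM; apply: ler_pM; rewrite ?nm_ge0.
  by rewrite nmM; apply: ler_pM; rewrite ?nm_ge0.
rewrite ler_pM2l // => dd.
apply/eqP; rewrite -subr_eq0 -nm_eq0 -/d; apply: contraT => dn0.
have dp : 0 < d by rewrite lt_def dn0.
move: dd; rewrite ler_pMr // => le1.
have : rho * (T - 2) < 1.
  apply: (@le_lt_trans _ _ (T^-1 * (T - 2))).
    by rewrite ler_wpM2r // /T addrK divr_ge0 // ltW.
  by rewrite mulrC ltr_pdivrMr // mul1r; lra.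
by rewrite ltNge le1.
Qed.

(* 1728 Delta / E4^3 = 1728 / j is a local coordinate at the cusp. *)
Lemma cusp_inj : exists2 rho : R, 0 < rho < 1 & forall x y, nm x <= rho -> nm y <= rho ->
  ee x * e4 y ^+ 3 = ee y * e4 x ^+ 3 -> x = y.
Proof.
apply: sdiff_ratio_inj sdiff_ee sdiff_e43 ee_0 _ _; first by rewrite e4_0 expr1n.
by rewrite oppr_eq0 pnatr_eq0.
Qed.

Lemma qsumm_sg_div : qsumm (fun n => sg R 1 n / n%:R).
Proof.
apply: (@qsumm_le _ _ (sg R 1) 1); last exact: qsumm_sg.
move=> -[|n]; first by rewrite mul0r mul1r.
rewrite mul1r nmM nmV ler_piMr ?nm_ge0 // nm_nat invf_le1 ?ltr0n //.
by rewrite ler1n.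
Qed.

Lemma nome_iC z s : nm (nome (z + iC s)) = nm (nome z) * expR (- (2 * pi * s)).
Proof. by rewrite !nm_nome raddfD /= -expRD; congr expR; ring. Qed.

Lemma expR_small (e : R) : 0 < e -> exists2 s : R, 0 <= s &
  forall t, s <= t -> expR (- (2 * pi * t)) <= e.
Proof.
move=> e0; exists (e^-1); first by rewrite invr_ge0 ltW.
move=> t et; rewrite expRN invf_ple ?posrE ?expR_gt0 //.
have t0 : 0 <= t by apply: le_trans et; rewrite invr_ge0 ltW.
apply: (le_trans et); apply: le_trans (expR_ge1Dx _).
have := pi_ge2 R; nra.
Qed.

(* Delta has the logarithmic derivative 12 g1, hence so does the product
   q prod (1 - q^n)^24, written here as an exponential. *)
Lemma disc_neq0 z : 0 < complex.Im z -> disc z != 0.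
Proof.
move=> hz; apply/eqP => d0.
pose c n := sg R 1 n / n%:R.
(* The sum of 24 sigma_1(n) q^n / n is minus the logarithm of prod (1 - q^n)^24, hence its positive
   sign; [F] is [disc] divided by the product. *)
pose F w := disc w * cexp (24 * qs c w + -1 * (two_pi_i R * w)).
have hF w : 0 < complex.Im w -> cdiff F w 0.
  move=> hw.
  have h1 : cdiff (fun w => 24 * qs c w + -1 * (two_pi_i R * w)) w
     (24 * (two_pi_i R * qs (sg R 1) w) + -1 * (two_pi_i R * 1)).
    apply: cdiff_add; apply: cdiff_scale; last exact: cdiff_scale (cdiff_id _).
    have := cdiff_qs qsumm_sg_div hw; rewrite (@qs_ext _ _ (sg R 1)) // => -[|n].
      by rewrite mul0r.
    by rewrite /= mulrC divfK // pnatr_eq0.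
  have := cdiff_mul (cdiff_disc hw) (cdiff_comp h1 (cdiff_cexp _)).
  set X := cexp _; set D := _ * X + _.
  suff -> : D = 0 by [].
  by rewrite /D /g1 sigma_seriesE //; field.
have F0 : F z = 0 by rewrite /F d0 mul0r.
have hv := const_vertical hF hz; rewrite F0 in hv.
have hd s : 0 <= s -> ee (nome (z + iC s)) = 0.
  move=> s0; have /eqP := hv s s0; rewrite mulf_eq0 (negbTE (cexp_neq0 _)) orbF.
  rewrite disc_ee; last by rewrite raddfD /= ltr_wpDr.
  have nz : 1728 * u ^+ 6 != 0 by apply: mulf_neq0; [rewrite pnatr_eq0|apply: expf_neq0; exact: u_neq0].
  by rewrite mulf_eq0 (negbTE nz) => /eqP.
(* High on the ray q is small and nonzero, yet [ee] vanishes there as it does at 0, against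
   injectivity near the cusp. *)
have [rho /andP[rho0 rho1] inj] := cusp_inj.
have [s s0 hs] := expR_small rho0.
have hq : nm (nome (z + iC s)) <= rho.
  rewrite nome_iC; apply: le_trans (hs s (lexx s)); rewrite ler_piMl ?expR_ge0 //.
  by rewrite ltW // nome_lt1.
have zz (a b c' d : C) : a = 0 -> c' = 0 -> a * b = c' * d by move=> -> ->; rewrite !mul0r.
have h0 : nm (0 : C) <= rho by rewrite nm0 ltW.
have := inj _ _ hq h0 (zz _ _ _ _ (hd s s0) ee_0).
by apply/eqP; exact: nome_neq0.
Qed.

End Cusp.

(** * Lipschitz' formula and the functional equation of g2 *)

Section LatticeSums.
Variable R : realType.
Local Notation C := R[i].
Implicit Types w z : C.

Lemma sum_inv_sq N : \sum_(0 <= n < N) (1 + n%:R ^+ 2)^-1 <= 3 - 3 / (N%:R + 1) :> R.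
Proof.
elim: N => [|N IH]; first by rewrite big_nil add0r divr1 subrr.
rewrite big_nat_recr //=; apply: le_trans (lerD IH (lexx _)) _.
have N0 : 0 <= N%:R :> R by [].
have S1 n : n.+1%:R = n%:R + 1 :> R by rewrite natr1.
rewrite (S1 N); have h : (1 + N%:R ^+ 2)^-1 <= 3 / ((N%:R + 1) * (N%:R + 1 + 1)) :> R.
  rewrite ler_pdivlMr ?mulr_gt0 ?ltr_wpDl // mulrC ler_pdivrMr ?ltr_wpDr ?sqr_ge0 //.
  case: N {IH} N0 => [|N] _; first by rewrite mulr0n expr0n /=; lra.
  by rewrite (S1 N); have : 0 <= N%:R :> R by []; move: (N%:R : R) => x; nra.
have -> : 3 - 3 / (N%:R + 1 + 1) = 3 - 3 / (N%:R + 1) + 3 / ((N%:R + 1) * (N%:R + 1 + 1)) :> R.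
  by field; rewrite !natr1 !pnatr_eq0.
by rewrite lerD2l.
Qed.

Definition isq (n : int) : C := ((1 + n%:~R ^+ 2)^-1 : R)%:C%C.

Lemma nm_isq n : nm (isq n) = (1 + n%:~R ^+ 2)^-1.
Proof. by rewrite nm_real ger0_norm // invr_ge0 addr_ge0 // sqr_ge0. Qed.

Lemma abs_le_isq : abs_le isq 6.
Proof.
pose a (p : bool * nat) : C := isq (Posz p.2).
pose f (n : int) := match n with Posz n => (true, n) | Negz n => (false, n.+1) end.
have fi : injective f by move=> [n|n] [m|m] //= [->].
apply: (@abs_le_ext _ _ (a \o f)).
  by move=> [n|n] //=; rewrite /a /isq /= NegzE mulrNz sqrrN.
apply: abs_le_inj => //; apply: (@abs_le_sigma _ _ _ _ (fun=> 3)).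
  move=> b; apply: abs_le_nat => N; under eq_bigr do rewrite nm_isq.
  apply: le_trans (sum_inv_sq N) _; rewrite lerBlDr lerDl divr_ge0 // addr_ge0 //.
move=> s us; rewrite big_const_seq count_predT iter_addr_0.
have : (size s <= size [:: true; false])%N.
  by apply: uniq_leq_size => // -[].
by case: (size s) => [|[|[|]]] //= _; rewrite ?mulr0n ?mulr1n ?mulr2n; lra.
Qed.

Definition L4 w (n : int) : C := (w + n%:~R) ^- 4.

(** A condition weaker than Im w > 0: it admits real w, and w = 1/2 is what gives zeta(4). *)
Definition away w (d : R) := 0 < d /\ forall n : int, d <= nm (w + n%:~R).

Lemma nm_L4 w n : nm (L4 w n) = (nm (w + n%:~R) ^+ 4)^-1.
Proof. by rewrite nmV nmX. Qed.

Lemma nm_int (n : int) : nm (n%:~R : C) = `|n%:~R|.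
Proof. by rewrite -(rmorph_int (real_complex R)) nm_real. Qed.

Lemma abs_le_L4 w d : away w d -> exists M, abs_le (L4 w) M.
Proof.
(* With t = |w + n| >= d one has n^2 <= 2 t^2 + 2 |w|^2; multiplying by powers of t^2/d^2 >= 1 gives
   1 + n^2 <= K t^4. *)
move=> [d0 h]; pose K := (2 + (1 + 2 * nm w ^+ 2) / d ^+ 2) / d ^+ 2.
exists (nm K%:C%C * 6); apply: abs_le_le (abs_le_scale _ abs_le_isq) => // n.
have K0 : 0 <= K by rewrite /K divr_ge0 ?sqr_ge0 // addr_ge0 // divr_ge0 ?sqr_ge0 // addr_ge0 // mulr_ge0 // sqr_ge0.
rewrite nm_L4 nmM nm_isq nm_real ger0_norm //.
set t := nm (w + n%:~R); have dt : d <= t by exact: h.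
have t0 : 0 < t by apply: lt_le_trans dt.
have n1 : `|n%:~R : R| <= t + nm w.
  rewrite -nm_int; apply: le_trans (nm_le_add _ (- w)) _.
  by rewrite opprK nmN /t [n%:~R + w]addrC.
have n2 : (n%:~R : R) ^+ 2 <= 2 * t ^+ 2 + 2 * nm w ^+ 2.
  rewrite -real_normK ?num_real //.
  have : `|n%:~R : R| ^+ 2 <= (t + nm w) ^+ 2 by rewrite lerXn2r ?nnegrE ?addr_ge0 ?nm_ge0 // ltW.
  by move=> /le_trans; apply; have := sqr_ge0 (t - nm w); nra.
have d2 : d ^+ 2 <= t ^+ 2 by rewrite lerXn2r ?nnegrE // ltW.
have dd : 0 < d ^+ 2 by rewrite exprn_gt0.
have tt : 0 < t ^+ 2 by rewrite exprn_gt0.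
have s0 : 0 < 1 + (n%:~R : R) ^+ 2 by rewrite ltr_wpDr ?sqr_ge0.
rewrite -[X in _ <= X]/(K / _) ler_pdivlMr // mulrC ler_pdivrMr ?exprn_gt0 //.
have -> : K * t ^+ 4 = (2 * t ^+ 2 + (1 + 2 * nm w ^+ 2) * (t ^+ 2 / d ^+ 2)) * (t ^+ 2 / d ^+ 2).
  by rewrite /K; field; rewrite gt_eqF.
have r1 : 1 <= t ^+ 2 / d ^+ 2 by rewrite ler_pdivlMr // mul1r.
have W0 : 0 <= nm w ^+ 2 by exact: sqr_ge0.
move: (t ^+ 2 / d ^+ 2) r1 => r r1.
apply: (@le_trans _ _ (2 * t ^+ 2 + (1 + 2 * nm w ^+ 2) * r)); last first.
  have r0 : 0 <= r by apply: le_trans r1.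
  rewrite ler_peMr //; apply: addr_ge0; first by rewrite mulr_ge0 // ltW.
  by rewrite mulr_ge0 // addr_ge0 // mulr_ge0.
have : 0 <= (1 + 2 * nm w ^+ 2) * (r - 1) by apply: mulr_ge0; [apply: addr_ge0 => //; exact: mulr_ge0|rewrite subr_ge0].
by nra.
Qed.

Definition S4 w := hsum (L4 w).

Lemma S4_sums_to w d : away w d -> sums_to (L4 w) (S4 w).
Proof. by move=> /abs_le_L4[M /hsumP]. Qed.

Lemma away_shift w d (k : int) : away w d -> away (w + k%:~R) d.
Proof.
by move=> [d0 h]; split=> // n; rewrite -addrA -intrD; exact: h.
Qed.

Lemma away_half w d (b : bool) : away w d -> away ((w + b%:R) / 2) (d / 2).
Proof.
move=> [d0 h]; split=> [|n]; first by rewrite divr_gt0.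
have -> : (w + b%:R) / 2 + n%:~R = (w + (b%:Z + n + n)%:~R) / 2.
  by rewrite !intrD pmulrn; field.
by rewrite nmM nmV nm_nat ler_wpM2r // invr_ge0.
Qed.

Lemma away_Im w : 0 < complex.Im w -> away w (complex.Im w).
Proof.
move=> h; split=> // n; apply: le_trans (nm_Im _).
have -> : complex.Im (w + n%:~R) = complex.Im w.
  by rewrite raddfD /= -(rmorph_int (real_complex R)) /= addr0.
exact: ler_norm.
Qed.

Lemma S4_shift w d (k : int) : away w d -> S4 (w + k%:~R) = S4 w.
Proof.
move=> h; apply: hsum_eq; apply: (@sums_to_bij _ _ _ (fun n => n - k)).
  by exists (fun n => n + k) => n; rewrite ?subrK ?addrK.
by apply: sums_to_ext (S4_sums_to h) => n; rewrite /= /L4 -addrA -intrD subrKC.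
Qed.

Lemma sums_to_even_odd (a : int -> C) l M : abs_le a M -> sums_to a l ->
  sums_to (fun n => a (n + n) + a (n + n + 1)) l.
Proof.
move=> ha hl; pose f (p : int * bool) : int := p.1 + p.1 + p.2%:Z.
have fi : injective f by move=> [n b] [m c]; rewrite /f /=; case: b; case: c => h; congr (_, _) => //; lia.
have f0 i : (forall p, f p != i) -> a i = 0.
  move=> h.
  have := h ((i %/ 2)%Z, (i %% 2)%Z == 1); rewrite /f /=.
  have := divz_eq i 2; have := modz_ge0 i (isT : 2 != 0 :> int); have := ltz_mod i (isT : 2 != 0 :> int).
  by case: eqP => /=; lia.
have haf := abs_le_inj fi ha.
apply: sums_to_sigma (sums_to_inj_ext fi f0 haf hl) _ => n.
have := @sums_to_fin R _ (fun b : bool => (a \o f) (n, b)) [:: false; true] isT.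
rewrite big_cons big_seq1 /= /f /= addr0; apply => -[]//.
Qed.

(** Even and odd integers are separated: (w/2 + n)^-4 = 16 (w + 2 n)^-4, and similarly for w + 1. *)
Lemma S4_double w d : away w d ->
  S4 ((w + false%:R) / 2) + S4 ((w + true%:R) / 2) = 16 * S4 w.
Proof.
move=> h; have [M hM] := abs_le_L4 h.
have h0 := S4_sums_to (away_half false h); have h1 := S4_sums_to (away_half true h).
apply: sums_to_unique (sums_to_add h0 h1) _.
apply: sums_to_ext (sums_to_scale 16 (sums_to_even_odd hM (S4_sums_to h))) => n.
have e x : L4 w x = (w + x%:~R) ^- 4 by [].
rewrite mulrDr /L4 !intrD; congr (_ + _).
  have -> : (w + false%:R) / 2 + n%:~R = (w + (n%:~R + n%:~R)) / 2 by rewrite /=; field.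
  by rewrite expr_div_n invf_div -natrX.
rewrite -[1%:~R]/1.
have -> : (w + true%:R) / 2 + n%:~R = (w + (n%:~R + n%:~R + 1)) / 2 by rewrite /=; field.
by rewrite expr_div_n invf_div -natrX.
Qed.

End LatticeSums.

(** * Lipschitz' formula in weight 4 *)

Section Lipschitz.
Variable R : realType.
Local Notation C := R[i].
Implicit Types w z q : C.

(** The closed form of the sum of n^3 q^n; as a rational function it also makes sense for |q| = 1,
    that is, for real w. *)
Definition rat4 q : C := q * (1 + 4 * q + q ^+ 2) / (1 - q) ^+ 4.

Lemma ps_diff (c : nat -> C) q : qsumm c -> nm q < 1 ->
  (1 - q) * ps c q = c 0%N + q * ps (fun n => c n.+1 - c n) q.
Proof.
move=> hc hq; have [[M hM] h] := ps_sums_to hc hq.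
have h1 := sums_to_shift 1 hM h.
rewrite big_nat1 expr0 mulr1 in h1.
have h2 := sums_to_sub h1 (sums_to_scale q h).
have E : q * ps (fun n => c n.+1 - c n) q = ps c q - c 0%N - q * ps c q.
  have q0 : q = 0 \/ q != 0 by case: (eqVneq q 0); [left|right].
  case: q0 => [->|q0]; first by rewrite !mul0r ps0 subrr subr0.
  have : sums_to (fun n => (c n.+1 - c n) * q ^+ n) (q^-1 * (ps c q - c 0%N - q * ps c q)).
    apply: sums_to_ext (sums_to_scale q^-1 h2) => n; rewrite add1n exprS.
    by field.
  by move=> /hsum_eq; rewrite -/(ps _ q) => ->; rewrite mulrA divff // mul1r.
by rewrite E; ring.
Qed.

Lemma ps_diff_eq (c d : nat -> C) q : qsumm c -> nm q < 1 ->
  (forall n, c n.+1 - c n = d n) -> (1 - q) * ps c q = c 0%N + q * ps d q.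
Proof. by move=> hc hq cd; rewrite ps_diff //; have /funext -> := cd. Qed.

(** Multiplication by 1 - q takes differences of the coefficients: n^3 gives 3 n^2 + 3 n + 1, then 6
    n + 6, then 6, then 0. *)
Lemma ps_cubes q : nm q < 1 -> ps (fun n => n%:R ^+ 3) q = rat4 q.
Proof.
move=> hq.
have q1 : 1 - q != 0.
  rewrite subr_eq0; apply: contraTneq hq => <-; by rewrite nm1 ltxx.
have p k := @qsumm_exp R k.
have S1 n : n.+1%:R = n%:R + 1 :> C by rewrite natr1.
pose c2 n : C := 3 * n%:R ^+ 2 + 3 * n%:R ^+ 1 + 1; pose c1 n : C := 6 * n%:R ^+ 1 + 6.
have p2 : qsumm c2.
  exact: qsumm_add (qsumm_add (qsumm_scale 3 (p 2%N)) (qsumm_scale 3 (p 1%N))) (qsumm_cst 1).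
have p1 : qsumm c1 by exact: qsumm_add (qsumm_scale 6 (p 1%N)) (qsumm_cst 6).
have e3 : (1 - q) * ps (fun n => n%:R ^+ 3) q = 0%:R ^+ 3 + q * ps c2 q.
  by apply: (ps_diff_eq (p 3%N) hq) => n; rewrite /c2 (S1 n); ring.
have e2 : (1 - q) * ps c2 q = c2 0%N + q * ps c1 q.
  by apply: (ps_diff_eq p2 hq) => n; rewrite /c2 /c1 (S1 n); ring.
have e1 : (1 - q) * ps c1 q = c1 0%N + q * ps (fun=> 6) q.
  by apply: (ps_diff_eq p1 hq) => n; rewrite /c1 (S1 n); ring.
have e0 : (1 - q) * ps (fun=> 6) q = 6 + q * ps (fun=> 0) q.
  by apply: (ps_diff_eq (qsumm_cst 6) hq) => n; rewrite subrr.
have z0 : ps (fun=> 0) q = 0 :> C by apply: hsum_eq; apply: HS0 => n; rewrite mul0r.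
rewrite z0 mulr0 addr0 in e0.
have f0 : ps (fun=> 6) q = 6 / (1 - q) by apply: (mulfI q1); rewrite e0; field.
have f1 : ps c1 q = 6 / (1 - q) ^+ 2.
  by apply: (mulfI q1); rewrite e1 f0 /c1; field.
have f2 : ps c2 q = (1 + 4 * q + q ^+ 2) / (1 - q) ^+ 3.
  by apply: (mulfI q1); rewrite e2 f1 /c2; field.
by apply: (mulfI q1); rewrite e3 f2 /rat4; field.
Qed.

(** On series this keeps the even exponents, 2 (2 m)^3 = 16 m^3. It is the duplication formula of
    [S4], since w/2 and (w + 1)/2 have opposite nomes. *)
Lemma rat4_double q : q ^+ 2 != 1 -> rat4 q + rat4 (- q) = 16 * rat4 (q ^+ 2).
Proof.
move=> h; rewrite /rat4.
have h2 : 1 - q ^+ 2 != 0 by rewrite subr_eq0 eq_sym.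
have E : 1 - q ^+ 2 = (1 - q) * (1 - - q) by ring.
have := h2; rewrite E mulf_eq0 negb_or => /andP[a b].
have b' : 1 + q != 0 by rewrite -[q]opprK.
by field; rewrite ?a ?b ?b'.
Qed.

(** With t = x/2 the mean value theorem gives sin x = 2 sin t cos t >= 2 t cos^2 t, and 2 cos^2 t =
    1 + cos x >= 1. *)
Lemma sin_ge_half (x : R) : 0 <= x <= pi / 2 -> x / 2 <= sin x.
Proof.
move=> /andP[x0 xp]; set t := x / 2.
have t0 : 0 <= t by rewrite divr_ge0.
have xE : x = t *+ 2 by rewrite mulr2n -splitr.
have tp : t <= pi by have := pi_ge0 R; rewrite /t; lra.
have hMVT : t * cos t <= sin t.
  have hd y : y \in `]0, t[%R -> is_derive y 1 (@sin R) (cos y) by move=> _; exact: is_derive_sin.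
  have hc : {within `[0, t], continuous (@sin R)}.
    by apply: continuous_subspaceT => y; exact: continuous_sin.
  have [c] := MVT_segment t0 hd hc; rewrite in_itv /= => /andP[c0 ct].
  rewrite sin0 !subr0 => ->; rewrite mulrC ler_wpM2r //.
  have [->//|ct'] := eqVneq c t.
  have clt : c < t by rewrite lt_def eq_sym ct' ct.
  by rewrite ltW // ltr_cos // in_itv /= ?c0 ?t0 ?tp ?(le_trans ct).
have c2 : 1 / 2 <= cos t ^+ 2.
  have : 0 <= cos x by apply: cos_ge0_pihalf; rewrite xp (le_trans _ x0) // oppr_le0 divr_ge0 // pi_ge0.
  by rewrite xE cos_mulr2n; lra.
have ct0 : 0 <= cos t.
  apply: cos_ge0_pihalf; have := pi_ge0 R; rewrite /t; lra.
rewrite [in leRHS]xE sin_mulr2n mulr2n.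
have : t * cos t * cos t <= sin t * cos t by rewrite ler_wpM2r.
rewrite -mulrA -expr2 => h1; have : t * (1 / 2) <= t * cos t ^+ 2 by rewrite ler_wpM2l.
rewrite [cos t * _]mulrC; lra.
Qed.

Lemma sin_sq_ge (x : R) : `|x| <= pi / 2 -> x ^+ 2 <= 4 * sin x ^+ 2.
Proof.
move=> h.
have h1 : `|x| / 2 <= sin `|x| by apply: sin_ge_half; rewrite h normr_ge0.
have h2 : sin `|x| ^+ 2 = sin x ^+ 2.
  by case: (ger0P x) => _ //; rewrite sinN sqrrN.
rewrite -h2 -(real_normK (num_real x)).
have : (`|x| / 2) ^+ 2 <= sin `|x| ^+ 2.
  by rewrite lerXn2r ?nnegrE ?divr_ge0 // (le_trans _ h1) // divr_ge0.
rewrite expr_div_n; lra.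
Qed.

Lemma sinh_sq_ge (a : R) : a ^+ 2 <= (expR a - expR (- a)) ^+ 2.
Proof.
have P (b : R) : 0 <= b -> b ^+ 2 <= (expR b - expR (- b)) ^+ 2.
  move=> b0.
  have e1 := expR_ge1Dx b.
  have e2 : expR (- b) <= 1 by rewrite expR_le1 oppr_le0.
  by rewrite lerXn2r ?nnegrE; lra.
have [a0|a0] := leP 0 a; first exact: P.
have := P (- a); rewrite opprK sqrrN => /(_ _)/le_trans; apply; first by rewrite oppr_ge0 ltW.
by rewrite -[X in X <= _]sqrrN opprB.
Qed.

Definition cosh2 (u : C) := cexp u + cexp (- u) - 2.

(** [cosh2 u] is the square of 2 sinh (u/2). For u/2 = a + i b its norm is (e^a - e^-a)^2 + 4 sin^2
    b, which is at least a^2 + b^2. *)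
Lemma cosh2_lower u : `|complex.Im u| <= pi -> nm u ^+ 2 / 4 <= nm (cosh2 u).
Proof.
move=> hu.
pose v := u / 2; have uv : u = v + v by rewrite /v -splitr.
have E : cosh2 u = (cexp v - cexp (- v)) ^+ 2.
  rewrite /cosh2 uv opprD !cexpD cexpN; field.
  exact: cexp_neq0.
have nv : nm v ^+ 2 = nm u ^+ 2 / 4.
  by rewrite nmM nmV nm_nat exprMn exprVn -natrX.
rewrite E nmX -nv; case: v uv E nv => a b uv _ _.
rewrite !nm_sqr [complex.Re (Complex a b)]/= [complex.Im (Complex a b)]/=.
have -> : complex.Re (cexp (Complex a b) - cexp (- Complex a b)) = (expR a - expR (- a)) * cos b.
  by rewrite raddfB /= /cexp /= cosN !mul0r !subr0 mulrBl.
have -> : complex.Im (cexp (Complex a b) - cexp (- Complex a b)) = (expR a + expR (- a)) * sin b.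
  by rewrite raddfB /= /cexp /= sinN !mul0r !addr0 mulrN opprK mulrDl.
have hb : `|b| <= pi / 2.
  move: hu; rewrite uv /= -mulr2n normrMn -mulr_natr; lra.
have h1 := sin_sq_ge hb; have h2 := sinh_sq_ge a.
have e1 : expR a * expR (- a) = 1 := expRxMexpNx_1 a.
have h3 : (expR a + expR (- a)) ^+ 2 = (expR a - expR (- a)) ^+ 2 + 4.
  have -> : (expR a + expR (- a)) ^+ 2 = (expR a - expR (- a)) ^+ 2 + 4 * (expR a * expR (- a)) by ring.
  by rewrite e1 mulr1.
rewrite !exprMn h3 cos2sin2.
move: ((expR a - expR (- a)) ^+ 2) (sin b ^+ 2) (a ^+ 2) (b ^+ 2) h1 h2 => x y z w h1 h2.
by lra.
Qed.

Lemma big_nat4 (V : nmodType) (F : nat -> V) :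
  \sum_(0 <= i < 4) F i = F 0%N + F 1%N + F 2%N + F 3%N.
Proof. by rewrite !big_nat_recr //= big_nil add0r. Qed.

Lemma cosh2_upper u : nm (cosh2 u - u ^+ 2) <= 2 * (nm u ^+ 4 * expR (nm u)).
Proof.
have h1 := cexp_taylor u 4; have h2 := cexp_taylor (- u) 4.
have E : cosh2 u - u ^+ 2 = (cexp u - \sum_(0 <= m < 4) ecoef u m) +
    (cexp (- u) - \sum_(0 <= m < 4) ecoef (- u) m).
  rewrite !big_nat4 /ecoef (_ : 0`! = 1)%N // (_ : 1`! = 1)%N // (_ : 2`! = 2)%N // (_ : 3`! = 6)%N //.
  by rewrite /cosh2; field.
rewrite E mulr_natl mulr2n; apply: le_trans (nmD _ _) _; apply: lerD => //.
by move: h2; rewrite nmN.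
Qed.

Lemma rat4_cosh2 u : cexp u != 1 -> rat4 (cexp u) = (6 + cosh2 u) / cosh2 u ^+ 2.
Proof.
move=> h; have q0 := cexp_neq0 u.
rewrite /cosh2 cexpN; move: (cexp u) h q0 => q q1 q0.
have a : 1 - q != 0 by rewrite subr_eq0 eq_sym.
have -> : q + q^-1 - 2 = (1 - q) ^+ 2 / q by field.
by rewrite /rat4; field; rewrite a q0.
Qed.

(** With c = 2 cosh u - 2 the function is (6 + c)/c^2, where c = u^2 + O(u^4) and |c| >= |u|^2/4.
    Removing the pole 6/u^4 thus leaves O(u^-2). *)
Lemma rat4_bound (U : R) : 0 <= U -> exists2 K : R, 0 <= K & forall u, u != 0 -> nm u <= U ->
  `|complex.Im u| <= pi -> nm (rat4 (cexp u) - 6 / u ^+ 4) <= K / nm u ^+ 2.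
Proof.
move=> U0; pose E := 2 * expR U; pose A := 1 + E * U ^+ 2.
have E0 : 0 <= E by rewrite mulr_ge0 ?expR_ge0.
have A0 : 0 <= A by rewrite addr_ge0 // mulr_ge0 // sqr_ge0.
exists (16 * (A + 6 * E * (A + 1))); first by rewrite mulr_ge0 // addr_ge0 // !mulr_ge0 // addr_ge0.
move=> u u0 uU uI; pose c := cosh2 u; pose t := nm u.
have t0 : 0 < t by rewrite nm_gt0.
have cl : t ^+ 2 / 4 <= nm c := cosh2_lower uI.
have c0 : c != 0 by rewrite -nm_gt0; apply: lt_le_trans cl; rewrite divr_gt0 // exprn_gt0.
have q1 : cexp u != 1.
  apply: contra_neq c0 => h; rewrite /c /cosh2 cexpN h invr1; ring.
have cu : nm (c - u ^+ 2) <= E * t ^+ 4.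
  apply: le_trans (cosh2_upper u) _; rewrite /E -mulrA ler_wpM2l // mulrC.
  by rewrite ler_wpM2r ?exprn_ge0 ?nm_ge0 // ler_expR.
have t2U : t ^+ 2 <= U ^+ 2 by rewrite lerXn2r ?nnegrE // ltW.
have cA : nm c <= A * t ^+ 2.
  apply: le_trans (nm_le_add _ (u ^+ 2)) _; rewrite nmX -/t /A mulrDl mul1r addrC lerD2l.
  apply: le_trans cu _; rewrite -mulrA ler_wpM2l // (_ : 4 = 2 + 2)%N // exprD.
  by rewrite ler_wpM2r // sqr_ge0.
have cs : nm (c + u ^+ 2) <= (A + 1) * t ^+ 2.
  by apply: le_trans (nmD _ _) _; rewrite nmX -/t mulrDl mul1r lerD2r.
rewrite (rat4_cosh2 q1) -/c.
have -> : (6 + c) / c ^+ 2 - 6 / u ^+ 4 = (c * u ^+ 4 - 6 * ((c - u ^+ 2) * (c + u ^+ 2))) / (c ^+ 2 * u ^+ 4).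
  by field; rewrite c0 u0.
rewrite nmM nmV [nm (c ^+ 2 * _)]nmM !nmX -/t ler_pdivrMr; last first.
  by rewrite mulr_gt0 // exprn_gt0 // nm_gt0.
have num : nm (c * u ^+ 4 - 6 * ((c - u ^+ 2) * (c + u ^+ 2))) <= (A + 6 * E * (A + 1)) * t ^+ 6.
  apply: le_trans (nmB _ _) _; rewrite [leRHS]mulrDl; apply: lerD.
    have -> : A * t ^+ 6 = A * t ^+ 2 * t ^+ 4 by ring.
    by rewrite nmM nmX ler_wpM2r // exprn_ge0 // ltW.
  rewrite nmM nm_nat nmM.
  have -> : 6 * E * (A + 1) * t ^+ 6 = 6 * (E * t ^+ 4 * ((A + 1) * t ^+ 2)) by ring.
  by rewrite ler_wpM2l //; apply: ler_pM; rewrite ?nm_ge0.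
apply: le_trans num _.
have X0 : 0 <= A + 6 * E * (A + 1) by rewrite addr_ge0 // !mulr_ge0 // addr_ge0.
have -> : 16 * (A + 6 * E * (A + 1)) / t ^+ 2 * (nm c ^+ 2 * t ^+ 4) =
   (A + 6 * E * (A + 1)) * (16 * (nm c ^+ 2 * t ^+ 2)) by field; rewrite gt_eqF.
have -> : t ^+ 6 = t ^+ 4 * t ^+ 2 by ring.
rewrite ler_wpM2l // mulrA ler_wpM2r ?sqr_ge0 //.
have : (t ^+ 2 / 4) ^+ 2 <= nm c ^+ 2.
  by rewrite lerXn2r ?nnegrE ?nm_ge0 // divr_ge0 // sqr_ge0.
by rewrite expr_div_n -exprM; lra.
Qed.

Definition lipschitz4_cst : C := two_pi_i R ^+ 4 / 6.

Definition D4 w := S4 w - lipschitz4_cst * rat4 (nome w).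

Lemma nome_away w d : away w d -> nome w != 1.
Proof.
move=> [d0 h]; apply: contraTneq (h 0) => E.
have : nome (0 : C) = nome w by rewrite E /nome mulr0 cexp0.
move=> /nome_inj_int[n]; rewrite add0r => wn.
have := h (- n); rewrite wn -intrD subrr mulr0z nm0 => /(lt_le_trans d0).
by rewrite ltxx.
Qed.

Lemma D4_shift w d (n : int) : away w d -> D4 (w + n%:~R) = D4 w.
Proof. by move=> h; rewrite /D4 (S4_shift n h) nomeD nome_int mulr1. Qed.

Lemma nome_half : nome (1 / 2 : C) = -1.
Proof.
have -> : nome (1 / 2 : C) = cexp (Complex 0 pi).
  rewrite /nome mul1r; congr cexp.
  have -> : two_pi_i R = Complex 0 pi * 2.
    by rewrite mulr_natr mulr2n /two_pi_i; simpc; congr Complex; ring.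
  by rewrite mulfK.
by rewrite /cexp /= expR0 mul1r cospi sinpi; apply/eqP; rewrite eq_complex /= oppr0 !eqxx.
Qed.

Lemma D4_double w d : away w d ->
  D4 ((w + false%:R) / 2) + D4 ((w + true%:R) / 2) = 16 * D4 w.
Proof.
move=> h; rewrite /D4.
have := S4_double h; have hq := nome_away h.
have q2 : nome (w / 2) ^+ 2 = nome w.
  by rewrite -nome_Mn mulr2n -splitr.
have e0 : (w + false%:R) / 2 = w / 2 by rewrite /= addr0.
have e1 : nome ((w + true%:R) / 2) = - nome (w / 2).
  by rewrite mulrDl nomeD nome_half mulrN1.
have := @rat4_double (nome (w / 2)); rewrite q2 => /(_ hq).
rewrite e1 e0; move: (S4 _) (S4 _) (S4 _) (rat4 _) (rat4 _) (rat4 _) => a b c x y z E1 E2.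
have -> : c - lipschitz4_cst * z + (b - lipschitz4_cst * y) = (c + b) - lipschitz4_cst * (z + y) by ring.
by rewrite E1 E2; ring.
Qed.

(** The term w^-4 of [S4] cancels the pole 6/u^4 of [rat4] at u = 2 pi i w, up to O(|w|^-2). The
    remaining terms are bounded uniformly, since |w + n| >= |n|/2 for n nonzero. *)
Lemma D4_strip : exists2 K : R, 0 <= K & forall w d, away w d ->
  `|complex.Re w| <= 1 / 2 -> 0 <= complex.Im w <= 1 -> nm (D4 w) <= K / d ^+ 2.
Proof.
(* On the strip |w| <= 3/2, and pi <= 4, so |2 pi w| <= 12. *)
have [K K0 hK] := @rat4_bound 12 (ler0n _ _).
pose Q := nm lipschitz4_cst * K.
have Q0 : 0 <= Q by rewrite mulr_ge0 ?nm_ge0.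
(* 2^7 compares (|n|/2)^-4 with 1/(1 + n^2), whose sum is at most 6; the 4 absorbs d^2 <= |w|^2 <=
   2. *)
exists (2 ^+ 7 * 6 * 4 + Q); first by rewrite addr_ge0 // !mulr_ge0.
move=> w d aw /[dup] Rw; rewrite ler_norml => /andP[Rw1 Rw2] /andP[Iw1 Iw2].
have [d0 hd] := aw.
have dw : d <= nm w by have := hd 0; rewrite addr0.
have w0 : w != 0 by rewrite -nm_gt0; apply: lt_le_trans dw.
have nw2 : nm w ^+ 2 <= 2 by rewrite nm_sqr; nra.
have pi4 : (pi : R) <= 4 by have := @pihalf_lt2 R; lra.
have pi0 := @pi_gt0 R.
have far : nm (S4 w - w ^- 4) <= 2 ^+ 7 * 6.
  pose b (n : int) := if n == 0 then 0 else L4 w n.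
  have hb : sums_to b (S4 w - w ^- 4).
    have h0 : sums_to (fun n : int => if n == 0 then w ^- 4 else 0) (w ^- 4).
      have := @sums_to_fin R _ (fun n : int => if n == 0 then w ^- 4 else 0) [:: 0] isT.
      by rewrite big_seq1 eqxx; apply => n; rewrite inE => /negbTE ->.
    apply: sums_to_ext (sums_to_sub (S4_sums_to aw) h0) => n; rewrite /b; case: eqP => [->|_].
      by rewrite /L4 addr0 subrr.
    by rewrite subr0.
  have -> : 2 ^+ 7 * 6 = nm ((2 ^+ 7)%:C%C : C) * 6 :> R by rewrite nm_real ger0_norm.
  apply: sums_to_nm hb _; apply: abs_le_le (abs_le_scale _ (abs_le_isq R)) => // n.
  rewrite nmM nm_isq nm_real ger0_norm // /b; case: eqP => [_|/eqP n0].
    by rewrite nm0 mulr_ge0 // invr_ge0 addr_ge0 // sqr_ge0.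
  rewrite nm_L4.
  have n1 : 1 <= `|n%:~R : R|.
    by rewrite -intr_norm ler1z -gtz0_ge1 normr_gt0.
  have t1 : `|n%:~R : R| / 2 <= nm (w + n%:~R).
    apply: le_trans (nm_Re _); rewrite raddfD /= -(rmorph_int (real_complex R)) /=.
    have := lerB_normD (n%:~R : R) (complex.Re w).
    by rewrite [n%:~R + _]addrC; lra.
  have s0 : 0 < 1 + (n%:~R : R) ^+ 2 by rewrite ltr_wpDr ?sqr_ge0.
  have tp : 0 < nm (w + n%:~R) by apply: lt_le_trans t1; rewrite divr_gt0 // (lt_le_trans ltr01).
  rewrite ler_pdivlMr // mulrC ler_pdivrMr ?exprn_gt0 //.
  rewrite -[n%:~R ^+ 2]real_normK ?num_real //.
  have : (`|n%:~R : R| / 2) ^+ 4 <= nm (w + n%:~R) ^+ 4.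
    by rewrite lerXn2r ?nnegrE ?divr_ge0 // ltW.
  rewrite expr_div_n; move: (nm _ ^+ 4) => X.
  have : `|n%:~R : R| ^+ 2 <= `|n%:~R : R| ^+ 4 by rewrite ler_weXn2l.
  have : 1 <= `|n%:~R : R| ^+ 2 by rewrite exprn_ege1.
  by move: (`|n%:~R : R| ^+ 2) (`|n%:~R : R| ^+ 4) => p q; lra.
pose u := two_pi_i R * w.
have nu : nm u = 2 * pi * nm w by rewrite nmM nm_two_pi.
have near_ : nm (w ^- 4 - lipschitz4_cst * rat4 (nome w)) <= Q / nm w ^+ 2.
  have u0 : u != 0 by rewrite mulf_neq0 ?two_pi_neq0.
  have -> : w ^- 4 - lipschitz4_cst * rat4 (nome w) = - (lipschitz4_cst * (rat4 (cexp u) - 6 / u ^+ 4)).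
    rewrite /nome -/u; move: (rat4 _) => r; rewrite /lipschitz4_cst /u.
    by field; rewrite w0 two_pi_neq0.
  rewrite nmN nmM /Q -mulrA ler_wpM2l ?nm_ge0 //.
  have uI : `|complex.Im u| <= pi.
    have -> : complex.Im u = 2 * pi * complex.Re w.
      by rewrite /u; case: (w) => a b /=; rewrite mul0r add0r.
    by rewrite ler_norml; apply/andP; split; nra.
  have uU : nm u <= 12.
    have : nm w <= 3 / 2.
      by rewrite -(@ler_pXn2r _ 2) ?nnegrE ?nm_ge0 ?divr_ge0 //; apply: le_trans nw2 _; lra.
    by rewrite nu; have := nm_ge0 w; nra.
  apply: le_trans (hK u u0 uU uI) _.
  rewrite ler_wpM2l // lef_pV2 ?posrE ?exprn_gt0 ?nm_gt0 //.
  rewrite lerXn2r ?nnegrE ?nm_ge0 // nu ler_peMl ?nm_ge0 //.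
  by have := pi_ge2 R; lra.
have -> : D4 w = (S4 w - w ^- 4) + (w ^- 4 - lipschitz4_cst * rat4 (nome w)) by rewrite /D4; ring.
apply: le_trans (nmD _ _) _; rewrite mulrDl; apply: lerD.
  apply: le_trans far _; rewrite -[leRHS]mulrA; apply: ler_peMr; first by rewrite mulr_ge0.
  rewrite ler_pdivlMr ?exprn_gt0 // mul1r.
  have : d ^+ 2 <= nm w ^+ 2 by rewrite lerXn2r ?nnegrE ?nm_ge0 // ltW.
  by lra.
apply: le_trans near_ _; rewrite ler_wpM2l // lef_pV2 ?posrE ?exprn_gt0 ?nm_gt0 //.
by rewrite lerXn2r ?nnegrE ?nm_ge0 // ltW.
Qed.

(* Herglotz' trick: the duplication formula contracts a bound of order d^-2. *)
Lemma D4_zero w d : away w d -> 0 <= complex.Im w -> D4 w = 0.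
Proof.
have [K K0 hK] := D4_strip.
(* Halving w halves d, so each of the two values costs 4 times the previous bound; the total 8
   against the factor 16 gains 1/2. The height is halved too, so the N-th bound reaches up to height
   2^N. *)
have P N : forall w d, away w d -> 0 <= complex.Im w <= 2 ^+ N ->
    nm (D4 w) <= K * (1 / 2) ^+ N / d ^+ 2.
  elim: N => [|N IH] {}w {}d aw /andP[I0 I1].
    rewrite expr0 mulr1.
    pose n := - Num.floor (complex.Re w + 1 / 2).
    rewrite -(D4_shift n aw); apply: hK; first exact: away_shift.
      have := floor_itv (complex.Re w + 1 / 2).
      rewrite intrD raddfD /= -(rmorph_int (real_complex R)) /= /n mulrNz ler_norml.
      by move: (_%:~R) => k /andP[h1 h2]; apply/andP; split; lra.
    by rewrite raddfD /= -(rmorph_int (real_complex R)) /= addr0 I0.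
  have Ih b : complex.Im ((w + b%:R) / 2) = complex.Im w / 2.
    rewrite -(rmorph_nat (real_complex R) 2) -fmorphV -(rmorph_nat (real_complex R) b).
    by case: (w) => x y /=; rewrite !addr0 mulr0 add0r.
  have hb b : nm (D4 ((w + (b : bool)%:R) / 2)) <= K * (1 / 2) ^+ N / (d / 2) ^+ 2.
    apply: IH; first exact: away_half.
    rewrite Ih divr_ge0 //= ler_pdivrMr // -exprSr //.
  have E := D4_double aw.
  have : nm (16 * D4 w) <= K * (1 / 2) ^+ N / (d / 2) ^+ 2 + K * (1 / 2) ^+ N / (d / 2) ^+ 2.
    by rewrite -E; apply: le_trans (nmD _ _) _; apply: lerD.
  have [d0 _] := aw.
  have q4 x : x / (d / 2) ^+ 2 = 4 * (x / d ^+ 2) by field; rewrite gt_eqF.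
  rewrite nmM nm_nat q4 [(1 / 2) ^+ N.+1]exprS.
  have -> : K * (1 / 2 * (1 / 2) ^+ N) / d ^+ 2 = (K * (1 / 2) ^+ N / d ^+ 2) / 2 by ring.
  by lra.
move=> aw Iw; apply: nm_eps_eq0 => e e0.
have [d0 _] := aw.
have [N hN] : exists N : nat, complex.Im w <= 2 ^+ N /\ K / d ^+ 2 <= e * 2 ^+ N.
  have P2 (x : R) : exists N : nat, forall M, (N <= M)%N -> x <= 2 ^+ M.
    exists (Num.bound `|x|) => M hM.
    have h1 : x < (Num.bound `|x|)%:R by apply: le_lt_trans (ler_norm _) (archi_boundP _).
    apply: le_trans (ltW h1) _; apply: (@le_trans _ _ M%:R); first by rewrite ler_nat.
    by rewrite -natrX ler_nat ltnW // ltn_expl.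
  have [N1 h1] := P2 (complex.Im w); have [N2 h2] := P2 (K / d ^+ 2 / e).
  exists (maxn N1 N2); rewrite h1 ?leq_maxl //; split=> //.
  by rewrite [leRHS]mulrC -ler_pdivrMr // h2 // leq_maxr.
apply: le_trans (P N w d aw _) _; first by rewrite Iw; case: hN.
case: hN => _ hN.
have -> : K * (1 / 2) ^+ N / d ^+ 2 = (K / d ^+ 2) / 2 ^+ N.
  by rewrite expr_div_n expr1n; ring.
by rewrite ler_pdivrMr // exprn_gt0.
Qed.

End Lipschitz.

(** * The lattice sum of weight 4 *)

Section Eisenstein4.
Variable R : realType.
Local Notation C := R[i].
Implicit Types w z : C.

Lemma lipschitz4 w : 0 < complex.Im w -> S4 w = lipschitz4_cst R * rat4 (nome w).
Proof.
move=> hw; have := D4_zero (away_Im hw) (ltW hw).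
by rewrite /D4 => /eqP; rewrite subr_eq0 => /eqP.
Qed.

Lemma away_half_point : away (1 / 2 : C) (1 / 2).
Proof.
split=> [|n]; first by rewrite divr_gt0.
have -> : 1 / 2 + n%:~R = (1 + n + n)%:~R / 2 :> C by rewrite !intrD; field.
rewrite nmM nmV nm_nat nm_int ler_wpM2r ?invr_ge0 //.
rewrite -intr_norm ler1z -gtz0_ge1 normr_gt0; lia.
Qed.

Lemma S4_half : S4 (1 / 2 : C) = lipschitz4_cst R / 8.
Proof.
have Im0 : 0 <= complex.Im (1 / 2 : C).
  by rewrite mul1r -(rmorph_nat (real_complex R)) -fmorphV.
have := D4_zero away_half_point Im0.
rewrite /D4 nome_half => /eqP; rewrite subr_eq0 => /eqP ->.
by rewrite /rat4; field.
Qed.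

Lemma int_sq_ge1 (n : int) : n != 0 -> 1 <= (n%:~R : R) ^+ 2.
Proof.
move=> n0; rewrite -real_normK ?num_real // exprn_ege1 //.
by rewrite -intr_norm ler1z -gtz0_ge1 normr_gt0.
Qed.

Lemma abs_le_L4_0 : exists M, abs_le (L4 (0 : C)) M.
Proof.
exists (nm (2%:C%C : C) * 6); apply: abs_le_le (abs_le_scale _ (abs_le_isq R)) => // n.
rewrite nm_L4 add0r nmM nm_isq nm_real ger0_norm // nm_int.
have s0 : 0 < 1 + (n%:~R : R) ^+ 2 by rewrite ltr_wpDr ?sqr_ge0.
have [->|n0] := eqVneq n 0.
  by rewrite mulr0z normr0 expr0n invr0 mulr_ge0 // invr_ge0 ltW.
have h := int_sq_ge1 n0.
rewrite (_ : 4 = 2 * 2)%N // exprM real_normK ?num_real //.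
have p0 : 0 < (n%:~R : R) ^+ 2 ^+ 2 by rewrite exprn_gt0 // (lt_le_trans ltr01).
by rewrite ler_pdivlMr // mulrC ler_pdivrMr //; nra.
Qed.

(** [S4 0] is 2 zeta(4), since the inverse of 0 is 0 and so the term n = 0 vanishes. Separating even
    and odd n gives 15 [S4 0] = [S4 (1 / 2)], which Lipschitz' formula evaluates at q = -1. *)
Lemma zeta4 : S4 (0 : C) = lipschitz4_cst R / 120.
Proof.
have [M hM] := abs_le_L4_0; have h0 := hsumP hM; rewrite -/(S4 0) in h0.
have h1 := S4_sums_to away_half_point.
have h2 := sums_to_even_odd hM h0.
have h3 := sums_to_scale 16^-1 (sums_to_add h0 h1).
have E : S4 (0 : C) = 16^-1 * (S4 0 + S4 (1 / 2)).
  apply: sums_to_unique h2 _; apply: sums_to_ext h3 => n.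
  rewrite mulrDr /L4 !add0r; congr (_ + _).
    rewrite -invfM; congr (_^-1); rewrite !intrD.
    have -> : n%:~R + n%:~R = 2 * n%:~R :> C by ring.
    by rewrite exprMn -natrX.
  rewrite -invfM; congr (_^-1); rewrite !intrD -[1%:~R]/1.
  have -> : n%:~R + n%:~R + 1 = 2 * (1 / 2 + n%:~R) :> C by field.
  by rewrite exprMn -natrX.
rewrite S4_half in E; move: (S4 0) (lipschitz4_cst R) E => x k E.
have : 15 * x = k / 8.
  have -> : 15 * x = 16 * x - x by ring.
  by rewrite {1}E; field.
move=> E2; have -> : x = (15 * x) / 15 by field.
by rewrite E2; field.
Qed.

(** The origin of the lattice contributes 0, by the convention on the inverse of 0. *)
Definition G4term z (p : int * int) : C := (p.1%:~R * z + p.2%:~R) ^- 4.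

Lemma abs_le_G4 z : 0 < complex.Im z -> exists M, abs_le (G4term z) M.
Proof.
move=> hz; pose y := complex.Im z; pose x := complex.Re z.
(* With t = |m z + n| one has m^2 <= t^2/y^2 and n^2 <= 2 (m x + n)^2 + 2 m^2 x^2, hence m^2 + n^2
   <= A t^2. For (m, n) nonzero, (1 + m^2) (1 + n^2) <= 3 (m^2 + n^2)^2 then compares with a product
   of two single sums. *)
pose A := 2 + (2 * x ^+ 2 + 1) / y ^+ 2.
have y2 : 0 < y ^+ 2 by rewrite exprn_gt0.
have A0 : 0 <= A by rewrite addr_ge0 // divr_ge0 ?sqr_ge0 // addr_ge0 // mulr_ge0 // sqr_ge0.
have [l hl] := sums_to_exists (abs_le_isq R).
have [h1 _] := sums_to_mul (abs_le_isq R) (abs_le_isq R) hl hl.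
exists (nm (3 * A ^+ 2)%:C%C * (6 * 6)); apply: abs_le_le (abs_le_scale _ h1) => // -[m n].
rewrite /G4term; cbn [fst snd].
rewrite nmV nmX nmM (nmM (isq R m)) !nm_isq nm_real ger0_norm; last first.
  by rewrite mulr_ge0 // sqr_ge0.
set t := nm _.
have t2 : t ^+ 2 = (m%:~R * x + n%:~R) ^+ 2 + m%:~R ^+ 2 * y ^+ 2.
  rewrite nm_sqr !raddfD /= -!(rmorph_int (real_complex R)) /=.
  rewrite /x /y; case: (z) => a b /=; ring.
have S0 : 0 < 1 + (m%:~R : R) ^+ 2 by rewrite ltr_wpDr ?sqr_ge0.
have S1 : 0 < 1 + (n%:~R : R) ^+ 2 by rewrite ltr_wpDr ?sqr_ge0.
have St : (m%:~R : R) ^+ 2 + n%:~R ^+ 2 <= A * t ^+ 2.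
  have h : (m%:~R : R) ^+ 2 <= t ^+ 2 / y ^+ 2.
    by rewrite ler_pdivlMr // t2 lerDr sqr_ge0.
  have -> : A * t ^+ 2 = 2 * t ^+ 2 + (2 * x ^+ 2 + 1) * (t ^+ 2 / y ^+ 2).
    by rewrite /A; field; rewrite gt_eqF.
  have : (2 * x ^+ 2 + 1) * (m%:~R : R) ^+ 2 <= (2 * x ^+ 2 + 1) * (t ^+ 2 / y ^+ 2).
    by rewrite ler_wpM2l // addr_ge0 // mulr_ge0 // sqr_ge0.
  have : (m%:~R * x + n%:~R) ^+ 2 <= t ^+ 2 by rewrite t2 lerDl mulr_ge0 ?sqr_ge0.
  have := sqr_ge0 (2 * (m%:~R * x) + n%:~R : R).
  by move: (t ^+ 2 / y ^+ 2) (t ^+ 2) (m%:~R : R) (n%:~R : R) => r s a b; nra.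
have [mn0|mn0] := boolP ((m == 0) && (n == 0)).
  case/andP: mn0 => /eqP m0 /eqP n0; rewrite /t m0 n0 !mulr0z mul0r addr0 nm0 expr0n invr0.
  by rewrite [0 ^+ 2]expr0n /= addr0 invr1 !mulr1 mulr_ge0 // sqr_ge0.
rewrite -invfM.
have Sge : 1 <= (m%:~R : R) ^+ 2 + n%:~R ^+ 2.
  move: mn0; rewrite negb_and => /orP[/int_sq_ge1 h|/int_sq_ge1 h].
    by apply: le_trans h _; rewrite lerDl sqr_ge0.
  by apply: le_trans h _; rewrite lerDr sqr_ge0.
have t2p : 0 < t ^+ 2.
  have := sqr_ge0 t; rewrite le_eqVlt => /orP[/eqP e|//]; move: St; rewrite -e mulr0; lra.
rewrite ler_pdivlMr ?mulr_gt0 // mulrC ler_pdivrMr; last first.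
  by rewrite (_ : 4 = 2 * 2)%N // exprM exprn_gt0.
have -> : 3 * A ^+ 2 * t ^+ 4 = 3 * (A * t ^+ 2) ^+ 2 by ring.
have : ((m%:~R : R) ^+ 2 + n%:~R ^+ 2) ^+ 2 <= (A * t ^+ 2) ^+ 2.
  apply: lerXn2r; [by rewrite nnegrE addr_ge0 // sqr_ge0| |exact: St].
  by rewrite nnegrE; apply: le_trans St; rewrite addr_ge0 // sqr_ge0.
have := sqr_ge0 (m%:~R : R); have := sqr_ge0 (n%:~R : R).
move: ((A * t ^+ 2) ^+ 2) ((m%:~R : R) ^+ 2) ((n%:~R : R) ^+ 2) Sge => X a b Sge b0 a0 H.
by nra.
Qed.

Definition G4 z := hsum (G4term z).

Lemma G4_sums_to z : 0 < complex.Im z -> sums_to (G4term z) (G4 z).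
Proof. by move=> /abs_le_G4[M /hsumP]. Qed.

Lemma sums_to_rat4 z : 0 < complex.Im z ->
  sums_to (fun x : nat => rat4 (nome z ^+ x.+1)) (W (nome z) 3 0).
Proof.
move=> hz; have q1 := nome_lt1 hz.
apply: sums_to_sigma (sums_to_swap (W_sums_to q1 3 0)) _ => x.
have qx : nm (nome z ^+ x.+1) < 1 by rewrite nmX exprn_ilt1 ?nm_ge0.
have [[M hM] h] := ps_sums_to (@qsumm_exp R 3) qx.
rewrite ps_cubes // in h.
have := sums_to_shift 1 hM h; rewrite big_nat1 expr0n mul0r subr0.
apply: sums_to_ext => a; rewrite /wterm /= expr0 mulr1 add1n; congr (_ * _).
by rewrite -exprM mulnC.
Qed.

Lemma Im_natM z m : 0 < complex.Im z -> 0 < complex.Im (m.+1%:R * z).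
Proof.
move=> hz; rewrite -(rmorph_nat (real_complex R)); case: z hz => a b /= hb.
by rewrite mul0r addr0 mulr_gt0.
Qed.

(** Lipschitz' formula at m z evaluates the row m > 0; the row -m equals the row m, and the row 0 is
    2 zeta(4). *)
Lemma G4_value z : 0 < complex.Im z -> G4 z = lipschitz4_cst R / 120 * (1 + 240 * W (nome z) 3 0).
Proof.
move=> hz; have [M hM] := abs_le_G4 hz; have hG := G4_sums_to hz.
pose b (m : int) : C := match m with Posz 0 => S4 0 | Posz k.+1 => lipschitz4_cst R * rat4 (nome z ^+ k.+1)
  | Negz k => lipschitz4_cst R * rat4 (nome z ^+ k.+1) end.
have row k : sums_to (fun n : int => G4term z (Posz k.+1, n)) (lipschitz4_cst R * rat4 (nome z ^+ k.+1)).
  have hw := Im_natM k hz.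
  rewrite -nome_Mn -mulr_natl -lipschitz4 //.
  by apply: sums_to_ext (S4_sums_to (away_Im hw)) => n; rewrite /L4 /G4term /= -pmulrn.
have hb : sums_to b (G4 z).
  apply: sums_to_sigma hG _ => -[[|k]|k] /=.
  - have [N hN] := abs_le_L4_0; apply: sums_to_ext (hsumP hN) => n.
    by rewrite /L4 /G4term /= mulr0z mul0r.
  - exact: row.
  - apply: (@sums_to_bij _ _ _ (fun n => - n)); first by exists (fun n => - n) => n; rewrite opprK.
    apply: sums_to_ext (row k) => n; rewrite /G4term /= NegzE !mulrNz mulNr -opprD.
    by congr (_^-1); move: (_ + _) => x; ring.
have hW := sums_to_scale (lipschitz4_cst R) (sums_to_rat4 hz).
have h0 : sums_to (fun m : int => if m == 0 then S4 0 else 0) (S4 (0 : C)).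
  have := @sums_to_fin R _ (fun m : int => if m == 0 then S4 (0 : C) else 0) [:: 0] isT.
  by rewrite big_seq1 eqxx; apply => n; rewrite inE => /negbTE ->.
have hp : sums_to (fun m : int => if m is Posz k.+1 then lipschitz4_cst R * rat4 (nome z ^+ k.+1) else 0)
    (lipschitz4_cst R * W (nome z) 3 0).
  apply: (@sums_to_inj _ _ _ (fun k => Posz k.+1)) hW; first by move=> k l [].
  by move=> [[|k]|k] // /(_ k); rewrite eqxx.
have hn : sums_to (fun m : int => if m is Negz k then lipschitz4_cst R * rat4 (nome z ^+ k.+1) else 0)
    (lipschitz4_cst R * W (nome z) 3 0).
  apply: (@sums_to_inj _ _ _ Negz) hW; first by move=> k l [].
  by move=> [k|k] // /(_ k); rewrite eqxx.
have -> : G4 z = S4 0 + lipschitz4_cst R * W (nome z) 3 0 + lipschitz4_cst R * W (nome z) 3 0.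
  apply: sums_to_unique hb _; apply: sums_to_ext (sums_to_add (sums_to_add h0 hp) hn) => -[[|k]|k] /=.
  - by rewrite !addr0.
  - by rewrite add0r addr0.
  - by rewrite !add0r.
by rewrite zeta4; field.
Qed.

Lemma Im_S z : 0 < complex.Im z -> 0 < complex.Im (- z^-1).
Proof.
move=> hz; have z0 : 0 < nm z ^+ 2.
  by rewrite exprn_gt0 // nm_gt0; apply: contraTneq hz => ->; rewrite ltxx.
move: z0; rewrite nm_sqr; case: z hz => a b /= hb z0.
by rewrite opprK divr_gt0.
Qed.

Lemma Im_neq0 z : 0 < complex.Im z -> z != 0.
Proof. by move=> hz; apply: contraTneq hz => ->; rewrite ltxx. Qed.

(** In weight 4 the sum over the lattice is absolutely convergent, so (m, n) may be replaced by (-n,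
    m). *)
Lemma G4_S z : 0 < complex.Im z -> G4 (- z^-1) = z ^+ 4 * G4 z.
Proof.
move=> hz; have z0 := Im_neq0 hz.
apply: sums_to_unique (G4_sums_to (Im_S hz)) _.
apply: (@sums_to_bij _ _ _ (fun p : int * int => (- p.2, p.1))).
  by exists (fun p : int * int => (p.2, - p.1)) => -[m n] /=; rewrite opprK.
apply: sums_to_ext (sums_to_scale (z ^+ 4) (G4_sums_to hz)) => -[m n].
rewrite /G4term /= mulrNz mulrNN.
have -> : n%:~R / z + m%:~R = (m%:~R * z + n%:~R) / z by field.
by rewrite expr_div_n invf_div.
Qed.

Lemma g2_S z : 0 < complex.Im z -> g2 (- z^-1) = z ^+ 4 * g2 z.
Proof.
move=> hz; have [_ -> _] := g_W hz; have [_ -> _] := g_W (Im_S hz).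
have E := G4_S hz; rewrite !G4_value ?Im_S // in E.
have k0 : lipschitz4_cst R / 120 != 0.
  by apply: mulf_neq0; [apply: mulf_neq0|]; rewrite ?expf_neq0 ?two_pi_neq0 // invr_eq0 pnatr_eq0.
have {}E : 1 + 240 * W (nome (- z^-1)) 3 0 = z ^+ 4 * (1 + 240 * W (nome z) 3 0).
  by apply: (mulfI k0); rewrite E mulrCA.
have gen (a x y c : C) : x = c * y -> a * x = c * (a * y) by move=> ->; rewrite mulrCA.
exact: gen E.
Qed.

End Eisenstein4.

(** * Modularity *)

Section Modular.
Variable R : realType.
Local Notation C := R[i].
Implicit Types z : C.

Lemma cdiff_S (f : C -> C) z d : 0 < complex.Im z -> cdiff f (- z^-1) d ->
  cdiff (fun w => f (- w^-1)) z (d * z ^- 2).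
Proof.
move=> hz hf; have h := cdiff_scale (-1) (cdiff_inv (Im_neq0 hz)).
have -> : z ^- 2 = -1 * - z ^- 2 by rewrite mulN1r opprK.
have h' : cdiff (fun x => - x^-1) z (-1 * - z ^- 2).
  by apply: cdiff_near ltr01 _ h => x _; rewrite mulN1r.
exact: cdiff_comp h' hf.
Qed.

Lemma cdiff_X z n : cdiff (fun w => w ^+ n) z (n%:R * z ^+ n.-1).
Proof.
elim: n => [|n IH]; first by rewrite mul0r; exact: cdiff_cst.
have := cdiff_mul (cdiff_id z) IH.
have -> : 1 * z ^+ n + z * (n%:R * z ^+ n.-1) = n.+1%:R * z ^+ n.
  by case: n {IH} => [|n]; rewrite ?expr0 ?mul0r ?mulr0 ?addr0 // -[n.+2%:R]natr1 exprS /=; ring.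
by apply: cdiff_near ltr01 _ => h _; rewrite exprS.
Qed.

Lemma cdiff_eq (f g : C -> C) z d d' : (forall w, 0 < complex.Im w -> f w = g w) ->
  0 < complex.Im z -> cdiff f z d -> cdiff g z d' -> d = d'.
Proof.
move=> fg hz hf; apply: cdiff_unique.
by apply: cdiff_near hz _ hf => h hh; apply: fg; exact: Im_near.
Qed.

(* Differentiating the functional equation of [g2] once gives [2 x g2 = 3 y], and
   twice [x (x g2 + 3 g3) = 0], so that [g3 (-1/z) = +- z^6 g3 z]. Hence the
   discriminant is modular, and its logarithmic derivative gives [x = 0]. *)
Let x z := g1 (- z^-1) * z^-1 ^+ 2 - z^-1 - g1 z.
Let y z := g3 (- z^-1) * z^-1 ^+ 6 - g3 z.

Lemma g23_S z : 0 < complex.Im z -> 2 * (x z * g2 z) = 3 * y z.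
Proof.
move=> hz; have z0 := Im_neq0 hz; have hS := Im_S hz.
have := cdiff_eq (@g2_S R) hz (cdiff_S hz (cdiff_g2 hS)) (cdiff_mul (cdiff_X z 4) (cdiff_g2 hz)).
rewrite g2_S //= /x /y.
move: (g1 _) (g3 (- _)) (g1 z) (g2 z) (g3 z) => a1 a3 b1 b2 b3 E.
have -> : a3 = (4 * a1 * z ^+ 4 * b2 - z ^+ 2 * (4%:R * z ^+ 3 * b2 + z ^+ 4 * (4 * b1 * b2 - 6 * b3))) / 6.
  by rewrite -E; field.
by field.
Qed.

(** The terms in g2 cancel by [g2_S], which leaves a Riccati equation for the defect. *)
Lemma cdiff_x z : 0 < complex.Im z -> cdiff x z (x z * (x z + 2 * g1 z)).
Proof.
move=> hz; have z0 := Im_neq0 hz; have hS := Im_S hz.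
have i2 := cdiff_mul (cdiff_inv z0) (cdiff_inv z0).
have := cdiff_add (cdiff_add (cdiff_mul (cdiff_S hz (cdiff_g1 hS)) i2)
  (cdiff_scale (-1) (cdiff_inv z0))) (cdiff_scale (-1) (cdiff_g1 hz)).
rewrite g2_S //.
set d := (X in cdiff _ _ X); have -> : d = x z * (x z + 2 * g1 z).
  by rewrite /d /x; move: (g1 _) (g1 z) (g2 z) => a1 b1 b2; field.
have gen (a i b : C) : a * (i * i) + -1 * i + -1 * b = a * i ^+ 2 - i - b by ring.
by apply: cdiff_near ltr01 _ => h _; exact: gen.
Qed.

Lemma cdiff_y z : 0 < complex.Im z ->
  cdiff y z (6 * (x z * g3 z + g1 z * y z + x z * y z)).
Proof.
move=> hz; have z0 := Im_neq0 hz; have hS := Im_S hz.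
have i6 := cdiff_comp (cdiff_inv z0) (cdiff_X z^-1 6).
have := cdiff_add (cdiff_mul (cdiff_S hz (cdiff_g3 hS)) i6) (cdiff_scale (-1) (cdiff_g3 hz)).
rewrite g2_S //=.
set d := (X in cdiff _ _ X).
have -> : d = 6 * (x z * g3 z + g1 z * y z + x z * y z).
  rewrite /d /x /y; move: (g1 _) (g3 (- _)) (g1 z) (g2 z) (g3 z) => a1 a3 b1 b2 b3.
  by field.
have gen (a i b : C) : a * i + -1 * b = a * i - b by ring.
by apply: cdiff_near ltr01 _ => h _; exact: gen.
Qed.

Lemma x_alt z : 0 < complex.Im z -> x z * (x z * g2 z + 3 * g3 z) = 0.
Proof.
move=> hz.
have := cdiff_eq g23_S hz (cdiff_scale 2 (cdiff_mul (cdiff_x hz) (cdiff_g2 hz)))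
  (cdiff_scale 3 (cdiff_y hz)).
have -> : y z = 2 / 3 * (x z * g2 z) by have := g23_S hz => E; rewrite -mulrAC E; field.
move: (x z) (g1 z) (g2 z) (g3 z) => X b1 b2 b3 E.
have -> : X * (X * b2 + 3 * b3) = (2 * (X * (X + 2 * b1) * b2 + X * (4 * b1 * b2 - 6 * b3)) -
  3 * (6 * (X * b3 + b1 * (2 / 3 * (X * b2)) + X * (2 / 3 * (X * b2))))) / (- 10).
  by field.
by rewrite E subrr mul0r.
Qed.

(** At each z either y = 0 or y = -2 g3. The sign of g3 (-1/z) might a priori vary with z, but only
    its square enters the discriminant. *)
Lemma disc_S z : 0 < complex.Im z -> disc (- z^-1) = z ^+ 12 * disc z.
Proof.
move=> hz; have z0 := Im_neq0 hz.
have E : g3 (- z^-1) = z ^+ 6 * (g3 z + y z).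
  by rewrite /y; move: (g3 _) (g3 z) => a b; field.
have Y2 : (g3 z + y z) ^+ 2 = g3 z ^+ 2.
  have := x_alt hz; have H := g23_S hz.
  have -> : x z * g2 z = 3 / 2 * y z by move: H; move: (y z) (x z * g2 z) => a b H; apply: (@mulfI _ 2); rewrite ?pnatr_eq0 // H; field.
  move/eqP; rewrite mulf_eq0 => /orP[/eqP x0|/eqP e].
    move: H; rewrite x0 mul0r mulr0 => /esym/eqP; rewrite mulf_eq0 pnatr_eq0 /= => /eqP ->.
    by rewrite addr0.
  have -> : y z = - 2 * g3 z.
    move: e; move: (y z) (g3 z) => a b e.
    have -> : a = 2 / 3 * (3 / 2 * a + 3 * b) - 2 * b by field.
    by rewrite e; ring.
  by move: (g3 z) => b; ring.
rewrite /disc E g2_S // exprMn Y2; move: (g2 z) (g3 z) => a b; ring.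
Qed.

Lemma g1_S z : 0 < complex.Im z -> g1 (- z^-1) = z ^+ 2 * g1 z + z.
Proof.
move=> hz; have z0 := Im_neq0 hz; have hS := Im_S hz.
have := cdiff_eq disc_S hz (cdiff_S hz (cdiff_disc hS)) (cdiff_mul (cdiff_X z 12) (cdiff_disc hz)).
rewrite disc_S //=; have := disc_neq0 hz.
move: (disc z) (g1 (- _)) (g1 z) => D a b D0.
have gen (t : C) : t != 0 -> t * a * (z ^+ 12 * D) * z ^- 2 = t * z ^+ 11 * D + z ^+ 12 * (t * b * D) ->
    a = z ^+ 2 * b + z.
  move=> t0 E; have N : t * z ^+ 10 * D != 0 by rewrite !mulf_neq0 // expf_neq0.
  apply: (mulfI N).
  have -> : t * z ^+ 10 * D * a = t * a * (z ^+ 12 * D) * z ^- 2 by field.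
  by rewrite E; ring.
by apply: gen; rewrite pnatr_eq0.
Qed.

Lemma g3_S z : 0 < complex.Im z -> g3 (- z^-1) = z ^+ 6 * g3 z.
Proof.
move=> hz; have z0 := Im_neq0 hz.
have x0 : x z = 0 by rewrite /x g1_S //; move: (g1 z) => a; field.
have := g23_S hz; rewrite x0 mul0r mulr0 => /esym/eqP; rewrite mulf_eq0 pnatr_eq0 /=.
by rewrite /y subr_eq0 => /eqP <-; rewrite exprVn mulrCA divff ?mulr1 // expf_neq0.
Qed.

Lemma Im_inv z : complex.Im (- z^-1) = complex.Im z / nm z ^+ 2.
Proof. by rewrite raddfN /=; case: z => a b; rewrite nm_sqr /=; ring. Qed.

Lemma Im_addz z (n : int) : complex.Im (z + n%:~R) = complex.Im z.
Proof. by rewrite raddfD /= -[n%:~R](rmorph_int (@real_complex R)) addr0. Qed.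

Lemma g_addz z (n : int) : 0 < complex.Im z ->
  [/\ g1 (z + n%:~R) = g1 z, g2 (z + n%:~R) = g2 z & g3 (z + n%:~R) = g3 z].
Proof.
move=> hz; have hn : 0 < complex.Im (z + n%:~R) by rewrite Im_addz.
have E : nome (z + n%:~R) = nome z by rewrite nomeD nome_int mulr1.
by have [-> -> ->] := g_W hn; rewrite E; have [-> -> ->] := g_W hz.
Qed.

Definition autj (c d : int) z : C := c%:~R * z + d%:~R.
Definition mob (a b c d : int) z : C := autj a b z / autj c d z.

Lemma Im_autj c d z : complex.Im (autj c d z) = c%:~R * complex.Im z.
Proof.
have ce (n : int) : n%:~R = (n%:~R : R)%:C%C :> C by rewrite rmorph_int.
rewrite /autj !ce raddfD /= addr0.
by case: z => x0 y0 /=; rewrite mul0r addr0.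
Qed.

Lemma autj_neq0 (a b c d : int) z : a * d - b * c = 1 -> 0 < complex.Im z -> autj c d z != 0.
Proof.
move=> det hz; apply/eqP => e; have := Im_autj c d z; rewrite e /= => /esym/eqP.
rewrite mulf_eq0 (gt_eqF hz) orbF intr_eq0 => /eqP c0.
move: e; rewrite /autj c0 mul0r add0r => /eqP; rewrite intr_eq0 => /eqP d0.
by move: det; rewrite c0 d0 !mulr0 subrr.
Qed.

(** Induction on |c|. Division a = q c + r writes the matrix as T^q S times one with rows (c, d) and
    (-r, -b'), where |r| < |c|; for c = 0 only a translation and a sign remain. *)
Theorem modular (a b c d : int) z : a * d - b * c = 1 -> 0 < complex.Im z ->
  let w := mob a b c d z in let j := autj c d z in
  [/\ complex.Im w = complex.Im z / nm j ^+ 2, g1 w = j ^+ 2 * g1 z + c%:~R * j,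
      g2 w = j ^+ 4 * g2 z & g3 w = j ^+ 6 * g3 z].
Proof.
move=> + hz; have [m] := ubnP `|c|%N; elim: m a b c d => // m IH a b c d cm det.
have j0 := autj_neq0 det hz.
have [c0|c0] := eqVneq c 0.
  move: det; rewrite c0 mulr0 subr0 => det.
  have [[a1 d1]|[a1 d1]] : (a = 1 /\ d = 1) \/ (a = -1 /\ d = -1).
    have /eqP := congr1 absz det; rewrite abszM muln_eq1 => /andP[/eqP a1 /eqP d1].
    have [a2|a2] : a = 1 \/ a = -1 by lia.
      by move: det; rewrite a2 mul1r => ->; left.
    by move: det; rewrite a2 mulN1r => <-; right; rewrite opprK.
    rewrite a1 d1 /mob /autj !mul1r !mul0r !add0r !divr1 !expr1n !mul1r nm1 expr1n divr1 addr0.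
    by rewrite Im_addz; have [-> -> ->] := g_addz b hz.
  rewrite a1 d1 /mob /autj !mul0r !add0r addr0 !mulN1r.
  have -> : (-1 : int)%:~R = -1 :> C by rewrite mulrNz.
  rewrite invrN1 mulrN1 nmN nm1 expr1n divr1.
  have -> : - (- z + b%:~R) = z + (- b)%:~R by rewrite opprD opprK mulrNz.
  rewrite Im_addz; have [-> -> ->] := g_addz (- b) hz.
  have -> : (-1 : C) ^+ 2 = 1 by ring.
  have -> : (-1 : C) ^+ 4 = 1 by ring.
  have -> : (-1 : C) ^+ 6 = 1 by ring.
  by rewrite !mul1r.
pose q := (a %/ c)%Z; pose r := (a %% c)%Z.
have aE : a = q * c + r by exact: divz_eq.
have r0 : 0 <= r by apply: modz_ge0.
have rc : r < `|c| by apply: ltz_mod.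
pose b' := b - q * d.
have det' : c * (- b') - d * (- r) = 1 by move: det; rewrite /b' aE => <-; ring.
have rm : (`|(- r)%R| < m)%N by lia.
have [w1 w2 w3 w4] := IH c d (- r) (- b') rm det'.
set w := mob c d (- r) (- b') z in w1 w2 w3 w4; set j' := autj (- r) (- b') z in w1 w2 w3 w4.
have j'0 : j' != 0 := autj_neq0 det' hz.
have hw : 0 < complex.Im w by rewrite w1 divr_gt0 // exprn_gt0 // nm_gt0.
have wE : w = autj c d z / j' by [].
have detC : c%:~R * (- b'%:~R) - d%:~R * (- r%:~R) = 1 :> C.
  by rewrite -!mulrNz -!intrM -mulrNz -intrD det'.
have E : mob a b c d z = - w^-1 + q%:~R.
  rewrite wE /mob invf_div -mulNr; apply: (mulIf j0); rewrite divfK // mulrDl divfK //.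
  rewrite /j' /autj aE; have -> : b = b' + q * d by rewrite /b' subrK.
  by rewrite !mulrNz !intrD !intrM; ring.
rewrite /= E Im_addz Im_inv; have [-> -> ->] := g_addz q (Im_S hw).
have wj : w * j' = autj c d z by rewrite wE divfK.
clearbody w.
rewrite (g1_S hw) (g2_S hw) (g3_S hw) w1 w2 w3 w4 -wj; split.
- by rewrite nmM -mulrA -invfM; congr (_ / _); rewrite exprMn mulrC.
- rewrite mulrNz; have -> : w ^+ 2 * (j' ^+ 2 * g1 z + - r%:~R * j') + w =
    (w * j') ^+ 2 * g1 z + w * (1 - r%:~R * (w * j')) by ring.
  congr (_ + _); rewrite [RHS]mulrCA; congr (_ * _).
  rewrite wj; transitivity (c%:~R * - b'%:~R - d%:~R * - r%:~R - r%:~R * autj c d z : C).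
    by rewrite detC.
  by rewrite /j' /autj !mulrNz; ring.
- by ring.
- by ring.
Qed.

(* [lam] is the automorphy factor, so [sl2 z lam z'] says that the lattices
   [Z z + Z] and [lam (Z z' + Z)] coincide. *)
Definition sl2 z (lam : C) z' := exists a b c d : int,
  [/\ a * d - b * c = 1, z' = mob a b c d z & lam = autj c d z].

Lemma sl2_sym z lam z' : 0 < complex.Im z -> sl2 z lam z' -> sl2 z' lam^-1 z.
Proof.
move=> hz [a [b [c [d [det -> ->]]]]]; exists d, (- b), (- c), a.
have j0 := autj_neq0 det hz.
have detC : a%:~R * d%:~R - b%:~R * c%:~R = 1 :> C by rewrite -!intrM -mulrNz -intrD det.
have E : autj (- c) a (mob a b c d z) = (autj c d z)^-1.
  apply: (mulIf j0); rewrite mulVf //; apply: etrans detC.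
  by rewrite {1}/autj mulrDl -mulrA divfK // /autj !mulrNz; ring.
split; [by rewrite -det; ring| |by []].
rewrite {1}/mob E invrK {1}/autj mulrDl -mulrA divfK //.
transitivity ((a%:~R * d%:~R - b%:~R * c%:~R) * z); first by rewrite detC mul1r.
by rewrite /autj !mulrNz; ring.
Qed.

Lemma sl2_trans z lam z' mu z'' : 0 < complex.Im z ->
  sl2 z lam z' -> sl2 z' mu z'' -> sl2 z (lam * mu) z''.
Proof.
move=> hz [a [b [c [d [det -> ->]]]]] [a' [b' [c' [d' [det' -> ->]]]]].
have j0 := autj_neq0 det hz.
have E e f : autj c d z * autj e f (mob a b c d z) = autj (e * a + f * c) (e * b + f * d) z.
  rewrite {2}/autj /mob; transitivity (e%:~R * autj a b z + f%:~R * autj c d z); first by field.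
  by rewrite /autj !intrD !intrM; ring.
exists (a' * a + b' * c), (a' * b + b' * d), (c' * a + d' * c), (c' * b + d' * d).
split; [|by rewrite [RHS]/mob -!E -mulf_div divff // mul1r|by rewrite E].
transitivity ((a * d - b * c) * (a' * d' - b' * c')); first by ring.
by rewrite det det'.
Qed.

Lemma sl2_T z (n : int) : sl2 z 1 (z + n%:~R).
Proof.
by exists 1, n, 0, 1; split; [ring|rewrite /mob /autj; field|rewrite /autj mul0r add0r].
Qed.

Lemma sl2_S z : 0 < complex.Im z -> sl2 z z (- z^-1).
Proof.
move=> hz; exists 0, (-1), 1, 0; split; [by []| |by rewrite /autj mul1r addr0].
by rewrite /mob /autj mul0r mul1r add0r addr0 mulrNz mulN1r.
Qed.

Lemma sl2_g z lam z' : 0 < complex.Im z -> sl2 z lam z' ->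
  [/\ lam != 0, 0 < complex.Im z', g2 z' = lam ^+ 4 * g2 z & g3 z' = lam ^+ 6 * g3 z].
Proof.
move=> hz [a [b [c [d [det -> ->]]]]]; have [h1 _ h2 h3] := modular det hz.
have j0 := autj_neq0 det hz; split=> //.
by rewrite h1 divr_gt0 // exprn_gt0 // nm_gt0.
Qed.

End Modular.

(** * Local inverses *)

Section LocalInverse.
Variable R : realType.
Local Notation C := R[i].
Local Notation hf := (2^-1 : R).

Lemma geo_half (a : R) s : 0 <= a -> uniq s -> \sum_(i <- s) a * hf ^+ i <= 2 * a.
Proof.
move=> a0 us.
have p i : 0 <= a * hf ^+ i by rewrite mulr_ge0 // exprn_ge0 // invr_ge0.
have : abs_le (fun i => (a * hf ^+ i)%:C%C) (2 * a).
  apply: abs_le_nat => N; under eq_bigr do rewrite nm_real ger0_norm //.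
  suff -> : \sum_(0 <= i < N) a * hf ^+ i = 2 * a - 2 * (a * hf ^+ N).
    by rewrite gerBl mulr_ge0.
  elim: N => [|N IH]; first by rewrite big_nil expr0 mulr1 subrr.
  by rewrite big_nat_recr //= IH exprS; field.
move=> /(_ s us); congr (_ <= _); apply: eq_bigr => i _.
by rewrite nm_real ger0_norm.
Qed.

Lemma nb_telescope n (r : R) (x : nat -> 'rV[R]_n -> C) a : 0 < r -> 0 <= a ->
  (forall h, x 0%N h = 0) ->
  (forall k, nb r (fun h => x k.+1 h - x k h) (a * hf ^+ k)) ->
  exists2 X, nb r X (2 * a) &
    forall h, box r h -> forall k, nm (X h - x k h) <= 2 * (a * hf ^+ k).
Proof.
move=> r0 a0 x0 dx.
have ab h k : box r h -> abs_le (fun j => x (k + j).+1 h - x (k + j)%N h) (2 * (a * hf ^+ k)).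
  move=> hb s us.
  have ak : 0 <= a * hf ^+ k by rewrite mulr_ge0 // exprn_ge0 // invr_ge0.
  apply: le_trans (geo_half ak us); apply: ler_sum => j _.
  by rewrite -mulrA -exprD; apply: nb_val (dx (k + j)%N) hb.
pose X h := hsum (fun j => x j.+1 h - x j h).
have hX h : box r h -> sums_to (fun j => x j.+1 h - x j h) (X h).
  by move=> /(ab h 0%N); exact: hsumP.
exists X; first by apply: (nb_family r0 dx _ hX) => s; exact: geo_half.
move=> h hb k.
have := sums_to_nm (sums_to_shift k (ab h 0%N hb) (hX h hb)) (ab h k hb).
by rewrite telescope_sumr // x0 subr0.
Qed.

(** Newton's iteration with the derivative frozen at the identity. Strict differentiability makes p
    - H(p) a contraction on the algebra, so the solution is a power series in the same variables as
    [s] and [t]. *)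
Lemma nb_inverse (H1 H2 : C -> C -> C) : sdiff H1 1 0 -> sdiff H2 0 1 ->
  H1 0 0 = 0 -> H2 0 0 = 0 -> forall e, 0 < e -> exists2 sg : R, 0 < sg &
  forall n (r : R) (s t : 'rV[R]_n -> C), 0 < r -> nb r s sg -> nb r t sg ->
  exists x y, [/\ nb r x e, nb r y e &
    forall h, box r h -> H1 (x h) (y h) = s h /\ H2 (x h) (y h) = t h].
Proof.
move=> hd1 hd2 z1 z2 e e0.
have [L1 [q1 [L10 /andP[q10 _] hp1]]] := sdiff_point hd1.
have [L2 [q2 [L20 /andP[q20 _] hp2]]] := sdiff_point hd2.
case: hd1 => K1 [r1 [K10 /andP[r10 _] h1]]; case: hd2 => K2 [r2 [K20 /andP[r20 _] h2]].
pose K := K1 + K2 + 1; have K0 : 0 < K by rewrite /K; lra.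
(* The bound through [hf / K] makes the contraction factor at most 1/2; the others keep the iterates
   inside the domains of the estimates and below [e]. *)
pose M := Num.min (Num.min (Num.min q1 q2) (Num.min r1 r2)) (Num.min e (hf / K)).
have M0 : 0 < M by rewrite !lt_min q10 q20 r10 r20 e0 !divr_gt0.
have [Mr1 Mr2 Me MK] : [/\ M <= r1, M <= r2, M <= e & M <= hf / K].
  by rewrite !ge_min !lexx ?orbT; split.
have [Mq1 Mq2] : M <= q1 /\ M <= q2 by rewrite !ge_min !lexx ?orbT; split.
have MK1 : K1 * M <= hf.
  by move: MK; rewrite ler_pdivlMr // /K; have := ltW M0; nra.
have MK2 : K2 * M <= hf.
  by move: MK; rewrite ler_pdivlMr // /K; have := ltW M0; nra.
(* The first step has norm at most M/2 and each step halves the previous bound, so all iterates have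
   norm at most M. *)
exists (M / 2) => [|n r s t p0 hs ht]; first by rewrite divr_gt0.
set a := M / 2 in hs ht *; have a0 : 0 <= a by rewrite divr_ge0 // ltW.
have aM : 2 * a = M by rewrite /a; field.
pose F (p : ('rV[R]_n -> C) * ('rV[R]_n -> C)) :=
  (fun h => p.1 h - H1 (p.1 h) (p.2 h) + s h, fun h => p.2 h - H2 (p.1 h) (p.2 h) + t h).
pose P k := iter k F (fun=> 0, fun=> 0).
pose x k := (P k).1; pose y k := (P k).2.
have xS k h : x k.+1 h = x k h - H1 (x k h) (y k h) + s h by [].
have yS k h : y k.+1 h = y k h - H2 (x k h) (y k h) + t h by [].
have x00 h : x 0%N h = 0 by [].
have y00 h : y 0%N h = 0 by [].
clearbody x y; clear P F.
have inv k : [/\ nb r (x k) (M - M * hf ^+ k), nb r (y k) (M - M * hf ^+ k),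
    nb r (fun h => x k.+1 h - x k h) (a * hf ^+ k) &
    nb r (fun h => y k.+1 h - y k h) (a * hf ^+ k)].
  elim: k => [|k [i1 i2 i3 i4]].
    have c0 := nb_cst n p0 (0 : C); rewrite nm0 in c0.
    rewrite expr0 mulr1 subrr mulr1; split.
    - by apply: nb_ext c0.
    - by apply: nb_ext c0.
    - by apply: nb_ext hs => // h _; rewrite xS x00 y00 z1; ring.
    - by apply: nb_ext ht => // h _; rewrite yS x00 y00 z2; ring.
  have ak0 : 0 <= a * hf ^+ k by rewrite mulr_ge0 // exprn_ge0 // invr_ge0.
  have E : M - M * hf ^+ k + a * hf ^+ k = M - M * hf ^+ k.+1.
    by rewrite -aM exprS; field.
  have j1 : nb r (x k.+1) (M - M * hf ^+ k.+1).
    by rewrite -E; apply: nb_ext (nb_add i1 i3) => // h _; ring.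
  have j2 : nb r (y k.+1) (M - M * hf ^+ k.+1).
    by rewrite -E; apply: nb_ext (nb_add i2 i4) => // h _; ring.
  have le k' : M - M * hf ^+ k' <= M.
    by rewrite gerBl mulr_ge0 ?ltW // exprn_gt0 // invr_gt0.
  have m1 := nb_le (le _) i1; have m2 := nb_le (le _) i2.
  have m3 := nb_le (le _) j1; have m4 := nb_le (le _) j2.
  have d1 := h1 n r _ _ _ _ M _ p0 Mr1 m3 m4 m1 m2 i3 i4.
  have d2 := h2 n r _ _ _ _ M _ p0 Mr2 m3 m4 m1 m2 i3 i4.
  have EK (K' : R) : K' * M <= hf -> K' * (a * hf ^+ k * M) <= a * hf ^+ k.+1.
    by move=> hK; rewrite mulrCA exprSr [leRHS]mulrA; apply: ler_wpM2l.
  split=> //.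
    apply: nb_ext (nb_opp d1) => [h _|]; last exact: EK.
    by rewrite !xS; ring.
  apply: nb_ext (nb_opp d2) => [h _|]; last exact: EK.
  by rewrite !yS; ring.
have [X hX lX] := nb_telescope p0 a0 x00 (fun k => let: And4 _ _ h _ := inv k in h).
have [Y hY lY] := nb_telescope p0 a0 y00 (fun k => let: And4 _ _ _ h := inv k in h).
rewrite aM in hX hY.
have dx k h : box r h -> nm (x k.+1 h - x k h) <= a * hf ^+ k.
  by move=> hb; have [_ _ i _] := inv k; exact: nb_val i hb.
have dy k h : box r h -> nm (y k.+1 h - y k h) <= a * hf ^+ k.
  by move=> hb; have [_ _ _ i] := inv k; exact: nb_val i hb.
exists X, Y; split; [exact: nb_le hX|exact: nb_le hY|].
move=> h hb.
have vx k : nm (x k h) <= M.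
  have [i _ _ _] := inv k; apply: le_trans (nb_val p0 i hb) _.
  by rewrite gerBl mulr_ge0 ?ltW // exprn_gt0 // invr_gt0.
have vy k : nm (y k h) <= M.
  have [_ i _ _] := inv k; apply: le_trans (nb_val p0 i hb) _.
  by rewrite gerBl mulr_ge0 ?ltW // exprn_gt0 // invr_gt0.
have vX := nb_val p0 hX hb; have vY := nb_val p0 hY hb.
have small (e' A : R) : 0 < e' -> 0 <= A -> exists k, A * (a * hf ^+ k) <= e'.
  move=> e'0 A0; have B0 : 0 <= A * a by rewrite mulr_ge0.
  have [k hk] : exists k, A * a / e' < 2 ^+ k.
    exists (Num.bound (A * a / e')).
    apply: lt_le_trans (archi_boundP (divr_ge0 B0 (ltW e'0))) _.
    by rewrite -natrX ler_nat ltnW // ltn_expl.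
  exists k; rewrite exprVn mulrA ler_pdivrMr ?exprn_gt0 //.
  by move: hk; rewrite ltr_pdivrMr // [ltRHS]mulrC => /ltW.
split; apply: nm_eps_eq => e' e'0.
- have [|k hk] := small e' (2 * (L1 * M) + 3) e'0.
    by rewrite addr_ge0 // !mulr_ge0 // ltW.
  apply: le_trans hk.
  have := hp1 _ _ _ _ M _ Mq1 vX vY (vx k) (vy k) (lX h hb k) (lY h hb k).
  move: (lX h hb k) (dx k h hb); rewrite xS mul1r mul0r subr0.
  move: (X h) (x k h) (s h) (a * hf ^+ k) (H1 (X h) (Y h)) (H1 (x k h) (y k h)) => U V S' d A B u1 u2 u3.
  have -> : A - S' = (A - B - (U - V)) + (U - V) - (V - B + S' - V) by ring.
  apply: le_trans (nmB _ _) _; apply: le_trans (lerD (nmD _ _) (lexx _)) _.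
  by apply: le_trans (lerD (lerD u3 u1) u2) _; rewrite le_eqVlt; apply/orP; left; apply/eqP; ring.
- have [|k hk] := small e' (2 * (L2 * M) + 3) e'0.
    by rewrite addr_ge0 // !mulr_ge0 // ltW.
  apply: le_trans hk.
  have := hp2 _ _ _ _ M _ Mq2 vX vY (vx k) (vy k) (lX h hb k) (lY h hb k).
  move: (lY h hb k) (dy k h hb); rewrite yS mul1r mul0r subr0.
  move: (Y h) (y k h) (t h) (a * hf ^+ k) (H2 (X h) (Y h)) (H2 (x k h) (y k h)) => U V S' d A B u1 u2 u3.
  have -> : A - S' = (A - B - (U - V)) + (U - V) - (V - B + S' - V) by ring.
  apply: le_trans (nmB _ _) _; apply: le_trans (lerD (nmD _ _) (lexx _)) _.
  by apply: le_trans (lerD (lerD u3 u1) u2) _; rewrite le_eqVlt; apply/orP; left; apply/eqP; ring.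
Qed.

End LocalInverse.

(** * From normally convergent series to real analyticity *)

Section Analytic.
Variable R : realType.
Local Notation C := R[i].

Lemma abs_le_summable (I : choiceType) (a : I -> C) (b : I -> R) M :
  (forall i, `|b i| <= nm (a i)) -> abs_le a M -> summable [set: I] (fun i => (b i)%:E).
Proof.
move=> ba hM; apply: (@le_lt_trans _ _ M%:E); last exact: ltry.
apply: ge_ereal_sup => /= _ [X [finX _] <-].
rewrite fsbig_finite //= sumEFin lee_fin.
apply: le_trans (hM _ (finmap.fset_uniq _)); apply: ler_sum => i _; exact: ba.
Qed.

Lemma box_sums n (a : {ffun 'I_n -> nat} -> C) l : sums_to a l -> forall e : R, 0 < e ->
  \forall N \near \oo,
    nm (\sum_(b : {ffun 'I_n -> 'I_N}) a [ffun i => nat_of_ord (b i)] - l) <= e.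
Proof.
move=> h e /h[s0 hs]; exists (\max_(a <- s0) (\max_i a i).+1)%N => //= N hN.
pose F (b : {ffun 'I_n -> 'I_N}) : {ffun 'I_n -> nat} := [ffun i => nat_of_ord (b i)].
have Fi : injective F.
  move=> b c /ffunP E; apply/ffunP => i; have := E i; rewrite !ffunE; exact: val_inj.
rewrite -(big_map F xpredT a) /=; apply: hs.
  by rewrite map_inj_uniq // index_enum_uniq.
move=> c cs; have cN i : (c i < N)%N.
  apply: leq_trans hN; apply: leq_trans (leq_bigmax_seq _ cs isT).
  by rewrite ltnS; apply: (leq_bigmax (F := fun i => c i)).
apply/mapP; exists [ffun i => Ordinal (cN i)]; first exact: mem_index_enum.
by apply/ffunP => i; rewrite !ffunE.
Qed.

(** [p] stands for a real part, an imaginary part or half of the latter. Being real-linear and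
    bounded by the norm, it may be applied to the coefficients. *)
Lemma nb_analytic n (p : C -> R) (f : 'rV[R]_n -> R) (F : 'rV[R]_n -> C) x (r : R) M :
  (forall u v, p (u + v) = p u + p v) -> (forall (c : C) (t : R), p (c * t%:C%C) = p c * t) ->
  (forall u, `|p u| <= nm u) ->
  0 < r -> nb r F M -> (forall h, box r h -> f (x + h) = p (F h)) ->
  real_analytic_at f x.
Proof.
move=> pD pZ pn r0 [c [hc hF]] fF; exists (p \o c), r; split=> // h hr.
have hb : box r h by move=> i; exact/ltW/hr.
have p0 : p 0 = 0 by have := pD 0 0; rewrite addr0; lra.
have pB u v : p (u - v) = p u - p v.
  by have := pD (u - v) v; rewrite subrK; lra.
have E a : p (c a) * \prod_(i < n) h 0 i ^+ a i = p (c a * mon h a) by rewrite pZ.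
split.
  apply: (abs_le_summable (a := fun a => c a * mon h a)) (abs_le_mon r0 hb hc) => a.
  by rewrite E.
apply/cvgrPdist_le => e e0; have := box_sums (hF h hb) e0.
apply: filterS => N; rewrite distrC fF // => hN.
apply: le_trans hN; apply: le_trans (pn _); rewrite pB.
rewrite (big_morph p pD p0).
rewrite le_eqVlt; apply/orP; left; apply/eqP; congr (`|_ - _|); apply: eq_bigr => b _.
by rewrite -E /=; congr (_ * _); apply: eq_bigr => i _; rewrite ffunE.
Qed.

End Analytic.

(** * Local inversion of (z, l) -> (g2 z l^4, g3 z l^6) *)

Section Inverse2.
Variable R : realType.
Local Notation C := R[i].
Implicit Types (F : C -> C -> C) (z l : C).

(** Composition with the inverse of the Jacobian matrix, by Cramer's rule. *)
Lemma sdiff_normalize F1 F2 a b a' b' : sdiff F1 a b -> sdiff F2 a' b' ->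
  a * b' - b * a' != 0 ->
  exists H1 H2 : C -> C -> C, [/\ sdiff H1 1 0, sdiff H2 0 1 & forall x y,
   [/\ F1 x y = F1 0 0 + a * H1 x y + b * H2 x y,
       F2 x y = F2 0 0 + a' * H1 x y + b' * H2 x y,
       (a * b' - b * a') * H1 x y = b' * (F1 x y - F1 0 0) - b * (F2 x y - F2 0 0) &
       (a * b' - b * a') * H2 x y = a * (F2 x y - F2 0 0) - a' * (F1 x y - F1 0 0)]].
Proof.
move=> h1 h2; set D := a * b' - b * a' => D0.
have k1 := sdiff_add h1 (sdiff_const (- F1 0 0)).
have k2 := sdiff_add h2 (sdiff_const (- F2 0 0)).
rewrite !addr0 in k1 k2.
exists (fun x y => (b' / D) * (F1 x y - F1 0 0) + (- b / D) * (F2 x y - F2 0 0)).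
exists (fun x y => (- a' / D) * (F1 x y - F1 0 0) + (a / D) * (F2 x y - F2 0 0)).
split.
- have := sdiff_add (sdiff_scale (b' / D) k1) (sdiff_scale (- b / D) k2).
  have -> : b' / D * a + - b / D * a' = 1.
    by rewrite -(divff D0) /D; ring.
  by have -> : b' / D * b + - b / D * b' = 0 by ring.
- have := sdiff_add (sdiff_scale (- a' / D) k1) (sdiff_scale (a / D) k2).
  have -> : - a' / D * b + a / D * b' = 1.
    by rewrite -(divff D0) /D; ring.
  by have -> : - a' / D * a + a / D * a' = 0 by ring.
- move=> x y; rewrite /D in D0 *; split; field; exact: D0.
Qed.

Lemma nb_inverse2 F1 F2 a b a' b' : sdiff F1 a b -> sdiff F2 a' b' ->
  a * b' - b * a' != 0 -> forall e, 0 < e -> exists2 sg : R, 0 < sg &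
  forall n (r : R) (s t : 'rV[R]_n -> C), 0 < r -> nb r s sg -> nb r t sg ->
  exists x y, [/\ nb r x e, nb r y e &
    forall h, box r h -> F1 (x h) (y h) = F1 0 0 + s h /\ F2 (x h) (y h) = F2 0 0 + t h].
Proof.
move=> h1 h2 D0 e e0; have [H1 [H2 [k1 k2 E]]] := sdiff_normalize h1 h2 D0.
have D1 : 0 < nm (a * b' - b * a') by rewrite nm_gt0.
have [_ _ z1 z2] := E 0 0; rewrite !subrr !mulr0 subrr in z1 z2.
have {}z1 : H1 0 0 = 0 by move/eqP: z1; rewrite mulf_eq0 (negbTE D0) => /eqP.
have {}z2 : H2 0 0 = 0 by move/eqP: z2; rewrite mulf_eq0 (negbTE D0) => /eqP.
have [sg s0 inv] := nb_inverse k1 k2 z1 z2 e0.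
pose A := (nm a + nm b + nm a' + nm b') / nm (a * b' - b * a') + 1.
have A0 : 0 < A.
  by rewrite ltr_wpDl // divr_ge0 ?nm_ge0 // !addr_ge0 ?nm_ge0.
exists (sg / A) => [|n r s t r0 hs ht]; first by rewrite divr_gt0.
have B0 : 0 <= sg / A by rewrite divr_ge0 ?ltW.
pose D := a * b' - b * a'.
have le (c d : C) : nm c + nm d <= nm a + nm b + nm a' + nm b' ->
    nm (c / D) * (sg / A) + nm (d / D) * (sg / A) <= sg.
  move=> cd; rewrite -mulrDl !nmM !nmV -mulrDl mulrA ler_pdivrMr // mulrC.
  apply: ler_wpM2l; first exact: ltW.
  rewrite /A -/D; apply: (@le_trans _ _ ((nm a + nm b + nm a' + nm b') / nm D)); last by rewrite lerDl.
  by rewrite ler_pM2r // invr_gt0.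
have [||x [y [hx hy hxy]]] := inv n r (fun h => (b' / D) * s h + (- b / D) * t h)
  (fun h => (- a' / D) * s h + (a / D) * t h) r0.
- apply: nb_le (nb_add (nb_scale (b' / D) hs) (nb_scale (- b / D) ht)); apply: le.
  by rewrite nmN; have := nm_ge0 a; have := nm_ge0 a'; lra.
- apply: nb_le (nb_add (nb_scale (- a' / D) hs) (nb_scale (a / D) ht)); apply: le.
  by rewrite nmN; have := nm_ge0 b; have := nm_ge0 b'; lra.
exists x, y; split=> // h hb; have [e1 e2 _ _] := E (x h) (y h).
have [q1 q2] := hxy h hb; rewrite e1 e2 q1 q2 /D.
by split; field.
Qed.

(** If the normalized functions agree at two points, strict differentiability gives d <= d/2 for
    their distance d. *)
Lemma sdiff_inj F1 F2 a b a' b' : sdiff F1 a b -> sdiff F2 a' b' ->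
  a * b' - b * a' != 0 -> exists2 e : R, 0 < e & forall x y x' y',
  nm x <= e -> nm y <= e -> nm x' <= e -> nm y' <= e ->
  F1 x y = F1 x' y' -> F2 x y = F2 x' y' -> x = x' /\ y = y'.
Proof.
move=> h1 h2 D0; have [H1 [H2 [k1 k2 E]]] := sdiff_normalize h1 h2 D0.
have [K1 [r1 [K10 /andP[r10 _] p1]]] := sdiff_point k1.
have [K2 [r2 [K20 /andP[r20 _] p2]]] := sdiff_point k2.
pose K := K1 + K2 + 1; have K0 : 0 < K by rewrite /K; lra.
pose M := Num.min (Num.min r1 r2) (2^-1 / K).
have M0 : 0 < M by rewrite !lt_min r10 r20 !divr_gt0.
have [Mr1 Mr2 MK] : [/\ M <= r1, M <= r2 & M <= 2^-1 / K].
  by rewrite !ge_min !lexx ?orbT; split.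
have MK1 : K1 * M <= 2^-1.
  by move: MK; rewrite ler_pdivlMr // /K; have := ltW M0; nra.
have MK2 : K2 * M <= 2^-1.
  by move: MK; rewrite ler_pdivlMr // /K; have := ltW M0; nra.
exists M => // x y x' y' hx hy hx' hy' e1 e2.
have [_ _ u1 u2] := E x y; have [_ _ v1 v2] := E x' y'.
have {u1 v1} E1 : H1 x y = H1 x' y' by apply: (mulfI D0); rewrite u1 v1 e1 e2.
have {u2 v2} E2 : H2 x y = H2 x' y' by apply: (mulfI D0); rewrite u2 v2 e1 e2.
pose d := Num.max (nm (x - x')) (nm (y - y')).
have [dx dy] : nm (x - x') <= d /\ nm (y - y') <= d by rewrite !le_max !lexx orbT.
have d0 : 0 <= d by apply: le_trans dx; exact: nm_ge0.
have := p1 _ _ _ _ M d Mr1 hx hy hx' hy' dx dy.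
have := p2 _ _ _ _ M d Mr2 hx hy hx' hy' dx dy.
rewrite E1 E2 !subrr !sub0r !mul1r !mul0r !subr0 oppr0 add0r !nmN => q2 q1.
have half (K' : R) : K' * M <= 2^-1 -> K' * (d * M) <= 2^-1 * d.
  by move=> h; rewrite mulrCA mulrC; apply: ler_wpM2r.
have dle : d <= 2^-1 * d.
  rewrite {1}/d ge_max; apply/andP; split.
    by apply: le_trans q1 _; exact: half.
  by apply: le_trans q2 _; exact: half.
have {}d0 : d = 0 by lra.
have n0 (w : C) : nm w <= d -> w = 0.
  by rewrite d0 => h; apply/eqP; rewrite -nm_eq0 eq_le h nm_ge0.
by split; apply/eqP; rewrite -subr_eq0; apply/eqP; exact: n0.
Qed.

Lemma sdiff_exp F a b k : sdiff F a b ->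
  sdiff (fun x y => F x y ^+ k.+1) (k.+1%:R * F 0 0 ^+ k * a) (k.+1%:R * F 0 0 ^+ k * b).
Proof.
move=> hF; elim: k => [|k IH].
  by rewrite expr0 !mul1r; apply: sdiff_ext hF => x y; rewrite expr1.
have := sdiff_mul hF IH; rewrite -[k.+2%:R]natr1.
move: (k.+1%:R : C) => N.
have gen (c : C) : c * F 0 0 ^+ k.+1 + F 0 0 * (N * F 0 0 ^+ k * c) =
  (N + 1) * F 0 0 ^+ k.+1 * c by rewrite exprS; ring.
by rewrite !gen; apply: sdiff_ext => x y; rewrite [RHS]exprS.
Qed.

Lemma sdiff_cdiff (f : C -> C) (z a : C) : sdiff (fun x _ => f (z + x)) a 0 -> cdiff f z a.
Proof.
move=> /sdiff_point[K [rho [K0 /andP[r0 _] h]]].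
apply: (cdiff_quad (K := K) r0) => w /ltW hw.
have := h w 0 0 0 (nm w) (nm w) hw (lexx _); rewrite !nm0 !subr0 mul0r subr0 addr0 expr2.
by apply=> //; rewrite ?nm0 nm_ge0.
Qed.

Let u : C := two_pi_i R / 12.
(* Everywhere defined power series agreeing with [g1], [g2], [g3] on the half plane. *)
Definition G1 z : C := u * (1 - 24 * qs (sg R 1) z).
Definition G2 z : C := 12 * u ^+ 2 * (1 + 240 * qs (sg R 3) z).
Definition G3 z : C := 8 * u ^+ 3 * (1 - 504 * qs (sg R 5) z).

Lemma G123 z : 0 < complex.Im z -> [/\ G1 z = g1 z, G2 z = g2 z & G3 z = g3 z].
Proof. by move=> hz; rewrite /g1 /g2 /g3 !sigma_seriesE. Qed.

Lemma sdiff_sg (f : C -> C) k (a b : C) z : 0 < complex.Im z ->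
  (forall w, f w = a + b * qs (sg R k) w) -> exists d, sdiff (fun x _ => f (z + x)) d 0.
Proof.
move=> hz hf.
have := sdiff_add (sdiff_const a) (sdiff_scale b (sdiff_qs (@qsumm_sg R k) hz)).
rewrite mulr0 !add0r => h; eexists; apply: sdiff_ext h => x _; exact/esym/hf.
Qed.

Lemma sdiff_G1 z : 0 < complex.Im z -> exists d, sdiff (fun x _ => G1 (z + x)) d 0.
Proof.
move=> hz; apply: (sdiff_sg (a := u) (b := u * - 24) hz (k := 1)) => w.
by rewrite /G1; ring.
Qed.

(** The q-series supplies a strict derivative; uniqueness of complex derivatives identifies it with
    Ramanujan's expression. *)
Lemma sdiff_G2 z : 0 < complex.Im z ->
  sdiff (fun x _ => G2 (z + x)) (4 * g1 z * g2 z - 6 * g3 z) 0.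
Proof.
move=> hz; have [|d hd] := sdiff_sg (f := G2) (a := 12 * u ^+ 2) (b := 12 * u ^+ 2 * 240) hz (k := 3).
  by move=> w; rewrite /G2; ring.
suff <- : d = 4 * g1 z * g2 z - 6 * g3 z by [].
apply: cdiff_eq hz (sdiff_cdiff hd) (cdiff_g2 hz) => w hw.
by have [_ -> _] := G123 hw.
Qed.

Lemma sdiff_G3 z : 0 < complex.Im z ->
  sdiff (fun x _ => G3 (z + x)) (6 * g1 z * g3 z - g2 z ^+ 2 / 3) 0.
Proof.
move=> hz; have [|d hd] := sdiff_sg (f := G3) (a := 8 * u ^+ 3) (b := 8 * u ^+ 3 * - 504) hz (k := 5).
  by move=> w; rewrite /G3; ring.
suff <- : d = 6 * g1 z * g3 z - g2 z ^+ 2 / 3 by [].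
apply: cdiff_eq hz (sdiff_cdiff hd) (cdiff_g3 hz) => w hw.
by have [_ _ ->] := G123 hw.
Qed.

Lemma sdiff_pair z l : 0 < complex.Im z -> l != 0 -> exists a b a' b',
  [/\ sdiff (fun x y => G2 (z + x) * (l + y) ^+ 4) a b,
      sdiff (fun x y => G3 (z + x) * (l + y) ^+ 6) a' b' & a * b' - b * a' != 0].
Proof.
move=> hz l0; have hl := sdiff_add (sdiff_const l) (@sdiff_snd R).
have h2 := sdiff_mul (sdiff_G2 hz) (sdiff_exp 3 hl).
have h3 := sdiff_mul (sdiff_G3 hz) (sdiff_exp 5 hl).
do 4!eexists; split; [exact: h2|exact: h3|].
rewrite !addr0; have [_ -> ->] := G123 hz.
have := disc_neq0 hz; rewrite /disc.
move: (g1 z) (g2 z) (g3 z) => a b c D0.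
(* The terms containing g1 cancel, leaving -(4/3) l^9 times the discriminant. *)
set X := (X in X != 0); have -> : X = (- 4 / 3) * l ^+ 9 * (27 * c ^+ 2 - b ^+ 3).
  by rewrite /X; field.
by rewrite !mulf_neq0 ?expf_neq0 ?oppr_eq0 ?pnatr_eq0 // invr_eq0 pnatr_eq0.
Qed.

Lemma Im_half z x (e : R) : e <= complex.Im z / 2 -> 0 < complex.Im z -> nm x <= e ->
  0 < complex.Im (z + x).
Proof. by move=> h1 hz h2; apply: Im_near; have := nm_ge0 x; lra. Qed.

Lemma local_inverse z l : 0 < complex.Im z -> l != 0 -> forall e, 0 < e ->
  exists2 sg : R, 0 < sg &
  forall n (r : R) (s t : 'rV[R]_n -> C), 0 < r -> nb r s sg -> nb r t sg ->
  exists x y, [/\ nb r x e, nb r y e & forall h, box r h ->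
    [/\ 0 < complex.Im (z + x h), g2 (z + x h) * (l + y h) ^+ 4 = g2 z * l ^+ 4 + s h &
        g3 (z + x h) * (l + y h) ^+ 6 = g3 z * l ^+ 6 + t h]].
Proof.
move=> hz l0 e e0; have [a [b [a' [b' [h1 h2 D0]]]]] := sdiff_pair hz l0.
pose e' := Num.min e (complex.Im z / 2).
have e'0 : 0 < e' by rewrite lt_min e0 divr_gt0.
have [ee ei] : e' <= e /\ e' <= complex.Im z / 2 by rewrite !ge_min !lexx orbT.
have [sg s0 inv] := nb_inverse2 h1 h2 D0 e'0.
exists sg => // n r s t r0 hs ht; have [x [y [hx hy hxy]]] := inv n r s t r0 hs ht.
exists x, y; split; [exact: nb_le hx|exact: nb_le hy|move=> h hb].
have im := Im_half ei hz (nb_val r0 hx hb).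
have [] := hxy h hb; rewrite !addr0.
by have [_ -> ->] := G123 hz; have [_ -> ->] := G123 im.
Qed.

Lemma local_inj z l : 0 < complex.Im z -> l != 0 -> exists2 e : R, 0 < e &
  forall x y x' y', nm x <= e -> nm y <= e -> nm x' <= e -> nm y' <= e ->
  g2 (z + x) * (l + y) ^+ 4 = g2 (z + x') * (l + y') ^+ 4 ->
  g3 (z + x) * (l + y) ^+ 6 = g3 (z + x') * (l + y') ^+ 6 -> x = x' /\ y = y'.
Proof.
move=> hz l0; have [a [b [a' [b' [h1 h2 D0]]]]] := sdiff_pair hz l0.
have [e e0 inj] := sdiff_inj h1 h2 D0.
exists (Num.min e (complex.Im z / 2)) => [|x y x' y']; first by rewrite lt_min e0 divr_gt0.
rewrite !le_min => /andP[x1 x2] /andP[y1 y2] /andP[x1' x2'] /andP[y1' y2'] E1 E2.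
have [_ i2 i3] := G123 (Im_half (lexx _) hz x2).
have [_ i2' i3'] := G123 (Im_half (lexx _) hz x2').
by apply: inj; rewrite // ?i2 ?i2' // i3 i3'.
Qed.

Lemma local_surj z l : 0 < complex.Im z -> l != 0 -> forall e, 0 < e ->
  exists2 d : R, 0 < d & forall s t, nm s <= d -> nm t <= d ->
  exists x y, [/\ nm x <= e, nm y <= e, 0 < complex.Im (z + x),
    g2 (z + x) * (l + y) ^+ 4 = g2 z * l ^+ 4 + s &
    g3 (z + x) * (l + y) ^+ 6 = g3 z * l ^+ 6 + t].
Proof.
move=> hz l0 e e0; have [d d0 inv] := local_inverse hz l0 e0.
exists d => // s t hs ht.
have c (w : C) N : nm w <= N -> nb (n := 0) 1 (fun=> w) N.
  by move=> hw; apply: nb_le hw (nb_cst 0 ltr01 w).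
have [x [y [hx hy hxy]]] := inv 0%N 1 _ _ ltr01 (c s _ hs) (c t _ ht).
have hb : box (n := 0) 1 (0 : 'rV[R]_0) by case.
have [i1 i2 i3] := hxy _ hb.
by exists (x 0), (y 0); split=> //; [exact: nb_val hx hb|exact: nb_val hy hb].
Qed.

End Inverse2.

(** * Surjectivity *)

Section Sequences.
Variable R : realType.
Local Notation C := R[i].
Implicit Types (y : nat -> C) (x : C).

Definition tends y x := forall e : R, 0 < e -> exists N, forall k, (N <= k)%N -> nm (y k - x) <= e.

Lemma tends_cst x : tends (fun=> x) x.
Proof. by move=> e e0; exists 0%N => k _; rewrite subrr nm0 ltW. Qed.

Lemma tends_sub y x (phi : nat -> nat) : (forall k, (k <= phi k)%N) -> tends y x -> tends (y \o phi) x.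
Proof.
by move=> hp h e /h[N hN]; exists N => k Nk; apply: hN; exact: leq_trans (hp k).
Qed.

Lemma tends_cdiff y x (f : C -> C) d : cdiff f x d -> tends y x -> tends (f \o y) (f x).
Proof.
move=> /cdiff_bound[r r0 h] hy e e0.
have D0 : 0 < nm d + 1 by rewrite ltr_wpDl ?nm_ge0.
have [|N hN] := hy (Num.min (r / 2) (e / (nm d + 1))).
  by rewrite lt_min !divr_gt0.
exists N => k /hN; rewrite le_min => /andP[h1 h2].
have := h (y k - x); rewrite [x + _]addrC subrK => H; apply: le_trans (H _) _.
  by apply: le_lt_trans h1 _; lra.
by rewrite mulrC -ler_pdivlMr.
Qed.

Lemma tends_add y y' x x' : tends y x -> tends y' x' -> tends (fun k => y k + y' k) (x + x').
Proof.
move=> h h' e e0; have [N hN] := h _ (divr_gt0 e0 (ltr0Sn _ 1)).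
have [N' hN'] := h' _ (divr_gt0 e0 (ltr0Sn _ 1)).
exists (maxn N N') => k; rewrite geq_max => /andP[/hN k1 /hN' k2].
have -> : y k + y' k - (x + x') = (y k - x) + (y' k - x') by ring.
by apply: le_trans (nmD _ _) _; rewrite [e]splitr lerD.
Qed.

Lemma tends_bnd y x : tends y x -> exists2 M : R, 0 < M & exists N, forall k, (N <= k)%N -> nm (y k) <= M.
Proof.
move=> /(_ 1 ltr01)[N hN]; exists (nm x + 1); first by rewrite ltr_wpDl ?nm_ge0.
exists N => k /hN h; apply: le_trans (nm_le_add _ x) _; rewrite addrC lerD //.
Qed.

Lemma tends_scale c y x : tends y x -> tends (fun k => c * y k) (c * x).
Proof.
by move=> h; apply: tends_cdiff h; exact: cdiff_scale (cdiff_id _).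
Qed.

Lemma tends_exp y x n : tends y x -> tends (fun k => y k ^+ n) (x ^+ n).
Proof. exact: (tends_cdiff (cdiff_X x n)). Qed.

Lemma tends_mul y y' x x' : tends y x -> tends y' x' -> tends (fun k => y k * y' k) (x * x').
Proof.
move=> h h'.
(* Polarization reduces products to squares, which are functions of one variable. *)
have gen (a b : C) : a * b = 2^-1 * ((a + b) ^+ 2 + -1 * (a ^+ 2 + b ^+ 2)) by field.
rewrite gen.
have -> : (fun k => y k * y' k) =
   (fun k => 2^-1 * ((y k + y' k) ^+ 2 + -1 * (y k ^+ 2 + y' k ^+ 2))).
  by apply/funext => k; exact: gen.
apply/tends_scale/tends_add; first exact/tends_exp/tends_add.
by apply/tends_scale/tends_add; exact: tends_exp.
Qed.

Lemma tends_inv y x : x != 0 -> tends y x -> tends (fun k => (y k)^-1) x^-1.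
Proof. by move=> x0; exact: tends_cdiff (cdiff_inv x0). Qed.

Lemma tends_unique y x x' : tends y x -> tends y x' -> x = x'.
Proof.
move=> h h'; apply: nm_eps_eq => e e0.
have [N hN] := h _ (divr_gt0 e0 (ltr0Sn _ 1)).
have [N' hN'] := h' _ (divr_gt0 e0 (ltr0Sn _ 1)).
have k1 := hN _ (leq_maxl N N'); have k2 := hN' _ (leq_maxr N N').
set k := maxn N N' in k1 k2.
have -> : x - x' = (y k - x') - (y k - x) by ring.
by apply: le_trans (nmB _ _) _; rewrite [e]splitr lerD.
Qed.

Lemma tends_limit_le y x (p : C -> R) (B : R) : (forall u v, p u - p v <= nm (u - v)) ->
  tends y x -> (forall k, p (y k) <= B) -> p x <= B.
Proof.
move=> hp h hB; apply/ler_addgt0Pl => e /h[N hN].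
have := hp x (y N); have := hB N; have := hN N (leqnn _); rewrite nmBC; lra.
Qed.

Lemma eps_small (e : R) : 0 < e -> exists N, forall k, (N <= k)%N -> k.+1%:R^-1 <= e.
Proof.
move=> e0; exists (Num.bound e^-1) => k hk.
rewrite invf_ple ?posrE //; apply/ltW; apply: lt_le_trans (archi_boundP _) _.
  by rewrite invr_ge0 ltW.
by rewrite ler_nat ltnW.
Qed.

Lemma tends_eps y x : (forall k, nm (y k - x) <= k.+1%:R^-1) -> tends y x.
Proof.
move=> h e /eps_small[N hN]; exists N => k /hN; exact: le_trans (h k).
Qed.

Lemma bolzano_weierstrass_real (y : nat -> R) M : (forall k, `|y k| <= M) -> exists (x : R) (phi : nat -> nat),
  forall k, (k <= phi k)%N /\ `|y (phi k) - x| <= k.+1%:R^-1.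
Proof.
move=> yM.
have [x [_ hx]] : (`[- M, M] `&` cluster (y @ \oo)) !=set0.
  apply: (segment_compact (a := - M) (b := M)).
  by exists 0%N => // k _ /=; rewrite in_itv /= -ler_norml.
have hk k : exists j, (k <= j)%N /\ `|y j - x| <= k.+1%:R^-1.
  have [||z [[j kj <-] hj]] := hx (y @` [set j | (k <= j)%N]) (ball x (k.+1%:R^-1)).
  - by exists k => // j kj; exists j.
  - by apply: nbhsx_ballx; rewrite invr_gt0.
  exists j; split=> //; move: hj; rewrite /ball /= distrC => /ltW //.
exists x, (fun k => projT1 (cid (hk k))) => k; by case: cid.
Qed.

Lemma bolzano_weierstrass y M : (forall k, nm (y k) <= M) -> exists x (phi : nat -> nat),
  (forall k, (k <= phi k)%N) /\ tends (y \o phi) x.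
Proof.
move=> yM.
have [|a [p hp]] := @bolzano_weierstrass_real (fun k => complex.Re (y k)) M.
  by move=> k; apply: le_trans (nm_Re _) _.
have [|b [q hq]] := @bolzano_weierstrass_real (fun k => complex.Im (y (p k))) M.
  by move=> k; apply: le_trans (nm_Im _) _.
exists (Complex a b), (p \o q); split=> [k|].
  by apply: leq_trans (proj1 (hq k)) _; exact: (proj1 (hp _)).
move=> e e0; have e2 : 0 < e / 2 by rewrite divr_gt0.
have [N hN] := eps_small e2; exists N => k /hN ke.
have h1 := proj2 (hp (q k)); have [kq h2] := hq k.
have h3 : (q k).+1%:R^-1 <= k.+1%:R^-1 :> R by rewrite lef_pV2 ?posrE // ler_nat.
apply: le_trans (nm_le_ReIm _) _; rewrite [e]splitr !raddfB /=; apply: lerD.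
  exact: le_trans h1 (le_trans h3 ke).
exact: le_trans h2 ke.
Qed.

(* The product of the distances from [x] to the roots of [X^(n+1) - a] is
   [|a - x^(n+1)|]. *)
Lemma root_near n x (a : C) : exists x', x' ^+ n.+1 = a /\ nm (x' - x) ^+ n.+1 <= nm (a - x ^+ n.+1).
Proof.
pose p : {poly C} := 'X^(n.+1) - a%:P.
have [s sE] := closed_field_poly_normal p.
have mon : p \is monic by rewrite monicXnsubC.
rewrite (monicP mon) scale1r in sE.
have ss : size s = n.+1.
  by have := size_XnsubC a (ltn0Sn n); rewrite -/p sE size_prod_XsubC => -[].
have root z : z \in s -> z ^+ n.+1 = a.
  move=> zs; have : root p z by rewrite sE root_prod_XsubC.
  by rewrite rootE !hornerE subr_eq0 => /eqP.
pose B := nm (a - x ^+ n.+1); have B0 : 0 <= B := nm_ge0 _.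
have E : \prod_(z <- s) nm (z - x) = B.
  have := congr1 (fun p => nm p.[x]) sE; rewrite horner_prod nm_prod !hornerE nmBC -/B => ->.
  by apply: eq_bigr => z _; rewrite !hornerE nmBC.
have P t : (forall z, z \in t -> B < nm (z - x) ^+ n.+1) ->
    B ^+ size t <= \prod_(z <- t) nm (z - x) ^+ n.+1 /\ 0 < \prod_(z <- t) nm (z - x) ^+ n.+1.
  elim: t => [|z t IH] h; first by rewrite big_nil expr0.
  have [|i1 i2] := IH; first by move=> w wt; apply: h; rewrite inE wt orbT.
  have hz := h z (mem_head _ _); rewrite big_cons /= exprS.
  have z0 := le_lt_trans B0 hz; split; last exact: mulr_gt0.
  by apply: ler_pM => //; [exact: exprn_ge0|exact: ltW].
have [[z zs hz]|no] := pselect (exists2 z, z \in s & nm (z - x) ^+ n.+1 <= B).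
  by exists z; split; [exact: root|].
have lt z : z \in s -> B < nm (z - x) ^+ n.+1.
  by move=> zs; rewrite ltNge; apply/negP => h; apply: no; exists z.
case: s ss lt E {sE root no} => // z t [st] lt E.
have [|i1 i2] := P t; first by move=> w wt; apply: lt; rewrite inE wt orbT.
have hz := lt z (mem_head _ _).
have : B ^+ n.+1 < \prod_(w <- z :: t) nm (w - x) ^+ n.+1.
  rewrite big_cons exprS; apply: (@le_lt_trans _ _ (B * \prod_(w <- t) nm (w - x) ^+ n.+1)).
    by move: i1; rewrite st; exact: ler_wpM2l.
  by rewrite ltr_pM2r.
by rewrite prodrXl E ltxx.
Qed.

End Sequences.

(** * The fundamental domain and the function J *)

Section Domain.
Variable R : realType.
Local Notation C := R[i].
Implicit Types z l : C.

(* Contains the closure of the standard fundamental domain. *)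
Definition wfd z := `|complex.Re z| <= 2^-1 /\ 2^-1 <= complex.Im z.

Lemma wfd_gt0 z : wfd z -> 0 < complex.Im z.
Proof. by case=> _; apply: lt_le_trans; rewrite invr_gt0. Qed.

Lemma Re_addz z (n : int) : complex.Re (z + n%:~R) = complex.Re z + n%:~R.
Proof. by rewrite raddfD /= -[n%:~R in LHS](rmorph_int (@real_complex R)). Qed.

(** After translation to |Re w| <= 1/2, either Im w >= 1/2 or |w|^2 <= 1/2, in which case the
    inversion at least doubles the imaginary part; [n] counts the doublings that suffice. *)
Lemma reduce z : 0 < complex.Im z -> exists lam z', sl2 z lam z' /\ wfd z'.
Proof.
move=> hz; have [n hn] : exists n, 2^-1 <= complex.Im z * 2 ^+ n.
  exists (Num.bound (complex.Im z)^-1); rewrite mulrC -ler_pdivrMr //.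
  have h := archi_boundP (ltW (_ : 0 < (complex.Im z)^-1)); rewrite invr_gt0 in h.
  apply: (@le_trans _ _ (Num.bound (complex.Im z)^-1)%:R).
    apply: le_trans (ltW (h hz)); rewrite ler_piMl ?invr_ge0 ?(ltW hz) //.
    by rewrite invf_le1 // ler1n.
  by rewrite -natrX ler_nat ltnW // ltn_expl.
elim: n z hz hn => [|n IH] z hz hn; pose m := - Num.floor (complex.Re z + 2^-1);
  pose w := z + m%:~R.
all: have wR : `|complex.Re w| <= 2^-1 by
  rewrite /w Re_addz /m mulrNz ler_norml; have := floor_itv (complex.Re z + 2^-1);
  rewrite intrD => /andP[h1 h2]; apply/andP; split; lra.
all: have wI : complex.Im w = complex.Im z by exact: Im_addz.
  exists 1, w; split; first exact: sl2_T.
  by split=> //; rewrite wI; move: hn; rewrite expr0 mulr1.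
have [i1|i1] := leP 2^-1 (complex.Im w).
  by exists 1, w; split; [exact: sl2_T|].
have hw : 0 < complex.Im w by rewrite wI.
have nw : nm w ^+ 2 <= 2^-1.
  rewrite nm_sqr; move: wR; rewrite ler_norml => /andP[].
  by move: (complex.Im w) (complex.Re w) hw i1 => b a b0 b1 a0 a1; nra.
have nw0 : 0 < nm w ^+ 2 by rewrite exprn_gt0 // nm_gt0 Im_neq0.
have [||lam [z' [h1 h2]]] := IH (- w^-1); first exact: Im_S.
  rewrite Im_inv; apply: le_trans hn _; rewrite -wI exprS mulrA ler_pM2r ?exprn_gt0 //.
  by rewrite ler_pdivlMr // mulrAC -[leRHS]mulr1 -mulrA ler_pM2l //; lra.
exists (1 * (w * lam)), z'; split=> //.
exact: sl2_trans hz (sl2_T z m) (sl2_trans hw (sl2_S hw) h1).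
Qed.

(** In terms of the classical invariant this is -j/1728: it equals 0 where g2 vanishes and -1 where
    g3 vanishes. *)
Definition J z := g2 z ^+ 3 / disc z.

Lemma cdiff_J z : 0 < complex.Im z -> exists d, cdiff J z d.
Proof.
move=> hz; eexists; apply: cdiff_mul.
  exact: cdiff_comp (cdiff_g2 hz) (cdiff_X _ 3).
exact: cdiff_comp (cdiff_disc hz) (cdiff_inv (disc_neq0 hz)).
Qed.

Lemma tends_J y z : 0 < complex.Im z -> tends y z -> tends (J \o y) (J z).
Proof. by move=> /cdiff_J[d]; exact: tends_cdiff. Qed.

Lemma disc_scale z w l : g2 w = l ^+ 4 * g2 z -> g3 w = l ^+ 6 * g3 z ->
  disc w = l ^+ 12 * disc z.
Proof. by rewrite /disc => -> ->; move: (g2 z) (g3 z) => a b; ring. Qed.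

Lemma J_scale z w l : l != 0 -> g2 w = l ^+ 4 * g2 z -> g3 w = l ^+ 6 * g3 z -> J w = J z.
Proof.
move=> l0 e2 e3; rewrite /J (disc_scale e2 e3) e2 exprMn -exprM -mulf_div divff ?mul1r //.
exact: expf_neq0.
Qed.

Lemma J_sl2 z lam z' : 0 < complex.Im z -> sl2 z lam z' -> J z' = J z.
Proof. by move=> hz /(sl2_g hz)[l0 _]; exact: J_scale. Qed.

Lemma J_ee z : 0 < complex.Im z -> J z = e4 (nome z) ^+ 3 / ee (nome z) /\ ee (nome z) != 0.
Proof.
move=> hz; rewrite /J; have := disc_neq0 hz; rewrite (disc_ee hz) (g2_e4 hz).
set q := nome z; have := u_neq0 R; move: (two_pi_i R / 12) (e4 q) (ee q) => u a b u0 D0.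
have b0 : b != 0 by move: D0; rewrite mulf_eq0 negb_or => /andP[].
split=> //; field; rewrite b0 u0 /=; by rewrite ?pnatr_eq0.
Qed.

Lemma J_cusp (M rho : R) : 0 < rho -> exists2 Y : R, 0 < Y & forall z, Y <= complex.Im z ->
  M < nm (J z) /\ nm (nome z) <= rho.
Proof.
move=> rho0.
have c1 : cdiff (fun q : C => e4 q ^+ 3) 0 720.
  by apply: (sdiff_cdiff (f := fun q => e4 q ^+ 3)); apply: sdiff_ext (sdiff_e43 R) => x _; rewrite add0r.
have c2 : cdiff (@ee R) 0 (-1728).
  by apply: (sdiff_cdiff (f := @ee R)); apply: sdiff_ext (sdiff_ee R) => x _; rewrite add0r.
have [r1 r10 b1] := cdiff_bound c1; have [r2 r20 b2] := cdiff_bound c2.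
rewrite e4_0 expr1n ee_0 in b1 b2.
set A := nm 720 + 1 in b1; set B := nm (-1728) + 1 in b2.
have A0 : 0 < A by rewrite ltr_wpDl ?nm_ge0.
have B0 : 0 < B by rewrite ltr_wpDl ?nm_ge0.
clearbody A B; clear c1 c2.
(* From |E4^3| >= 1 - A |q| and |ee| <= B |q|, the bound |q| D <= 1/2 forces M |ee| < |E4^3|. *)
pose D := A + (`|M| + 1) * B.
have D0 : 0 < D by rewrite ltr_wpDr // mulr_ge0 ?ltW // addr_gt0.
pose e := Num.min (Num.min (r1 / 2) (r2 / 2)) (Num.min rho (2^-1 / D)).
have e0 : 0 < e by rewrite !lt_min rho0 !divr_gt0.
have [s s0 hs] := expR_small e0.
exists (s + 1) => [|z hz]; first by rewrite ltr_wpDl.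
have iz : 0 < complex.Im z by lra.
have qe : nm (nome z) <= e by rewrite nm_nome; apply: hs; lra.
move: (qe); rewrite !le_min => /andP[/andP[q1 q2] /andP[q3 q4]]; split=> //.
have [-> ee0] := J_ee iz; have n0 : 0 < nm (ee (nome z)) by rewrite nm_gt0.
have := b1 (nome z); have := b2 (nome z); rewrite !add0r subr0.
move: (nome z) q1 q2 q4 ee0 n0 => q q1 q2 q4 ee0 n0 k2 k1.
have hf (r : R) : 0 < r -> nm q <= r / 2 -> nm q < r by move=> r0 /le_lt_trans; apply; rewrite ltr_pdivrMr // ltr_pMr // ltr1n.
have {}k2 := k2 (hf _ r20 q2); have {}k1 := k1 (hf _ r10 q1).
rewrite nmM nmV ltr_pdivlMr //.
have h1 : 1 <= A * nm q + nm (e4 q ^+ 3).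
  have := nm_le_add 1 (e4 q ^+ 3); rewrite nm1 nmBC => H; apply: le_trans H _.
  by rewrite lerD2r; exact: k1.
move: q4; rewrite ler_pdivlMr // => q4.
have h2 : M * nm (ee q) <= (`|M| + 1) * (B * nm q).
  apply: (@le_trans _ _ ((`|M| + 1) * nm (ee q))).
    by apply: ler_wpM2r; [exact: nm_ge0|apply: le_trans (ler_norm M) _; rewrite lerDl].
  by apply: ler_wpM2l => //; have := normr_ge0 M; lra.
apply: le_lt_trans h2 _; move: q4; rewrite /D mulrDr mulrCA [nm q * B]mulrC.
move: (nm q) (nm (e4 q ^+ 3)) h1 => a b h1 h2; apply: lt_le_trans (_ : 1 - A * a <= b); last by rewrite lerBlDl.
  by rewrite ltrBrDl; rewrite [A * a]mulrC; apply: le_lt_trans h2 _; rewrite invf_lt1 // ltr1n.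
Qed.

Lemma wfd_compact (Y : R) (y : nat -> C) : (forall k, wfd (y k)) ->
  (forall k, complex.Im (y k) <= Y) ->
  exists z (phi : nat -> nat), [/\ wfd z, forall k, (k <= phi k)%N & tends (y \o phi) z].
Proof.
move=> hF hY; have [|z [phi [hp hc]]] := @bolzano_weierstrass _ y (2^-1 + Y).
  move=> k; apply: le_trans (nm_le_ReIm _) _; apply: lerD; first by case: (hF k).
  by rewrite gtr0_norm ?hY //; exact: wfd_gt0.
exists z, phi; split=> //.
have L (p : C -> R) B : (forall u v, p u - p v <= nm (u - v)) ->
    (forall k, p (y k) <= B) -> p z <= B.
  by move=> hp' hB; apply: (tends_limit_le hp' hc) => k; exact: hB.
split.
  rewrite ler_norml; apply/andP; split.
    rewrite lerNl; apply: (L (fun z => - complex.Re z)) => [u v|k].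
      by apply: le_trans (nm_Re _); rewrite raddfB /= -opprD; apply: le_trans (ler_norm _) _; rewrite normrN.
    by rewrite lerNl; case: (hF k); rewrite ler_norml => /andP[].
  apply: (L (@complex.Re R)) => [u v|k].
    by apply: le_trans (nm_Re _); rewrite raddfB /= ler_norm.
  by case: (hF k); rewrite ler_norml => /andP[].
rewrite -lerN2; apply: (L (fun z => - complex.Im z)) => [u v|k].
  by apply: le_trans (nm_Im _); rewrite raddfB /= -opprD; apply: le_trans (ler_norm _) _; rewrite normrN.
by rewrite lerN2; case: (hF k).
Qed.

Lemma J_compact (M : R) (y : nat -> C) : (forall k, wfd (y k)) -> (forall k, nm (J (y k)) <= M) ->
  exists z (phi : nat -> nat), [/\ wfd z, forall k, (k <= phi k)%N & tends (y \o phi) z].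
Proof.
move=> hF hM; have [Y Y0 hY] := J_cusp M (@ltr01 R).
apply: (@wfd_compact Y) => // k.
rewrite leNgt; apply/negP => /ltW /hY[+ _]; rewrite ltNge => /negP; apply; exact: hM.
Qed.

(** The denominator D is kept fixed, and a', b' are taken to be a cube root and a square root close
    to a and b. This also covers a = 0 and b = 0, where the quotient is ramified in a or in b. *)
Lemma J_open (a b : C) (e : R) : 0 < e -> 27 * b ^+ 2 - a ^+ 3 != 0 ->
  exists2 d : R, 0 < d & forall j, nm (j - a ^+ 3 / (27 * b ^+ 2 - a ^+ 3)) <= d ->
  exists a' b', [/\ nm (a' - a) <= e, nm (b' - b) <= e,
    27 * b' ^+ 2 - a' ^+ 3 != 0 & a' ^+ 3 / (27 * b' ^+ 2 - a' ^+ 3) = j].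
Proof.
move=> e0; set D := _ - _ => D0.
have Dp : 0 < nm D by rewrite nm_gt0.
exists (Num.min (e ^+ 3) (e ^+ 2) / nm D) => [|j hj].
  by rewrite divr_gt0 // lt_min !exprn_gt0.
have hj' : nm (j * D - a ^+ 3) <= Num.min (e ^+ 3) (e ^+ 2).
  have -> : j * D - a ^+ 3 = (j - a ^+ 3 / D) * D by field.
  by rewrite nmM -ler_pdivlMr.
have [a' [a1 a2]] := root_near 2 a (j * D).
have [b' [b1 b2]] := root_near 1 b ((j * D + D) / 27).
have e27 : nm ((j * D + D) / 27 - b ^+ 2) <= nm (j * D - a ^+ 3).
  have -> : (j * D + D) / 27 - b ^+ 2 = (j * D - a ^+ 3) / 27 by rewrite /D; field.
  by rewrite nmM nmV nm_nat ler_piMr ?nm_ge0 // invf_le1 // ler1n.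
have D' : 27 * b' ^+ 2 - a' ^+ 3 = D by rewrite a1 b1; field.
have P n (w : C) : nm w ^+ n.+1 <= e ^+ n.+1 -> nm w <= e.
  by rewrite ler_pXn2r ?nnegrE ?nm_ge0 // ltW.
exists a', b'; split.
- apply: (P 2%N); apply: le_trans a2 _; apply: le_trans hj' _; by rewrite ge_min lexx.
- apply: (P 1%N); apply: le_trans b2 _; apply: le_trans e27 _; apply: le_trans hj' _.
  by rewrite ge_min lexx orbT.
- by rewrite D'.
- by rewrite D' a1 mulfK.
Qed.

Lemma J_pair z l : 0 < complex.Im z -> l != 0 ->
  27 * (g3 z * l ^+ 6) ^+ 2 - (g2 z * l ^+ 4) ^+ 3 = disc z * l ^+ 12 /\
  (g2 z * l ^+ 4) ^+ 3 / (disc z * l ^+ 12) = J z.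
Proof.
move=> hz l0; rewrite /J; have := disc_neq0 hz; rewrite /disc.
move: (g2 z) (g3 z) => a b D0.
have E : 27 * (b * l ^+ 6) ^+ 2 - (a * l ^+ 4) ^+ 3 = (27 * b ^+ 2 - a ^+ 3) * l ^+ 12 by ring.
split=> //; rewrite exprMn -exprM -mulf_div divff ?mulr1 //; exact: expf_neq0.
Qed.

Lemma J_perturb z l : 0 < complex.Im z -> l != 0 -> forall e, 0 < e ->
  exists2 d : R, 0 < d & forall a b, nm (a - g2 z * l ^+ 4) <= d ->
    nm (b - g3 z * l ^+ 6) <= d -> 27 * b ^+ 2 - a ^+ 3 != 0 ->
  exists z' l', [/\ nm (z' - z) <= e, nm (l' - l) <= e, 0 < complex.Im z' &
    [/\ l' != 0, g2 z' * l' ^+ 4 = a, g3 z' * l' ^+ 6 = b &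
        J z' = a ^+ 3 / (27 * b ^+ 2 - a ^+ 3)]].
Proof.
move=> hz l0 e e0; have [d d0 hd] := local_surj hz l0 e0.
exists d => // a b ha hb D0; have [x [w [hx hw iz]]] := hd _ _ ha hb.
have gen (c c' : C) : c + (c' - c) = c' by rewrite addrC subrK.
rewrite !gen => e1 e2; have w0 : l + w != 0.
  apply: contraNneq D0 => w0; rewrite -e1 -e2 w0 !expr0n /= !mulr0 !expr0n /= mulr0 subr0.
  by [].
have [E1 E2] := J_pair iz w0; rewrite e1 e2 in E1 E2.
exists (z + x), (l + w); rewrite ![_ + _ - _]addrAC !subrr !add0r; split=> //.
by split=> //; rewrite E1.
Qed.

Lemma J_surj j : exists2 z, 0 < complex.Im z & J z = j.
Proof.
pose S := [set m : R | exists2 z, 0 < complex.Im z & m = nm (J z - j)].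
have hI : has_inf S.
  split; last by exists 0 => _ [z _ ->]; exact: nm_ge0.
  by exists (nm (J (iC 1) - j)), (iC 1) => //; exact: ltr01.
have hy k : exists z, wfd z /\ nm (J z - j) <= inf S + k.+1%:R^-1.
  have [|_ [z hz ->] h] := @inf_adherent R S (k.+1%:R^-1) _ hI; first by rewrite invr_gt0.
  have [lam [z' [zz hF]]] := reduce hz; exists z'; split; first exact: hF.
  by rewrite (J_sl2 hz zz); exact: ltW.
pose y k := projT1 (cid (hy k)).
have y1 k : wfd (y k) by rewrite /y; case: cid => ? [].
have y2 k : nm (J (y k) - j) <= inf S + k.+1%:R^-1 by rewrite /y; case: cid => ? [].
have [|z [phi [zF hp hc]]] := @J_compact (inf S + 1 + nm j) y y1.
  move=> k; apply: le_trans (nm_le_add _ j) _; rewrite lerD2r; apply: le_trans (y2 k) _.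
  by rewrite lerD2l invf_le1 // ler1n.
have hz := wfd_gt0 zF; have z0 := hz.
have m0 : nm (J z - j) <= inf S.
  apply/ler_addgt0Pl => e e0.
  have [N hN] := tends_J hz hc (divr_gt0 e0 (ltr0Sn _ 1)).
  have [N' hN'] := eps_small (divr_gt0 e0 (ltr0Sn _ 1)).
  have k1 := hN _ (leq_maxl N N'); set k := maxn N N' in k1.
  have k2 := hN' _ (leq_trans (leq_maxr N N') (hp k)).
  rewrite nmBC /= in k1; have := y2 (phi k) => k3.
  move: (J z) (J (y (phi k))) (inf S) ((phi k).+1%:R^-1) k1 k2 k3 => A B m t k1 k2 k3.
  have -> : A - j = (A - B) + (B - j) by ring.
  by apply: le_trans (nmD _ _) _; lra.
exists z => //; apply/eqP; rewrite -subr_eq0 -nm_eq0; apply: contraT => ne.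
have mp : 0 < nm (J z - j) by rewrite lt_def ne nm_ge0.
have [d d0 hd] := J_perturb hz (oner_neq0 _) (@ltr01 R).
have [E1 E2] := J_pair hz (oner_neq0 _).
have D0 : disc z * 1 ^+ 12 != 0 by rewrite expr1n mulr1 disc_neq0.
rewrite -E1 in D0 E2.
have [d' d'0 hd'] := J_open d0 D0; rewrite E2 in hd'.
(* Moving the value a fraction t of the way towards j multiplies the distance by 1 - t, against
   minimality. *)
pose t := Num.min 1 (d' / nm (J z - j)).
have t0 : 0 < t by rewrite lt_min ltr01 divr_gt0.
have [t1 t2] : t <= 1 /\ t <= d' / nm (J z - j) by rewrite !ge_min !lexx orbT.
have [|a' [b' [ha hb Dn Jn]]] := hd' (J z - t%:C%C * (J z - j)).
  rewrite addrAC subrr add0r nmN nmM nm_real gtr0_norm //.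
  by rewrite -ler_pdivlMr.
have [z' [_ [_ _ hz' [_ _ _ Jz']]]] := hd _ _ ha hb Dn.
have : inf S <= nm (J z' - j).
  apply: ge_inf; first by case: hI.
  by exists z'.
rewrite Jz' Jn; have -> : J z - t%:C%C * (J z - j) - j = (1 - t)%:C%C * (J z - j).
  have -> : (1 - t)%:C%C = 1 - t%:C%C by rewrite rmorphB rmorph1.
  by move: (J z) (t%:C%C) => A B; ring.
rewrite nmM nm_real ger0_norm ?subr_ge0 // => h.
have := le_trans m0 h; rewrite ler_pMl // lerBrDr => h'.
by move: t0; rewrite -(ltrDl 1) ltNge h'.
Qed.

(** Once J is matched, a scaling remains. If g2 z = 0, a sixth root settles g3. Otherwise a fourth
    root settles g2, hence g3 up to sign; replacing l by i l keeps l^4 and changes the sign of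
    l^6. *)
Lemma g_surj (a b : C) : 27 * b ^+ 2 - a ^+ 3 != 0 ->
  exists z l, [/\ 0 < complex.Im z, l != 0, g2 z * l ^+ 4 = a & g3 z * l ^+ 6 = b].
Proof.
set D := _ - _ => D0; have [z hz Jz] := J_surj (a ^+ 3 / D).
have d0 := disc_neq0 hz.
have E : g2 z ^+ 3 * D = a ^+ 3 * disc z.
  have gen (x y d : C) : d != 0 -> x / d = y / D -> x * D = y * d.
    by move=> h /eqP; rewrite eqr_div // => /eqP.
  exact: gen d0 Jz.
have [z2|z2] := eqVneq (g2 z) 0.
  have a0 : a = 0.
    move/eqP: E; rewrite z2 expr0n mul0r eq_sym mulf_eq0 (negbTE d0) orbF expf_eq0 /=.
    by move/eqP.
  have z3 : g3 z != 0.
    apply: contraNneq d0 => z3; rewrite /disc z2 z3 !expr0n /= mulr0 subr0 //.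
  have b0 : b != 0.
    by apply: contraNneq D0 => b0; rewrite /D a0 b0 !expr0n /= mulr0 subr0.
  have [l [hl _]] := root_near 5 0 (b / g3 z).
  exists z, l; split=> //; last by rewrite hl mulrC divfK.
    by apply: contraNneq b0 => l0; move/eqP: hl; rewrite l0 expr0n /= eq_sym mulf_eq0 invr_eq0 (negbTE z3) orbF.
  by rewrite z2 mul0r a0.
have a0 : a != 0.
  apply: contraNneq z2 => a0; move/eqP: E; rewrite a0 expr0n mul0r mulf_eq0 (negbTE D0) orbF.
  by rewrite expf_eq0.
have [l [hl _]] := root_near 3 0 (a / g2 z).
have l0 : l != 0.
  by apply: contraNneq a0 => l0; move/eqP: hl; rewrite l0 expr0n /= eq_sym mulf_eq0 invr_eq0 (negbTE z2) orbF.
have e2 : g2 z * l ^+ 4 = a by rewrite hl mulrC divfK.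
have e3 : (g3 z * l ^+ 6) ^+ 2 = b ^+ 2.
  have [E1 _] := J_pair hz l0; rewrite e2 in E1.
  have : disc z * l ^+ 12 = D.
    apply: (@mulfI _ (g2 z ^+ 3)); first exact: expf_neq0.
    rewrite E -e2; move: (disc z) (g2 z) => x y; ring.
  rewrite -E1 /D => /addIr /(mulfI _); apply; by rewrite pnatr_eq0.
move/eqP: e3; rewrite eqf_sqr => /orP[/eqP e3|/eqP e3]; first by exists z, l.
have i2 : (iC 1) ^+ 2 = -1 :> C by rewrite expr2 /iC; simpc.
exists z, (iC 1 * l); split=> //.
- by rewrite mulf_neq0 // -nm_eq0 nm_i oner_eq0.
- by rewrite exprMn (exprM _ 2 2) i2 sqrrN expr1n mul1r.
- by rewrite exprMn (exprM _ 2 3) i2 -signr_odd expr1 mulN1r mulrN e3 opprK.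
Qed.

End Domain.

(** * Injectivity *)

Section Injectivity.
Variable R : realType.
Local Notation C := R[i].
Implicit Types (z l lam : C) (y : nat -> C).

Lemma tends_subseq y x (phi : nat -> nat) : (forall k, (k <= phi k)%N) -> tends y x ->
  tends (fun k => y (phi k)) x.
Proof. exact: tends_sub. Qed.

Lemma tends_ext y y' x : (forall k, y k = y' k) -> tends y x -> tends y' x.
Proof. by move=> h; have -> : y' = y by apply/funext. Qed.

Lemma tends_real (p : C -> R) y x : (forall u v, p (u - v) = p u - p v) ->
  (forall u, `|p u| <= nm u) -> tends y x -> tends (fun k => (p (y k))%:C%C) (p x)%:C%C.
Proof.
move=> pB pn h e /h[N hN]; exists N => k /hN; apply: le_trans.
by rewrite -rmorphB nm_real -pB.
Qed.

Lemma tends_int (n : nat -> int) x : tends (fun k => (n k)%:~R : C) x ->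
  exists (m : int) N, x = m%:~R /\ forall k, (N <= k)%N -> n k = m.
Proof.
move=> h; have [|N hN] := h (4^-1); first by rewrite invr_gt0.
have hn k : (N <= k)%N -> n k = n N.
  move=> Nk; have h1 := hN k Nk; have h2 := hN N (leqnn N).
  have : nm ((n k - n N)%:~R : C) < 1.
    rewrite intrB; apply: le_lt_trans (nm_tri _ x _) _.
    by rewrite [nm (x - _)]nmBC; lra.
  rewrite -(rmorph_int (@real_complex R)) nm_real -intr_norm -[1]/(1%:~R) ltr_int => h3.
  by lia.
exists (n N), N; split=> //; apply: tends_unique h _.
by move=> e e0; exists N => k /hn ->; rewrite subrr nm0 ltW.
Qed.

(** The lower row is recovered continuously, c being Im (c z + d)/Im z, and the upper row likewise
    from lam z' = a z + b. Convergent sequences of integers are eventually constant, so a single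
    matrix serves in the limit. *)
Lemma sl2_closed (y w l : nat -> C) z z' lam : 0 < complex.Im z ->
  (forall k, 0 < complex.Im (y k)) -> (forall k, sl2 (y k) (l k) (w k)) ->
  tends y z -> tends w z' -> tends l lam -> lam != 0 -> sl2 z lam z'.
Proof.
move=> hz hy he cy cw cl lam0.
have co a b : 0 < complex.Im b -> (complex.Im a)%:C%C / (complex.Im b)%:C%C = (complex.Im a / complex.Im b)%:C%C :> C.
  by move=> hb; rewrite -rmorphV ?unitfE ?gt_eqF // -rmorphM.
have iE (c d : int) v : 0 < complex.Im v ->
    c%:~R = (complex.Im (autj c d v))%:C%C / (complex.Im v)%:C%C :> C.
  by move=> hv; rewrite co // Im_autj mulfK ?gt_eqF // rmorph_int.
have Iz0 : (complex.Im z)%:C%C != 0 :> C by rewrite -nm_gt0 nm_real gtr0_norm.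
have key (v : nat -> C) x (c d : nat -> int) : tends v x -> (forall k, v k = autj (c k) (d k) (y k)) ->
    exists (m n : int) N, x = autj m n z /\ forall k, (N <= k)%N -> c k = m /\ d k = n.
  move=> cvx vE.
  have c1 : tends (fun k => (c k)%:~R) ((complex.Im x)%:C%C / (complex.Im z)%:C%C).
    apply: (tends_ext (y := fun k => (complex.Im (v k))%:C%C / (complex.Im (y k))%:C%C)).
      by move=> k; rewrite vE -iE.
    apply: tends_mul; first exact: (tends_real (raddfB _) (@nm_Im R)).
    by apply: tends_inv => //; exact: (tends_real (raddfB _) (@nm_Im R)).
  have [m [N [mE hm]]] := tends_int c1; rewrite mE in c1.
  have c2 : tends (fun k => (d k)%:~R) (x + -1 * (m%:~R * z)).
    apply: (tends_ext (y := fun k => v k + -1 * ((c k)%:~R * y k))).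
      by move=> k; rewrite vE /autj; ring.
    by apply: tends_add => //; apply: tends_scale; exact: tends_mul.
  have [n [N' [nE hn]]] := tends_int c2.
  exists m, n, (maxn N N'); split; first by rewrite /autj -nE; ring.
  by move=> k; rewrite geq_max => /andP[/hm -> /hn ->].
pose D k (q : int * int * int * int) := let: (a, b, c, d) := q in
  [/\ a * d - b * c = 1, w k = mob a b c d (y k) & l k = autj c d (y k)].
have hD k : exists q, D k q.
  by have [a [b [c [d h]]]] := he k; exists (a, b, c, d).
pose q k := projT1 (cid (hD k)).
have qD k : D k (q k) by rewrite /q; case: cid.
pose a k := (q k).1.1.1; pose b k := (q k).1.1.2; pose c k := (q k).1.2; pose d k := (q k).2.
have H k : [/\ a k * d k - b k * c k = 1, w k = mob (a k) (b k) (c k) (d k) (y k) &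
    l k = autj (c k) (d k) (y k)].
  by have := qD k; rewrite /a /b /c /d /D; case: (q k) => [[[a' b'] c'] d'].
have [|c' [d' [N [e1 h1]]]] := key l lam c d cl; first by move=> k; have [] := H k.
have [|a' [b' [N' [e2 h2]]]] := key (fun k => l k * w k) (lam * z') a b (tends_mul cl cw).
  move=> k; have [det -> ->] := H k.
  by rewrite /mob mulrCA divff ?mulr1 // (autj_neq0 det).
exists a', b', c', d'; split=> //.
- have [] := H (maxn N N'); have [-> ->] := h1 _ (leq_maxl N N').
  by have [-> ->] := h2 _ (leq_maxr N N').
- by rewrite /mob -e1 -e2 [RHS]mulrC mulKf.
Qed.

Lemma sl2_N z : sl2 z (-1) z.
Proof.
have n1 : (-1)%:~R = -1 :> C by rewrite mulrNz.
exists (-1), 0, 0, (-1); split; [by []| |by rewrite /autj mul0r add0r n1].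
by rewrite /mob /autj n1 mul0r add0r addr0 mulN1r invrN1 mulrN1 opprK.
Qed.

(* The pairs [(z, lam)] and [(z', 1)] have the same image (g2 l^4, g3 l^6). *)
Definition sameg z lam z' := [/\ lam != 0, 0 < complex.Im z, 0 < complex.Im z',
  g2 z' = lam ^+ 4 * g2 z & g3 z' = lam ^+ 6 * g3 z].

Definition exotic z lam z' := sameg z lam z' /\ ~ sl2 z lam z'.

Lemma sameg_J z lam z' : sameg z lam z' -> J z' = J z.
Proof. by move=> [l0 _ _]; exact: J_scale. Qed.

Lemma exotic_reduce z lam z' : exotic z lam z' ->
  exists w mu w', [/\ exotic w mu w', wfd w, wfd w' & J w = J z].
Proof.
move=> [[l0 hz hz' e2 e3] ne].
have [mu [w [mw Fw]]] := reduce hz; have [nu [w' [nw Fw']]] := reduce hz'.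
have [mu0 hw m2 m3] := sl2_g hz mw; have [nu0 hw' n2 n3] := sl2_g hz' nw.
exists w, (mu^-1 * (lam * nu)), w'; split; [|exact: Fw|exact: Fw'|exact: J_sl2 hz mw].
split.
  split; [by rewrite !mulf_neq0 ?invr_eq0|exact: hw|exact: hw'| |].
    rewrite n2 e2 m2; move: (g2 z) => a; rewrite !exprMn exprVn; field; exact: mu0.
  rewrite n3 e3 m3; move: (g3 z) => a; rewrite !exprMn exprVn; field; exact: mu0.
move=> h; apply: ne.
have := sl2_trans hz (sl2_trans hz mw h) (sl2_sym hz' nw).
have -> // : mu * (mu^-1 * (lam * nu)) / nu = lam by field; rewrite mu0 nu0.
Qed.

(** Equal J gives equal nomes near the cusp, so z' is a translate of z. Since J is neither 0 nor -1,
    g2 and g3 do not vanish and lam^4 = lam^6 = 1; hence lam = 1 or -1, and the matrix -1 accounts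
    for the sign. *)
Lemma sameg_cusp z lam z' (rho : R) :
  (forall a b : C, nm a <= rho -> nm b <= rho -> ee a * e4 b ^+ 3 = ee b * e4 a ^+ 3 -> a = b) ->
  nm (nome z) <= rho -> nm (nome z') <= rho -> J z != 0 -> J z != - 1 ->
  sameg z lam z' -> sl2 z lam z'.
Proof.
move=> inj q q' j0 j1 sg; have [l0 hz hz' e2 e3] := sg.
have [E1 d1] := J_ee hz; have [E2 d2] := J_ee hz'.
have [n zn] : exists n : int, z' = z + n%:~R.
  apply: nome_inj_int; apply: (inj _ _ q q').
  have := sameg_J sg; rewrite E1 E2 => /eqP; rewrite (eqr_div _ _ d2 d1) => /eqP h.
  by rewrite [LHS]mulrC h mulrC.
have z2 : g2 z != 0.
  by apply: contraNneq j0 => h; rewrite /J h expr0n /= mul0r.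
have z3 : g3 z != 0.
  have D0 := disc_neq0 hz.
  apply: contraNneq j1 => h; rewrite /J; move: D0; rewrite /disc h expr0n /= mulr0 sub0r.
  by rewrite oppr_eq0 => D0; rewrite invrN mulrN divff.
have [_ g2n g3n] := g_addz n hz.
have gen (a b x : C) : a != 0 -> b = x * a -> b = a -> x = 1.
  by move=> a0 -> /(canRL (mulfK a0)) ->; rewrite divff.
rewrite zn in e2 e3; have l4 := gen _ _ _ z2 e2 g2n; have l6 := gen _ _ _ z3 e3 g3n.
have : lam ^+ 2 == 1 ^+ 2.
  by rewrite expr1n -l6 (exprD lam 4 2) l4 mul1r.
rewrite eqf_sqr => /orP[/eqP ->|/eqP ->]; rewrite zn; first exact: sl2_T.
by have := sl2_trans hz (sl2_N z) (sl2_T z n); rewrite mulr1.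
Qed.

Lemma exotic_bounded : exists M : R, forall z lam z', exotic z lam z' -> nm (J z) <= M.
Proof.
have [rho /andP[rho0 _] inj] := cusp_inj R.
have [Y Y0 hY] := J_cusp 0 rho0.
suff [M0 hM0] : exists M : R, forall z, wfd z -> complex.Im z <= Y -> nm (J z) <= M.
  (* The 1 excludes the values 0 and -1 of J. *)
  exists (Num.max 1 M0) => z lam z' hb.
  have [w [mu [w' [[hw ne] Fw Fw' <-]]]] := exotic_reduce hb.
  rewrite leNgt; apply/negP; rewrite gt_max => /andP[j1 jM].
  have far v : wfd v -> J v = J w -> nm (nome v) <= rho.
    move=> Fv Jv; have [h|h] := leP (complex.Im v) Y.
      by have := hM0 v Fv h; rewrite Jv leNgt jM.
    by have [] := hY v (ltW h).
  have hJ := sameg_J hw; apply: ne; apply: sameg_cusp inj _ _ _ _ hw.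
  - exact: far Fw (erefl _).
  - exact: far hJ.
  - by apply: contraTneq j1 => ->; rewrite nm0 ltNge ler01.
  - by apply: contraTneq j1 => ->; rewrite nmN nm1 ltxx.
apply: contrapT => no.
have hk k : exists z, [/\ wfd z, complex.Im z <= Y & k%:R < nm (J z)].
  apply: contrapT => nk; apply: no; exists k%:R => z h1 h2; rewrite leNgt; apply/negP => h3.
  by apply: nk; exists z.
pose y k := projT1 (cid (hk k)).
have hy k : [/\ wfd (y k), complex.Im (y k) <= Y & k%:R < nm (J (y k))] by rewrite /y; case: cid.
have [||z [phi [zF hp hc]]] := @wfd_compact R Y y.
- by move=> k; case: (hy k).
- by move=> k; case: (hy k).
have [M M0 [N hN]] := tends_bnd (tends_J (wfd_gt0 zF) hc).
pose k := maxn N (Num.bound M).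
have h1 := hN k (leq_maxl _ _); have [_ _ h2] := hy (phi k).
have := lt_le_trans h2 h1; rewrite ltNge => /negP; apply.
apply: le_trans (ltW (archi_boundP (ltW M0))) _; rewrite ler_nat.
exact: leq_trans (leq_maxr N _) (hp k).
Qed.

(** The twelfth powers of the factors are quotients of discriminants and converge, so the factors
    are bounded. *)
Lemma exotic_lam (y w l : nat -> C) z z' : 0 < complex.Im z -> 0 < complex.Im z' ->
  tends y z -> tends w z' -> (forall k, sameg (y k) (l k) (w k)) ->
  exists lam (phi : nat -> nat), (forall k, (k <= phi k)%N) /\ tends (l \o phi) lam.
Proof.
move=> hz hz' cy cw hs.
have c1 := tends_mul (tends_cdiff (cdiff_disc hz') cw)
  (tends_inv (disc_neq0 hz) (tends_cdiff (cdiff_disc hz) cy)).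
have [M M0 [N hN]] := tends_bnd c1.
have [|lam [phi [hp hc]]] := @bolzano_weierstrass _ (fun k => l (N + k)%N) (Num.max 1 M).
  move=> k; have := hN _ (leq_addr k N).
  have [_ h1 h2 e2 e3] := hs (N + k)%N.
  rewrite /= (disc_scale e2 e3) mulfK ?disc_neq0 // nmX => h.
  rewrite leNgt; apply/negP; rewrite gt_max => /andP[l1 lM].
  have : nm (l (N + k)%N) <= nm (l (N + k)%N) ^+ 12 by apply: ler_eXnr => //; exact: ltW.
  by move=> /le_trans/(_ h); rewrite leNgt lM.
exists lam, (fun k => N + phi k)%N; split=> // k.
exact: leq_trans (hp k) (leq_addl _ _).
Qed.

(** The equations pass to the limit. Were the limit related by a matrix, that matrix applied to
    nearby points would give pairs close to (z', 1) with the same image; local injectivity would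
    then relate these points as well. *)
Lemma exotic_limit (y w l : nat -> C) z z' lam : 0 < complex.Im z -> 0 < complex.Im z' ->
  tends y z -> tends w z' -> tends l lam -> (forall k, exotic (y k) (l k) (w k)) -> exotic z lam z'.
Proof.
move=> hz hz' cy cw cl hb.
have e2 : g2 z' = lam ^+ 4 * g2 z.
  apply: tends_unique (tends_cdiff (cdiff_g2 hz') cw) _.
  apply: (tends_ext _ (tends_mul (tends_exp 4 cl) (tends_cdiff (cdiff_g2 hz) cy))) => k.
  by have [[_ _ _ e _] _] := hb k; rewrite /= e.
have e3 : g3 z' = lam ^+ 6 * g3 z.
  apply: tends_unique (tends_cdiff (cdiff_g3 hz') cw) _.
  apply: (tends_ext _ (tends_mul (tends_exp 6 cl) (tends_cdiff (cdiff_g3 hz) cy))) => k.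
  by have [[_ _ _ _ e] _] := hb k; rewrite /= e.
have l0 : lam != 0.
  apply: contraNneq (disc_neq0 hz') => l0; rewrite (disc_scale e2 e3) l0 expr0n /=.
  by rewrite mul0r.
split=> // -[a [b [c [d [det zE lE]]]]].
have [e e0 inj] := local_inj hz' (oner_neq0 _).
have j0 := autj_neq0 det hz.
have caut (c' d' : int) : tends (fun k => autj c' d' (y k)) (autj c' d' z).
  by apply: tends_add (tends_cst _); exact: tends_scale.
have cm : tends (fun k => mob a b c d (y k)) z'.
  by rewrite zE; apply: tends_mul (caut _ _) _; exact: tends_inv.
have cr : tends (fun k => l k / autj c d (y k)) 1.
  by rewrite -(divff l0); apply: tends_mul => //; rewrite lE; apply: tends_inv.
have [N1 h1] := cw e e0; have [N2 h2] := cm e e0; have [N3 h3] := cr e e0.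
pose k := maxn N1 (maxn N2 N3).
have {}h1 := h1 k (leq_maxl _ _).
have {}h2 := h2 k (leq_trans (leq_maxl N2 N3) (leq_maxr _ _)).
have {}h3 := h3 k (leq_trans (leq_maxr N2 N3) (leq_maxr _ _)).
have [[lk0 hyk hwk f2 f3] ne] := hb k.
have jk := autj_neq0 det hyk.
have me : sl2 (y k) (autj c d (y k)) (mob a b c d (y k)) by exists a, b, c, d.
have [_ him m2 m3] := sl2_g hyk me.
have gen (u v : C) : u + (v - u) = v by rewrite addrC subrK.
have := inj (w k - z') 0 (mob a b c d (y k) - z') (l k / autj c d (y k) - 1) h1.
rewrite nm0 !gen addr0 => /(_ (ltW e0) h2 h3) []; last first.
- move=> /(congr1 (+%R^~ z')); rewrite !subrK => E /esym/eqP; rewrite subr_eq0 => /eqP F.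
  apply: ne; rewrite E; have -> : l k = autj c d (y k); last exact: me.
  by rewrite -[LHS](divfK jk) F mul1r.
- rewrite f3 m3 expr1n mulr1; move: (g3 (y k)) => A; field; exact: jk.
- rewrite f2 m2 expr1n mulr1; move: (g2 (y k)) => A; field; exact: jk.
Qed.

Lemma exists_farther (x : C) (r : R) : 0 < r -> exists j, nm (j - x) <= r /\ nm x < nm j.
Proof.
move=> r0; have [->|x0] := eqVneq x 0.
  by exists r%:C%C; rewrite subr0 nm0 nm_real gtr0_norm.
have xp : 0 < nm x by rewrite nm_gt0.
exists ((1 + r / nm x)%:C%C * x); split.
  rewrite rmorphD rmorph1 mulrDl mul1r addrAC subrr add0r nmM nm_real.
  by rewrite gtr0_norm ?divr_gt0 // divfK // gt_eqF.
by rewrite nmM nm_real gtr0_norm ?addr_gt0 ?divr_gt0 // ltr_pMl // ltrDl divr_gt0.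
Qed.

(** Both points are moved, by arbitrarily little, onto a common image with larger |J|. If no such
    pair were exotic, all of them would be related by SL2(Z), and [sl2_closed] would relate the
    original pair. *)
Lemma J_max z lam z' : exotic z lam z' -> exists w mu w', exotic w mu w' /\ nm (J z) < nm (J w).
Proof.
move=> [[l0 hz hz' e2 e3] ne]; apply: contrapT => no.
have [E1 E2] := J_pair hz' (oner_neq0 _).
have D0 : disc z' * 1 ^+ 12 != 0 by rewrite expr1n mulr1 disc_neq0.
rewrite -E1 in D0 E2.
have Jz : J z' = J z by exact: J_scale l0 e2 e3.
have p2 : g2 z * lam ^+ 4 = g2 z' * 1 ^+ 4 by rewrite e2 expr1n mulr1 mulrC.
have p3 : g3 z * lam ^+ 6 = g3 z' * 1 ^+ 6 by rewrite e3 expr1n mulr1 mulrC.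
have hk k : exists q : C * C * C, [/\ sl2 q.1.1 q.1.2 q.2, 0 < complex.Im q.1.1,
    nm (q.1.1 - z) <= k.+1%:R^-1, nm (q.2 - z') <= k.+1%:R^-1 &
    exists l l', [/\ q.1.2 = l / l', l' != 0, nm (l - lam) <= k.+1%:R^-1 & nm (l' - 1) <= k.+1%:R^-1]].
  have k0 : 0 < k.+1%:R^-1 :> R by rewrite invr_gt0.
  have [d d0 hd] := J_perturb hz l0 k0; have [d' d'0 hd'] := J_perturb hz' (oner_neq0 _) k0.
  have dd : 0 < Num.min d d' by rewrite lt_min d0.
  have [r r0 hr] := J_open dd D0; rewrite E2 Jz in hr.
  have [j [j1 j2]] : exists j, nm (j - J z) <= r /\ nm (J z) < nm j by exact: exists_farther.
  have [a [b [ha hb Dab Jab]]] := hr j j1.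
  move: ha hb; rewrite !le_min => /andP[ha ha'] /andP[hb hb'].
  have {}ha : nm (a - g2 z * lam ^+ 4) <= d by rewrite p2.
  have {}hb : nm (b - g3 z * lam ^+ 6) <= d by rewrite p3.
  have [x [l [x1 x2 x3 [x4 x5 x6 x7]]]] := hd a b ha hb Dab.
  have [x' [l' [x1' x2' x3' [x4' x5' x6' x7']]]] := hd' a b ha' hb' Dab.
  exists (x, l / l', x'); split; last first.
  - exists l, l'; split; [exact: erefl|exact: x4'|exact: x2|exact: x2'].
  - exact: x1'.
  - exact: x1.
  - exact: x3.
  apply: contrapT => nee; apply: no; exists x, (l / l'), x'; split; last by rewrite x7 Jab; exact: j2.
  split; last exact: nee.
  split; [by rewrite mulf_neq0 ?invr_eq0|exact: x3|exact: x3'| |].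
  rewrite -[LHS](mulfK (expf_neq0 4 x4')) x5' -x5; move: (g2 x) => A; field; exact: x4'.
  rewrite -[LHS](mulfK (expf_neq0 6 x4')) x6' -x6; move: (g3 x) => A; field; exact: x4'.
pose q k := projT1 (cid (hk k)).
have hq k : [/\ sl2 (q k).1.1 (q k).1.2 (q k).2, 0 < complex.Im (q k).1.1,
    nm ((q k).1.1 - z) <= k.+1%:R^-1, nm ((q k).2 - z') <= k.+1%:R^-1 &
    exists l l', [/\ (q k).1.2 = l / l', l' != 0, nm (l - lam) <= k.+1%:R^-1 & nm (l' - 1) <= k.+1%:R^-1]].
  by rewrite /q; case: cid.
pose L k := projT1 (cid (let: And5 _ _ _ _ h := hq k in h)).
have hL k : exists l', [/\ (q k).1.2 = L k / l', l' != 0, nm (L k - lam) <= k.+1%:R^-1 & nm (l' - 1) <= k.+1%:R^-1].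
  by rewrite /L; case: cid.
pose L' k := projT1 (cid (hL k)).
have hL' k : [/\ (q k).1.2 = L k / L' k, L' k != 0, nm (L k - lam) <= k.+1%:R^-1 & nm (L' k - 1) <= k.+1%:R^-1].
  by rewrite /L'; case: cid.
apply: ne; apply: (@sl2_closed (fun k => (q k).1.1) (fun k => (q k).2) (fun k => (q k).1.2) _ _ _ hz _ _ _ _ _ l0).
- by move=> k; case: (hq k).
- by move=> k; case: (hq k).
- by apply: tends_eps => k; case: (hq k).
- by apply: tends_eps => k; case: (hq k).
- rewrite -[lam]divr1; apply: (@tends_ext (fun k => L k / L' k)) => [k|].
    by case: (hL' k).
  apply: tends_mul; first by apply: tends_eps => k; case: (hL' k).
  by apply: tends_inv; [exact: oner_neq0|apply: tends_eps => k; case: (hL' k)].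
Qed.

(** Subsequences are extracted in turn for z, z' and lam, so that the supremum of |J| over exotic
    pairs is attained at an exotic pair. *)
Theorem g_inj z lam z' : sameg z lam z' -> sl2 z lam z'.
Proof.
move=> hs; apply: contrapT => ne.
have [M hM] := exotic_bounded.
pose S := [set m : R | exists z lam z', exotic z lam z' /\ m = nm (J z)].
have hS : has_sup S.
  split; first by exists (nm (J z)), z, lam, z'.
  by exists M => _ [v [l [v' [hb ->]]]]; exact: hM hb.
have hk k : exists q : C * C * C, [/\ exotic q.1.1 q.1.2 q.2, wfd q.1.1, wfd q.2 &
    sup S - k.+1%:R^-1 <= nm (J q.1.1)].
  have [|_ [v [l [v' [hb ->]]]] h] := @sup_adherent R S (k.+1%:R^-1) _ hS; first by rewrite invr_gt0.
  have [w [mu [w' [hb' Fw Fw' Jw]]]] := exotic_reduce hb.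
  by exists (w, mu, w'); split; [exact: hb'|exact: Fw|exact: Fw'|rewrite /= Jw; exact: ltW].
pose q k := projT1 (cid (hk k)).
have hq k : [/\ exotic (q k).1.1 (q k).1.2 (q k).2, wfd (q k).1.1, wfd (q k).2 &
    sup S - k.+1%:R^-1 <= nm (J (q k).1.1)] by rewrite /q; case: cid.
have [||x [p [Fx hp cx]]] := @J_compact R M (fun k => (q k).1.1).
- by move=> k; case: (hq k).
- by move=> k; have [hb _ _ _] := hq k; exact: hM hb.
have [||x' [p' [Fx' hp' cx']]] := @J_compact R M (fun k => (q (p k)).2).
- by move=> k; case: (hq (p k)).
- by move=> k; have [hb _ _ _] := hq (p k); have [h _] := hb; rewrite (sameg_J h); exact: hM hb.
have {}cx := tends_subseq hp' cx.
have [|mu [p'' [hp'' cl]]] := exotic_lam (wfd_gt0 Fx) (wfd_gt0 Fx') cx cx' (l := fun k => (q (p (p' k))).1.2).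
  by move=> k; have [[h _] _ _ _] := hq (p (p' k)).
have {}cx := tends_subseq hp'' cx; have {}cx' := tends_subseq hp'' cx'.
have xb := exotic_limit (wfd_gt0 Fx) (wfd_gt0 Fx') cx cx' cl (fun k => let: And4 h _ _ _ := hq (p (p' (p'' k))) in h).
have Jx : sup S <= nm (J x).
  have hpp k : (k <= p (p' (p'' k)))%N.
    exact: leq_trans (hp'' k) (leq_trans (hp' _) (hp _)).
  have cJ := tends_J (wfd_gt0 Fx) cx.
  apply/ler_addgt0Pr => e e0.
  have [N hN] := cJ _ (divr_gt0 e0 (ltr0Sn _ 1)).
  have [N' hN'] := eps_small (divr_gt0 e0 (ltr0Sn _ 1)).
  have k1 := hN _ (leq_maxl N N'); set k := maxn N N' in k1.
  have k2 := hN' _ (leq_trans (leq_maxr N N') (hpp k)).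
  have [_ _ _ k3] := hq (p (p' (p'' k))); rewrite /= in k1.
  have k4 := nm_le_add (J (q (p (p' (p'' k)))).1.1) (J x).
  move: (J x) (J _) (sup S) ((p (p' (p'' k))).+1%:R^-1) k1 k2 k3 k4 => A B m t k1 k2 k3 k4.
  lra.
have [w [nu [w' [wb Jw]]]] := J_max xb.
have : nm (J w) <= sup S by apply: sup_upper_bound => //; exists w, nu, w'.
by rewrite leNgt (le_lt_trans Jx Jw).
Qed.

End Injectivity.

(** * The solution *)

Section Formulas.
Variable R : realType.
Local Notation C := R[i].
Implicit Types (z l t k m w : C).
Local Notation cj := (@conjc R).
Local Notation i2 := (2 * Complex 0 1 : C).

Let cjM w w' : cj (w * w') = cj w * cj w'. Proof. exact: rmorphM. Qed.
Let cjD w w' : cj (w + w') = cj w + cj w'. Proof. exact: rmorphD. Qed.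
Let cjB w w' : cj (w - w') = cj w - cj w'. Proof. exact: rmorphB. Qed.
Let cj0 w : w != 0 -> cj w != 0. Proof. by rewrite conjc_eq0. Qed.

(** 2 i Im w as a polynomial in w and its conjugate: the identities below become identities of
    rational functions. [hIm] removes the factor 2 i from a purely imaginary number. *)
Definition dIm w : C := w - cj w.
Definition hIm w : R := complex.Im w / 2.

Lemma i2E : i2 = Complex 0 2.
Proof.
have -> : 2 = (2 : R)%:C%C by rewrite rmorph_nat.
by simpc.
Qed.

Lemma dImE w : dIm w = i2 * (complex.Im w)%:C%C.
Proof.
rewrite i2E /dIm; case: w => a b; apply/eqP; rewrite eq_complex /=.
by apply/andP; split; apply/eqP; ring.
Qed.

Lemma dImM w w' : dIm (w * cj w') = w * cj w' - cj w * w'.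
Proof. by rewrite /dIm cjM conjcK. Qed.

Lemma hImK w : cj w = - w -> i2 * (hIm w)%:C%C = w.
Proof.
rewrite i2E /hIm; case: w => a b /(congr1 (@complex.Re R)) /= h.
apply/eqP; rewrite eq_complex /=; apply/andP; split; apply/eqP; last by field.
by lra.
Qed.

Lemma hIm_i2 (a : R) : hIm (i2 * a%:C%C) = a.
Proof. by rewrite i2E /hIm /=; field. Qed.

Lemma nm_cj w : (nm w ^+ 2)%:C%C = w * cj w.
Proof. by rewrite nm_sqr; case: w => a b; simpc; congr Complex; ring. Qed.

Lemma dIm_cj w : cj (dIm w) = - dIm w.
Proof. by rewrite /dIm cjB conjcK opprB. Qed.

(* With [k = l^-1] and [k' = mm z l t], the point of T above is [(t, g2 z l^4, g3 z l^6)];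
   [2 i B1], [2 i B2] and [B3] are the following. *)
Definition mm z l t := t / l - g1 z * l.
Definition E1 z l : C := dIm z / (l * cj l).
Definition E2 z l t : C := dIm z * (mm z l t * cj (mm z l t)) + dIm (mm z l t * cj l).
Definition E3 z l t : C := (cj l + cj (mm z l t) * dIm z) / l.

Lemma sl2_facts z lam z' : 0 < complex.Im z -> sl2 z lam z' -> exists c : C,
  [/\ cj c = c, lam - cj lam = c * dIm z, dIm z' = dIm z / (lam * cj lam) &
      g1 z' = lam ^+ 2 * g1 z + c * lam].
Proof.
move=> hz [a [b [c [d [det -> ->]]]]]; have [h1 h2 _ _] := modular det hz.
have cjz (n : int) : cj n%:~R = n%:~R by rewrite rmorph_int.
have j0 := autj_neq0 det hz.
exists c%:~R; split=> //.
  by rewrite /autj /dIm cjD cjM !cjz; ring.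
rewrite !dImE h1 -nm_cj.
have -> (x y : R) : (x / y)%:C%C = x%:C%C / y%:C%C by rewrite rmorphM fmorphV.
by rewrite mulrA.
Qed.

(** The relation lam - conj lam = 2 i c Im z compensates the quasi-modular term c lam of g1. *)
Lemma E_sl2 z lam z' l t : 0 < complex.Im z -> sl2 z lam z' -> l != 0 ->
  [/\ E1 z' (l / lam) = E1 z l, E2 z' (l / lam) t = E2 z l t & E3 z' (l / lam) t = E3 z l t].
Proof.
move=> hz he l0; have [lam0 hz' _ _] := sl2_g hz he.
have [c [cc lamE DE gE]] := sl2_facts hz he.
have mE : mm z' (l / lam) t = lam * mm z l t - c * l.
  rewrite /mm gE; move: (g1 z) => x; field; by rewrite l0 lam0.
have cm : cj (mm z' (l / lam) t) = cj lam * cj (mm z l t) - c * cj l.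
  by rewrite mE cjB !cjM cc.
have cl : cj (l / lam) = cj l / cj lam by rewrite cjM conjc_inv.
have L0 := cj0 l0; have la0 := cj0 lam0.
have q0 : lam - cj lam - c * dIm z = 0 by rewrite lamE subrr.
rewrite /E1 /E2 /E3 !dImM cm cl mE DE.
move: (mm z l t) (cj (mm z l t)) (cj l) (cj lam) (dIm z) L0 la0 q0 {lamE DE cm cl mE gE}
  => m M L lb D L0 lb0 q0; split.
- by field; rewrite l0 L0 lam0 lb0.
(* The two sides differ by an explicit multiple of the vanishing quantity in [q0]. *)
- transitivity (D * (m * M) + (m * L - M * l) + (lam - lb - c * D) *
    (m * L / lb + l * M / lam - c * l * L / (lam * lb))); last by rewrite q0 mul0r addr0.
  by field; rewrite lam0 lb0.
- transitivity ((L + M * D) / l + (lam - lb - c * D) * (L / (lb * l))); last by rewrite q0 mul0r addr0.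
  by field; rewrite l0 lam0 lb0.
Qed.

Lemma E1_cj z l : cj (E1 z l) = - E1 z l.
Proof. by rewrite /E1 cjM conjc_inv cjM conjcK dIm_cj mulNr [cj l * l]mulrC. Qed.

Lemma E2_cj z l t : cj (E2 z l t) = - E2 z l t.
Proof. rewrite /E2 dImM; have := dIm_cj z; move: (mm z l t) (dIm z) => n D cD.
rewrite !(cjB, cjD, cjM, conjcK, cD).
by move: (cj n) (cj l) => N L; ring. Qed.

Lemma mm_act z l t k m : l != 0 -> k != 0 ->
  mm z (l / k) (t * k ^- 2 + m * k^-1) = mm z l t / k + m / l.
Proof. by move=> l0 k0; rewrite /mm; move: (g1 z) => x; field; rewrite l0 k0. Qed.

Lemma E1_act z l k : l != 0 -> k != 0 -> E1 z (l / k) = E1 z l * (k * cj k).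
Proof.
move=> l0 k0; rewrite /E1 cjM conjc_inv.
have := cj0 l0; have := cj0 k0; move: (cj l) (cj k) (dIm z) => L K D K0 L0.
by field; rewrite l0 k0 L0 K0.
Qed.

Lemma E2_act z l t k m : l != 0 -> k != 0 ->
  E2 z (l / k) (t * k ^- 2 + m * k^-1) =
  E1 z l * (m * cj m) + E2 z l t * (k^-1 * cj k^-1) + dIm (E3 z l t * m * cj k^-1).
Proof.
move=> l0 k0; rewrite /E2 mm_act // /E1 /E3 !dImM; have := dIm_cj z; move: (mm z l t) (dIm z) => n D cD.
rewrite !(cjM, cjD, conjc_inv, conjcK, cD).
have := cj0 l0; have := cj0 k0; move: (cj n) (cj l) (cj k) (cj m) => N L K M K0 L0.
by field; rewrite l0 k0 L0 K0.
Qed.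

Lemma E3_act z l t k m : l != 0 -> k != 0 ->
  E3 z (l / k) (t * k ^- 2 + m * k^-1) = E3 z l t * k * cj k^-1 + k * cj m * E1 z l.
Proof.
move=> l0 k0; rewrite /E3 mm_act // /E1; have := dIm_cj z; move: (mm z l t) (dIm z) => n D cD.
rewrite !(cjM, cjD, conjc_inv, conjcK).
have := cj0 l0; have := cj0 k0; move: (cj n) (cj l) (cj k) (cj m) => N L K M K0 L0.
by field; rewrite l0 k0 L0 K0.
Qed.

Lemma E3_nm z l t : l != 0 -> E3 z l t * cj (E3 z l t) = 1 - E1 z l * E2 z l t.
Proof.
move=> l0; rewrite /E3 /E1 /E2 dImM; have := dIm_cj z; move: (mm z l t) (dIm z) => n D cD.
rewrite !(cjM, cjD, conjc_inv, conjcK, cD).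
have := cj0 l0; move: (cj n) (cj l) => N L L0.
by field; rewrite l0 L0.
Qed.

Lemma E_g z : [/\ E1 z 1 = dIm z, E2 z 1 (g1 z) = 0 & E3 z 1 (g1 z) = 1].
Proof.
rewrite /E1 /E2 /E3; have -> : mm z 1 (g1 z) = 0 by rewrite /mm divr1 mulr1 subrr.
rewrite conjc0 conjc1 !mul0r !mulr0 !mulr1 !divr1 addr0 add0r; split=> //.
by rewrite /dIm conjc0 subrr.
Qed.

Lemma nm_E3 z l t : l != 0 -> hIm (E2 z l t) = 0 -> nm (E3 z l t) = 1.
Proof.
move=> l0 h; have := E3_nm z t l0; rewrite -(hImK (E2_cj z l t)) h !mulr0 subr0 -nm_cj.
move=> [] /eqP; rewrite sqrf_eq1 => /orP[/eqP //|/eqP e].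
by have := nm_ge0 (E3 z l t); rewrite e ler0N1.
Qed.

End Formulas.

(** * The functions on T, their equations and their uniqueness *)

Section Solution.
Variable R : realType.
Local Notation C := R[i].
Implicit Types (z l k m a b : C) (t : 'rV[C]_3).
Local Notation cj := (@conjc R).
Local Notation i2 := (2 * Complex 0 1 : C).

Definition represents a b (q : C * C) := [/\ 0 < complex.Im q.1, q.2 != 0,
  g2 q.1 * q.2 ^+ 4 = a & g3 q.1 * q.2 ^+ 6 = b].
(** An arbitrary choice of parameters; the default (0, 0) occurs exactly outside T. *)
Definition repr_of t : C * C := xget (0, 0) [set q | represents (t 0 1) (t 0 2) q].
Definition F1 t : C := E1 (repr_of t).1 (repr_of t).2.
Definition F2 t : C := E2 (repr_of t).1 (repr_of t).2 (t 0 0).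
Definition F3 t : C := E3 (repr_of t).1 (repr_of t).2 (t 0 0).

Lemma repr_of_represents t q : represents (t 0 1) (t 0 2) q -> represents (t 0 1) (t 0 2) (repr_of t).
Proof. by move=> hq; rewrite /repr_of; case: xgetP => [q' _ //|/(_ q)]. Qed.

(** Two representatives differ by the factor lam = l/l'. Injectivity puts it in SL2(Z), where the
    three expressions are invariant. *)
Lemma F_represents t z l : represents (t 0 1) (t 0 2) (z, l) ->
  [/\ F1 t = E1 z l, F2 t = E2 z l (t 0 0) & F3 t = E3 z l (t 0 0)].
Proof.
move=> hzl; have [/= hz l0 e2 e3] := hzl; have := repr_of_represents hzl.
rewrite /F1 /F2 /F3; case: (repr_of t) => z' l' [/= hz' l0' e2' e3'].
have sg : sameg z (l / l') z'.
  split; [by rewrite mulf_neq0 ?invr_eq0|exact: hz|exact: hz'| |].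
    rewrite -[LHS](mulfK (expf_neq0 4 l0')) e2' -e2; move: (g2 z) => A /=; field; exact: l0'.
  rewrite -[LHS](mulfK (expf_neq0 6 l0')) e3' -e3; move: (g3 z) => A /=; field; exact: l0'.
have [h1 h2 h3] := E_sl2 (t 0 0) hz (g_inj sg) l0.
have lE : l / (l / l') = l' by field; rewrite l0 l0'.
by rewrite lE in h1 h2 h3.
Qed.

Lemma TE t : T t <-> 27 * t 0 2 ^+ 2 - t 0 1 ^+ 3 != 0.
Proof. by split=> [/eqP|/eqP]. Qed.

Lemma T_represents t : T t -> exists z l, represents (t 0 1) (t 0 2) (z, l).
Proof. by move=> /TE /g_surj[z [l h]]; exists z, l. Qed.

Lemma vec3E a b (c : C) : [/\ vec3 a b c 0 0 = a, vec3 a b c 0 1 = b & vec3 a b c 0 2 = c].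
Proof. by rewrite !mxE. Qed.

Lemma vec3_eta t : t = vec3 (t 0 0) (t 0 1) (t 0 2).
Proof.
apply/rowP => -[[|[|[|//]]] h]; rewrite mxE /=; congr (t _ _); exact: val_inj.
Qed.

Lemma F_act a b (c : C) k m : T (vec3 a b c) -> k != 0 ->
  let t := vec3 a b c in
  let t' := vec3 (a * k ^- 2 + m * k^-1) (b * k ^- 4) (c * k ^- 6) in
  [/\ F1 t' = F1 t * (k * cj k),
      F2 t' = F1 t * (m * cj m) + F2 t * (k^-1 * cj k^-1) + dIm (F3 t * m * cj k^-1) &
      F3 t' = F3 t * k * cj k^-1 + k * cj m * F1 t].
Proof.
move=> hT k0 t t'; have [z [l hf]] := T_represents hT; have [t0 t1 t2] := vec3E a b c.
have [t0' t1' t2'] := vec3E (a * k ^- 2 + m * k^-1) (b * k ^- 4) (c * k ^- 6).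
have [hz l0 e2 e3] := hf.
have hf' : represents (t' 0 1) (t' 0 2) (z, l / k).
  split=> /=; [exact: hz|by rewrite mulf_neq0 ?invr_eq0| |].
    by rewrite t1' expr_div_n mulrA /=; congr (_ / _); rewrite -t1.
  by rewrite t2' expr_div_n mulrA /=; congr (_ / _); rewrite -t2.
have [-> -> ->] := F_represents hf'; have [-> -> ->] := F_represents hf.
by rewrite t0' t0; rewrite E1_act // E2_act // E3_act.
Qed.

Lemma F1_indep a a' b c : F1 (vec3 a b c) = F1 (vec3 a' b c).
Proof.
rewrite /F1 /repr_of; have [_ -> ->] := vec3E a b c; by have [_ -> ->] := vec3E a' b c.
Qed.

Lemma F_g z : 0 < complex.Im z -> [/\ F1 (g z) = dIm z, F2 (g z) = 0 & F3 (g z) = 1].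
Proof.
move=> hz; have [t0 t1 t2] := vec3E (g1 z) (g2 z) (g3 z).
have hf : represents (g z 0 1) (g z 0 2) (z, 1).
  by rewrite /g t1 t2; split; rewrite /= ?expr1n ?mulr1 ?oner_neq0.
have [-> -> ->] := F_represents hf; rewrite /g t0; exact: E_g.
Qed.

Definition B1 t : R := hIm (F1 t).
Definition B2 t : R := hIm (F2 t).

Lemma B1K t : i2 * (B1 t)%:C%C = F1 t. Proof. exact: hImK (E1_cj _ _). Qed.
Lemma B2K t : i2 * (B2 t)%:C%C = F2 t. Proof. exact: hImK (E2_cj _ _ _). Qed.

Lemma i2_inj (x y : R) : i2 * x%:C%C = i2 * y%:C%C -> x = y.
Proof. by move=> h; rewrite -[x]hIm_i2 h hIm_i2. Qed.

Lemma reM (x y : R) : (x * y)%:C%C = x%:C%C * y%:C%C :> C. Proof. exact: rmorphM. Qed.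
Lemma reD (x y : R) : (x + y)%:C%C = x%:C%C + y%:C%C :> C. Proof. exact: rmorphD. Qed.

Lemma B_equations : [/\ B1_equations B1, B2_equations B1 B2 F3 & B3_equations B1 F3].
Proof.
split; split.
- by move=> z /F_g[h _ _]; apply: i2_inj; rewrite B1K h dImE.
- move=> a b c k hT k0; have [+ _ _] := F_act 0 hT k0.
  rewrite (F1_indep _ a) => h; apply: i2_inj.
  by rewrite B1K h reM nm_cj -B1K !mulrA.
- by move=> z /F_g[_ h _]; rewrite /B2 h /hIm /= mul0r.
- move=> a b c k m hT k0; have [_ h _] := F_act m hT k0; apply: i2_inj.
  rewrite B2K h -B1K -B2K dImE !reD (reM (B1 _)) (reM (B2 _)) !nm_cj.
  by rewrite !mulrDr !mulrA.
- by move=> z /F_g[].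
- move=> a b c k m hT k0; have [_ _ ->] := F_act m hT k0.
  by rewrite -B1K; congr (_ + _); move: (cj m) (Complex 0 1) (B1 _)%:C%C => M I x; ring.
Qed.

Lemma B_determined (A1 A2 : 'rV[C]_3 -> R) (A3 : 'rV[C]_3 -> C) :
  (forall t1 t1' t2 t3 : C, T (vec3 t1 t2 t3) -> A1 (vec3 t1' t2 t3) = A1 (vec3 t1 t2 t3)) ->
  B1_equations A1 -> B2_equations A1 A2 A3 -> B3_equations A1 A3 ->
  forall t, T t -> [/\ A1 t = B1 t, A2 t = B2 t & A3 t = F3 t].
Proof.
move=> ind [a1 b1] [a2 b2] [a3 b3] t hT; have [z [l hf]] := T_represents hT.
have [/= hz l0 e2 e3] := hf.
have Tg : T (g z).
  by apply/TE; rewrite /g; have [_ -> ->] := vec3E (g1 z) (g2 z) (g3 z); exact: disc_neq0.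
have li : l^-1 != 0 by rewrite invr_eq0.
(* The point arises from [g z] by k = 1/l and k' = [mm z l (t 0 0)], which is how [mm] is
   defined. *)
have tE : t = vec3 (g1 z * l^-1 ^- 2 + mm z l (t 0 0) * l^-1^-1) (g2 z * l^-1 ^- 4) (g3 z * l^-1 ^- 6).
  rewrite [LHS]vec3_eta -e2 -e3 !exprVn !invrK /mm; congr vec3.
  by move: (g1 z) (t 0 0) => x y; field.
have [c1 c2 c3] := B_equations; case: c1 => c1 d1; case: c2 => c2 d2; case: c3 => c3 d3.
rewrite tE b2 // b3 // d2 // d3 //.
have E : A1 (g z) = B1 (g z) by rewrite a1 // c1.
have Td : T (vec3 (g1 z) (g2 z * l^-1 ^- 4) (g3 z * l^-1 ^- 6)).
  apply/TE; have [_ -> ->] := vec3E (g1 z) (g2 z * l^-1 ^- 4) (g3 z * l^-1 ^- 6).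
  have /TE := hT; rewrite {1 2}tE.
  by have [_ -> ->] := vec3E (g1 z * l^-1 ^- 2 + mm z l (t 0 0) * l^-1^-1) (g2 z * l^-1 ^- 4) (g3 z * l^-1 ^- 6).
rewrite -/(g z) E a2 // c2 // a3 // c3 //; split=> //.
(* The equation for the first function leaves t1 in place, so independence of t1 first brings this
   coordinate back to [g1 z]. *)
rewrite (ind _ _ _ _ Td) b1 // -/(g z) E -d1 //.
by rewrite /B1 (F1_indep _ (g1 z)).
Qed.

End Solution.

(** * Analyticity *)

Section Closure.
Variables (R : realType) (n : nat) (r : R).
Hypothesis r0 : 0 < r.
Local Notation C := R[i].
Local Notation cj := (@conjc R).
Implicit Types f g : 'rV[R]_n -> C.

Definition nbx f := exists M, nb r f M.

Lemma nbx_cst (c : C) : nbx (fun=> c). Proof. by exists (nm c); exact: nb_cst. Qed.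

Lemma nbx_add f g : nbx f -> nbx g -> nbx (fun h => f h + g h).
Proof. by move=> [M hf] [N hg]; exists (M + N); exact: nb_add. Qed.

Lemma nbx_sub f g : nbx f -> nbx g -> nbx (fun h => f h - g h).
Proof. by move=> [M hf] [N hg]; exists (M + N); exact: nb_sub. Qed.

Lemma nbx_mul f g : nbx f -> nbx g -> nbx (fun h => f h * g h).
Proof. by move=> [M hf] [N hg]; exists (M * N); exact: nb_mul. Qed.

Lemma nbx_ext f g : (forall h, box r h -> f h = g h) -> nbx f -> nbx g.
Proof. by move=> fg [M hf]; exists M; exact: nb_ext hf. Qed.

Lemma sums_to_cj (I : eqType) (a : I -> C) l : sums_to a l -> sums_to (fun i => cj (a i)) (cj l).
Proof.
move=> h e /h[s0 hs]; exists s0 => s us ss.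
by rewrite -(rmorph_sum (@conjc R)) -rmorphB nmJ; exact: hs.
Qed.

(** The monomials are real, so conjugating the coefficients conjugates the function. *)
Lemma nbx_cj f : nbx f -> nbx (fun h => cj (f h)).
Proof.
move=> [M [c [hc hf]]]; exists M, (fun a => cj (c a)); split.
  by apply: abs_le_le hc => // a; rewrite !nmM nmJ.
move=> h hb; apply: sums_to_ext (sums_to_cj (hf h hb)) => a.
by rewrite rmorphM; congr (_ * _); exact: conjc_real.
Qed.

Lemma sums_to_geo (w : C) : nm w <= 2^-1 -> sums_to (fun k => w ^+ k) (1 - w)^-1.
Proof.
move=> hw; have w1 : 1 - w != 0.
  by rewrite subr_eq0; apply: contraTneq hw => <-; rewrite nm1 -ltNge invf_lt1 // ltr1n.
apply: (@sums_to_nat_conv _ _ _ 2).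
  move=> s us; apply: (@le_trans _ _ (\sum_(k <- s) 1 * 2^-1 ^+ k)).
    apply: ler_sum => k _; rewrite nmX mul1r; apply: lerXn2r => //; rewrite nnegrE ?nm_ge0 // invr_ge0.
  by have := geo_half (@ler01 R) us; rewrite mulr1.
move=> e e0; have [N hN] := eps_small (divr_gt0 e0 (ltr0Sn R 1)).
exists N.+1 => k hk.
have -> : \sum_(0 <= i < k) w ^+ i - (1 - w)^-1 = - (w ^+ k / (1 - w)).
  apply: (mulIf w1); rewrite mulrBl mulVf // mulNr divfK //.
  rewrite big_mkord mulrC -[1 - w]opprB mulNr -subrX1; ring.
rewrite nmN nmM nmX nmV; have wi : 2^-1 <= nm (1 - w).
  by have := nm_le_add 1 (1 - w); rewrite opprB addrCA subrr addr0 nm1; lra.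
have h1 : nm w ^+ k <= k.+1%:R^-1.
  apply: (@le_trans _ _ (2^-1 ^+ k)); first by apply: lerXn2r => //; rewrite nnegrE ?nm_ge0 // invr_ge0.
  by rewrite exprVn lef_pV2 ?posrE ?exprn_gt0 // -natrX ler_nat ltn_expl.
have h2 : (nm (1 - w))^-1 <= 2 by rewrite invf_ple ?posrE //; apply: lt_le_trans wi; rewrite invr_gt0.
apply: (@le_trans _ _ (k.+1%:R^-1 * 2)).
  by apply: ler_pM => //; rewrite ?exprn_ge0 ?invr_ge0 ?nm_ge0.
by rewrite -ler_pdivlMr //; apply: hN; exact: ltnW.
Qed.

(** A geometric series in -f/c, an element of norm at most 1/2. *)
Lemma nbx_inv (c : C) f e : c != 0 -> e <= nm c / 2 -> nb r f e -> nbx (fun h => (c + f h)^-1).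
Proof.
move=> c0 ec hf; have cp : 0 < nm c by rewrite nm_gt0.
have hw : nb r (fun h => - c^-1 * f h) 2^-1.
  apply: nb_le (nb_scale _ hf); rewrite nmN nmV ler_pdivrMl //; lra.
have [M hM] : nbx (fun h => (1 - - c^-1 * f h)^-1).
  exists (2 * 1); apply: (@nb_family _ _ _ r0 _ (fun k h => (- c^-1 * f h) ^+ k) (fun k => 1 * 2^-1 ^+ k)).
  - by move=> k; rewrite mul1r; exact: nb_exp.
  - by move=> s; exact: geo_half.
  - by move=> h hb; apply: sums_to_geo; exact: nb_val hw hb.
apply: nbx_ext (nbx_mul (nbx_cst c^-1) (ex_intro _ M hM)) => h hb.
have w1 : c + f h != 0.
  rewrite -nm_gt0; have := nb_val r0 hf hb; have := nm_le_add c (- f h).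
  by rewrite opprK nmN; lra.
rewrite mulNr opprK; field; rewrite c0 w1 andbT /=.
by [].
Qed.

End Closure.

(** * Local power series for the solution *)

Section Analyticity.
Variable R : realType.
Local Notation C := R[i].
Local Notation cj := (@conjc R).
Implicit Types x h : 'rV[R]_(3 + 3).

Definition ccoord h (j : 'I_3) : C := (h 0 (lshift 3 j))%:C%C + Complex 0 1 * (h 0 (rshift 3 j))%:C%C.

Lemma to_complexD x h j : to_complex (x + h) 0 j = to_complex x 0 j + ccoord h j.
Proof. by rewrite !mxE /ccoord; simpc. Qed.

Lemma nb_ccoord (r : R) j : 0 < r -> nb r (fun h => ccoord h j) (r + r).
Proof.
move=> r0; apply: nb_add; first exact: nb_coord.
by apply: nb_ext (nb_scale (Complex 0 1) (nb_coord r0 _)) => //; rewrite nm_i mul1r.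
Qed.

(** The local inverse is fed with the increments of t2 and t3 as elements of the algebra in six real
    variables, so z and l become power series in these variables. *)
Lemma local_rep x : T (to_complex x) -> exists (r : R) (z l : 'rV[R]_(3 + 3) -> C),
  [/\ 0 < r, nbx r z, nbx r l, nbx r (fun h => (l h)^-1) & nbx r (fun h => g1 (z h)) /\
    forall h, box r h -> represents (to_complex (x + h) 0 1) (to_complex (x + h) 0 2) (z h, l h)].
Proof.
move=> /T_represents[z [l [/= hz l0 e2 e3]]].
have [d hd] := sdiff_G1 hz; have [L [rho [L0 /andP[rho0 _] hG]]] := sdiff_bound hd.
pose e := Num.min rho (nm l / 2).
have e0 : 0 < e by rewrite lt_min rho0 divr_gt0 // nm_gt0.
have [er el] : e <= rho /\ e <= nm l / 2 by rewrite !ge_min !lexx orbT.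
have [s s0 inv] := local_inverse hz l0 e0.
(* A complex coordinate has norm r + r on the box of radius r, hence half of the admissible size. *)
have r0 : 0 < s / 2 by rewrite divr_gt0.
have hs j : nb (s / 2) (fun h => ccoord h j) s by rewrite {2}[s]splitr; exact: nb_ccoord.
have [X [Y [hX hY hXY]]] := inv _ _ _ _ r0 (hs 1) (hs 2).
exists (s / 2), (fun h => z + X h), (fun h => l + Y h); split=> //.
- by apply: nbx_add; [exact: nbx_cst|exists e].
- by apply: nbx_add; [exact: nbx_cst|exists e].
- exact: nbx_inv hY.
split=> [|h hb].
  have h0 : nb (n := (3 + 3)%N) (s / 2) (fun=> 0) e.
    by apply: nb_le (nb_cst _ r0 (0 : C)); rewrite nm0 ltW.
  have hg := hG _ _ _ _ _ r0 er hX h0.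
  apply: nbx_ext (nbx_add (ex_intro _ _ hg) (nbx_cst _ r0 (G1 (z + 0)))) => h hb.
  have [hz' _ _] := hXY h hb; rewrite subrK; by have [-> _ _] := G123 hz'.
have [h1 h2 h3] := hXY h hb; rewrite !to_complexD -e2 -e3; split=> //=.
have := nb_val r0 hY hb; have := nm_le_add l (- Y h); rewrite opprK nmN => u1 u2.
rewrite -nm_gt0; have : 0 < nm l by rewrite nm_gt0.
by lra.
Qed.

Lemma F_nbx x : T (to_complex x) -> exists (r : R) (f1 f2 f3 : 'rV[R]_(3 + 3) -> C),
  [/\ 0 < r, nbx r f1, nbx r f2, nbx r f3 & forall h, box r h ->
    [/\ F1 (to_complex (x + h)) = f1 h, F2 (to_complex (x + h)) = f2 h &
        F3 (to_complex (x + h)) = f3 h]].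
Proof.
move=> /local_rep[r [z [l [r0 hz hl hi [hg hf]]]]].
have ht : nbx r (fun h => to_complex (x + h) 0 0).
  apply: (nbx_ext (f := fun h => to_complex x 0 0 + ccoord h 0)).
    by move=> h _; rewrite to_complexD.
  by apply: nbx_add; [exact: nbx_cst|exists (r + r); exact: nb_ccoord].
have hm : nbx r (fun h => mm (z h) (l h) (to_complex (x + h) 0 0)).
  by apply: nbx_sub; exact: nbx_mul.
have hd f : nbx r f -> nbx r (fun h => dIm (f h)).
  by move=> hh; apply: nbx_sub => //; exact: nbx_cj.
exists r, (fun h => E1 (z h) (l h)), (fun h => E2 (z h) (l h) (to_complex (x + h) 0 0)),
  (fun h => E3 (z h) (l h) (to_complex (x + h) 0 0)); split=> //.
- apply: (nbx_ext (f := fun h => dIm (z h) * ((l h)^-1 * cj (l h)^-1))).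
    by move=> h hb; rewrite /E1 invfM conjc_inv.
  by apply: nbx_mul => //; [exact: hd|apply: nbx_mul => //; exact: nbx_cj].
- apply: nbx_add; first by apply: nbx_mul => //; [exact: hd|apply: nbx_mul => //; exact: nbx_cj].
  by apply: hd; apply: nbx_mul => //; exact: nbx_cj.
- apply: nbx_mul => //; apply: nbx_add; first exact: nbx_cj.
  by apply: nbx_mul => //; [exact: nbx_cj|exact: hd].
- by move=> h hb; exact: F_represents (hf h hb).
Qed.

Lemma F_analytic : [/\ real_analytic_on (@T R) (@B1 R), real_analytic_on (@T R) (@B2 R) &
  complex_analytic_on (@T R) (@F3 R)].
Proof.
have hD u v : @hIm R (u + v) = hIm u + hIm v by rewrite /hIm raddfD /= mulrDl.
have hZ (c : C) (t : R) : hIm (c * t%:C%C) = hIm c * t.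
  by rewrite /hIm; case: c => a b /=; rewrite mulr0 add0r mulrAC.
have hn (w : C) : `|hIm w| <= nm w.
  rewrite /hIm normrM normfV (ger0_norm (ler0n R 2)); apply: le_trans (nm_Im w).
  by rewrite ler_piMr // invf_le1 // ler1n.
have RZ (c : C) (t : R) : complex.Re (c * t%:C%C) = complex.Re c * t.
  by case: c => a b /=; rewrite mulr0 subr0.
have IZ (c : C) (t : R) : complex.Im (c * t%:C%C) = complex.Im c * t.
  by case: c => a b /=; rewrite mulr0 add0r.
split; [|..|split] => x /F_nbx[r [f1 [f2 [f3 [r0 [M1 h1] [M2 h2] [M3 h3] hf]]]]].
- apply: (nb_analytic hD hZ hn r0 h1) => h hb.
  by have [e _ _] := hf h hb; rewrite /B1 /= e.
- apply: (nb_analytic hD hZ hn r0 h2) => h hb.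
  by have [_ e _] := hf h hb; rewrite /B2 /= e.
- apply: (nb_analytic (raddfD (@complex.Re R)) RZ (@nm_Re R) r0 h3) => h hb.
  by have [_ _ e] := hf h hb; rewrite /= e.
- apply: (nb_analytic (raddfD (@complex.Im R)) IZ (@nm_Im R) r0 h3) => h hb.
  by have [_ _ e] := hf h hb; rewrite /= e.
Qed.

End Analyticity.

(* The functions on T are represented by total functions on C^3 considered up
   to equality on T. *)
Theorem theorem2 (R : realType) :
  exists (B1 B2 : 'rV[R[i]]_3 -> R) (B3 : 'rV[R[i]]_3 -> R[i]),
    B_conditions B1 B2 B3 /\
    (forall (B1' B2' : 'rV[R[i]]_3 -> R) (B3' : 'rV[R[i]]_3 -> R[i]),
      B_conditions B1' B2' B3' ->
      forall t : 'rV[R[i]]_3, T t ->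
        [/\ B1' t = B1 t, B2' t = B2 t & B3' t = B3 t]) /\
    (forall t : 'rV[R[i]]_3, T t -> B2 t = 0 -> Normc.normc (B3 t) = 1).
Proof.
exists (@B1 R), (@B2 R), (@F3 R); split; [|split].
- split; first exact: F_analytic.
  split; last exact: B_equations.
  by move=> t1 t1' t2 t3 _; rewrite /B1 (F1_indep _ t1).
- move=> A1 A2 A3 [_ [ind [a1 a2 a3]]]; exact: B_determined.
- move=> t hT; have [z [l hf]] := T_represents hT; rewrite /B2.
  have [_ -> ->] := F_represents hf; apply: nm_E3.
  by case: hf.
Qed.
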